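(* Let $k,c$ be integers with $k,c\ge2$ and let $g(k,c)=2k(c\cdot k-c+2)+c(k-1)$. Let $G$ be a digraph with $n$ vertices, assume that we are given the bags of a bramble $\mathcal{B}$ in $G$ of congestion $c$ and size $|\mathcal{B}|\ge g(k,c)$, and let $S,T\subseteq V(G)$ with $S=\{s_1,\ldots,s_k\}$ and $T=\{t_1,\ldots,t_k\}$ (each of size $k$). Then in time $O(k^4\cdot n^2)$ one can do at least one of the following: 1. find a $\mathcal{B}^*\subseteq\mathcal{B}$ with $|\mathcal{B}^*|\ge g(k,c)-c(k-1)$ and an $(S,\bigcup\mathcal{B}^* )$-separator $X_S$ with $|X_S|\le k-1$ that is disjoint from all bags of $\mathcal{B}^*$; or 2. find a $\mathcal{B}^*\subseteq\mathcal{B}$ with $|\mathcal{B}^*|\ge g(k,c)-c(k-1)$ and a $(\bigcup\mathcal{B}^*,T)$-separator $X_T$ with $|X_T|\le k-1$ that is disjoint from all bags of $\mathcal{B}^*$; or 3. find a set of paths $\{P_1,\ldots,P_k\}$ in $G$ such that each $P_i$, $i\in[k]$, is a path from $s_i$ to $t_i$ and each vertex of $G$ appears in at most $c$ of these paths.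
   Context: Digraphs are finite; loops and parallel edges are allowed. $[k]=\{1,\ldots,k\}$. An $A\to B$ path is a path (possibly a single vertex) with first vertex in $A$ and last vertex in $B$; an $(A,B)$-separator in $G$ is a set $X\subseteq V(G)$ such that there are no $A\to B$ paths in $G\setminus X$. A bramble in $G$ is a collection $\mathcal{B}=\{B_1,\ldots,B_m\}$ of strongly connected subgraphs of $G$ (called bags) such that for all $B,B'\in\mathcal{B}$, either $V(B)\cap V(B')\ne\emptyset$, or $G$ has an edge from $V(B)$ to $V(B')$ and an edge from $V(B')$ to $V(B)$. Its size $|\mathcal{B}|$ is its number of bags. It has congestion $c$ if every vertex of $G$ appears in at most $c$ bags. $\bigcup\mathcal{B}^*$ denotes the set of all vertices appearing in bags of $\mathcal{B}^*$.
   Formalization: The constant hidden in O(k^4 n^2) may depend on c; a constant uniform in c is impossible, since outcomes 1 and 2 require producing at least 2ck(k-1) bags while c is not bounded in terms of k and n. *)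

(* Defs.v *)
From mathcomp Require Import all_boot.

Set Implicit Arguments.
Unset Strict Implicit.
Unset Printing Implicit Defensive.

(** * Digraphs, separators, brambles *)

(* Finite directed multigraphs: loops and parallel edges are allowed. *)
Record digraph (V : finType) := Digraph {
  edge : finType;
  src : edge -> V;
  tgt : edge -> V }.

Arguments src {V d} _.
Arguments tgt {V d} _.

Section Digraphs.
Variables (V : finType) (G : digraph V).

Definition multiplicity (u v : V) : nat :=
  #|[set e : edge G | (src e == u) && (tgt e == v)]|.

Definition arc : rel V :=
  fun u v => [exists e : edge G, (src e == u) && (tgt e == v)].

(* The vertex sequence of the path is [x :: p]; a path does not repeat
   vertices, and [p = [::]] is the single-vertex path. *)
Definition dipath (x : V) (p : seq V) (y : V) : bool :=
  [&& path arc x p, uniq (x :: p) & last x p == y].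

Definition separator (A B X : {set V}) : Prop :=
  ~ exists x p y, [/\ x \in A, y \in B, dipath x p y
                    & all (fun v => v \notin X) (x :: p)].

Record subgraph := Subgraph {
  sverts : {set V};
  sedges : {set edge G};
  sedgesP : forall e, e \in sedges -> (src e \in sverts) && (tgt e \in sverts) }.

Definition sarc (H : subgraph) : rel V :=
  fun u v => [exists e in sedges H, (src e == u) && (tgt e == v)].

Definition strongly_connected (H : subgraph) : Prop :=
  forall u v, u \in sverts H -> v \in sverts H -> connect (sarc H) u v.

Definition edge_between (A B : {set V}) : Prop :=
  exists e : edge G, src e \in A /\ tgt e \in B.

Definition touching (A B : {set V}) : Prop :=
  A :&: B != set0 \/ (edge_between A B /\ edge_between B A).

(* The case [i = j] of the second condition rules out empty bags.  The bags
   form an indexed family, so repetitions are permitted and count separately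
   in the size [m] and in the congestion. *)
Definition bramble (m : nat) (B : 'I_m -> subgraph) : Prop :=
  (forall i, strongly_connected (B i)) /\
  (forall i j, touching (sverts (B i)) (sverts (B j))).

Definition congestion (m : nat) (B : 'I_m -> subgraph) (c : nat) : Prop :=
  forall v : V, #|[set i | v \in sverts (B i)]| <= c.

(* Vertices appearing in the bags of the subfamily indexed by [I]. *)
Definition bag_union (m : nat) (B : 'I_m -> subgraph) (I : {set 'I_m}) :
    {set V} :=
  \bigcup_(i in I) sverts (B i).

End Digraphs.

Definition g (k c : nat) : nat := 2 * k * (c * k - c + 2) + c * (k - 1).

(** * Machine model *)

(* A random access machine with the uniform cost criterion, presented as a
   structured language.  A program is a finite syntactic object; it acts on
   scalar registers and on two-dimensional arrays, all holding natural
   numbers.  Multiplication is not a primitive, which excludes the known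
   abuses of unit-cost multiplication on unbounded numbers.  Subtraction is
   truncated and the tests evaluate to 0 or 1. *)
Inductive expr : Type :=
| Lit of nat
| Reg of nat
| Cell of nat & expr & expr  (* array name, row, column *)
| Add of expr & expr
| Sub of expr & expr
| Eqn of expr & expr
| Leq of expr & expr.

Inductive cmd : Type :=
| Skip
| SetReg of nat & expr
| SetCell of nat & expr & expr & expr
| Seq of cmd & cmd
| If of expr & cmd & cmd
| While of expr & cmd.

Record state := State {
  reg : nat -> nat;
  arr : nat -> nat -> nat -> nat }.

Definition set_reg (st : state) (x v : nat) : state :=
  State (fun y => if y == x then v else reg st y) (arr st).

Definition set_cell (st : state) (a i j v : nat) : state :=
  State (reg st)
    (fun a' i' j' =>
       if [&& a' == a, i' == i & j' == j] then v else arr st a' i' j').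

Fixpoint eval (st : state) (e : expr) : nat :=
  match e with
  | Lit v => v
  | Reg x => reg st x
  | Cell a e1 e2 => arr st a (eval st e1) (eval st e2)
  | Add e1 e2 => eval st e1 + eval st e2
  | Sub e1 e2 => eval st e1 - eval st e2
  | Eqn e1 e2 => eval st e1 == eval st e2
  | Leq e1 e2 => eval st e1 <= eval st e2
  end.

(* Every node of the expression costs one step. *)
Fixpoint ecost (e : expr) : nat :=
  match e with
  | Lit _ | Reg _ => 1
  | Cell _ e1 e2 | Add e1 e2 | Sub e1 e2 | Eqn e1 e2 | Leq e1 e2 =>
      (ecost e1 + ecost e2).+1
  end.

(* [exec p st t st']: started in [st], the program [p] halts in [st'] after
   exactly [t] steps. *)
Inductive exec : cmd -> state -> nat -> state -> Prop :=
| exec_skip st : exec Skip st 1 st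
| exec_set_reg st x e :
    exec (SetReg x e) st (ecost e).+1 (set_reg st x (eval st e))
| exec_set_cell st a e1 e2 e :
    exec (SetCell a e1 e2 e) st (ecost e1 + ecost e2 + ecost e).+1
      (set_cell st a (eval st e1) (eval st e2) (eval st e))
| exec_seq p1 p2 st1 st2 st3 t1 t2 :
    exec p1 st1 t1 st2 -> exec p2 st2 t2 st3 ->
    exec (Seq p1 p2) st1 (t1 + t2) st3
| exec_if e p1 p2 st st' t :
    exec (if eval st e != 0 then p1 else p2) st t st' ->
    exec (If e p1 p2) st (ecost e + t).+1 st'
| exec_while_stop e p st :
    eval st e = 0 -> exec (While e p) st (ecost e).+1 st
| exec_while_step e p st1 st2 st3 t1 t2 :
    eval st1 e != 0 -> exec p st1 t1 st2 -> exec (While e p) st2 t2 st3 ->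
    exec (While e p) st1 (ecost e + t1 + t2).+1 st3.

(** * Input and output conventions *)

(* [at_ord f i] is [f i] if [i] is in range, and 0 otherwise. *)
Definition at_ord (n : nat) (f : 'I_n -> nat) (i : nat) : nat :=
  if insub i is Some i' then f i' else 0.

(* Registers 0-3 hold [n], [k], [c], [m]; array 0 is the adjacency matrix
   (with multiplicities) of [G]; row [i] of array 1 is the characteristic
   vector of the vertex set of the bag [B i]; rows 0 and 1 of array 2 list
   [s] and [t].  Everything else is 0.  The edge sets of the bags are not
   supplied. *)
Definition input (n k c m : nat) (G : digraph 'I_n) (B : 'I_m -> subgraph G)
    (s t : 'I_k -> 'I_n) : state :=
  State (nth 0 [:: n; k; c; m])
    (fun a i j =>
       match a with
       | 0 => at_ord (fun u => at_ord (fun v => multiplicity G u v) j) i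
       | 1 => at_ord (fun b => at_ord (fun v => v \in sverts (B b) : nat) j) i
       | 2 => match i with
              | 0 => at_ord (fun l => s l : nat) j
              | 1 => at_ord (fun l => t l : nat) j
              | _ => 0
              end
       | _ => 0
       end).

(* Output lists are rows of array 3, with the length in column 0. *)
Definition out_list (st : state) (i : nat) : seq nat :=
  mkseq (fun j => arr st 3 i j.+1) (arr st 3 i 0).

Definition out_set (N : nat) (st : state) (i : nat) (A : {set 'I_N}) : Prop :=
  exists2 l : seq 'I_N, out_list st i = map val l & A = [set x in l].

(* Row 0 lists the indices of the subfamily, row 1 lists the separator. *)
Definition found_separator_from (n k c m : nat) (G : digraph 'I_n)
    (B : 'I_m -> subgraph G) (s : 'I_k -> 'I_n) (st : state) : Prop :=
  exists (I : {set 'I_m}) (X : {set 'I_n}),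
    [/\ out_set st 0 I /\ out_set st 1 X,
        #|I| >= g k c - c * (k - 1),
        separator G [set s l | l : 'I_k] (bag_union B I) X,
        #|X| <= k - 1
      & forall i, i \in I -> [disjoint X & sverts (B i)]].

Definition found_separator_to (n k c m : nat) (G : digraph 'I_n)
    (B : 'I_m -> subgraph G) (t : 'I_k -> 'I_n) (st : state) : Prop :=
  exists (I : {set 'I_m}) (X : {set 'I_n}),
    [/\ out_set st 0 I /\ out_set st 1 X,
        #|I| >= g k c - c * (k - 1),
        separator G (bag_union B I) [set t l | l : 'I_k] X,
        #|X| <= k - 1
      & forall i, i \in I -> [disjoint X & sverts (B i)]].

(* Row [l] lists the vertices [s l :: P l] of the [l]-th path, in order. *)
Definition found_linkage (n k c : nat) (G : digraph 'I_n)
    (s t : 'I_k -> 'I_n) (st : state) : Prop :=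
  exists P : 'I_k -> seq 'I_n,
    [/\ forall l : 'I_k, out_list st l = map val (s l :: P l),
        forall l, dipath G (s l) (P l) (t l)
      & forall v : 'I_n, #|[set l | v \in s l :: P l]| <= c].

(* On termination, register 0 tells which of the three outcomes is returned. *)
Definition correct_output (n k c m : nat) (G : digraph 'I_n)
    (B : 'I_m -> subgraph G) (s t : 'I_k -> 'I_n) (st : state) : Prop :=
  [\/ reg st 0 = 1 /\ found_separator_from c B s st,
      reg st 0 = 2 /\ found_separator_to c B t st
    | reg st 0 = 3 /\ found_linkage c G s t st].

(* Main.v *)
Require Import Defs.
From mathcomp Require Import all_boot zify.

Set Implicit Arguments.
Unset Strict Implicit.
Unset Printing Implicit Defensive.

(** Let [rho = c * (k - 1) + 1], so that fewer than [k] vertices hit fewer than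
    [rho] bags, and [g k c = 2 * k * (rho + 1) + c * (k - 1)].

    Disjoint paths from [k] sources to distinct available bags are computed by
    augmentations.  If this fails, there are a set [X] of vertices and a set [Y]
    of available bags such that [#|X| + #|Y| < k] and all available bags reached
    from the sources in the complement of [X] are in [Y] ([cut_bags],
    [cut_card]).  As
    long as more than [c * (k - 1)] bags are available, some available bag [b]
    is outside of [Y] and disjoint from [X]; every bag missed by [X] touches [b],
    so none of them is reached ([cut_isolates]).  Thus [X] is a separator as in
    the first outcome, or the second one when the arcs are reversed, and the
    bags missed by [X] are the required subfamily.

    Otherwise the paths are chosen so that every vertex that they leave lies in
    no available bag besides the [k] final ones, which then become unavailable.
    There are [rho] such rounds for [s], and then [rho] rounds for [t] in the
    reversed digraph.  For each side, let [F] be the set of the final bags of its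
    rounds, and [H] the set of the vertices left by the paths of these rounds and
    of all vertices in the bags of [F].  A vertex of [H] is in a bag of [F] or in
    no bag that is still available at the end.

    The point of the rounds is that [k] disjoint paths from the sources to
    available bags now exist within [H], up to their last vertices
    ([final_menger]).  Indeed a set [X] of fewer than [k] vertices misses one
    path of each round, hence leaves [rho] bags of [F] reached
    ([progress_round]), and cannot hit all of them; a bag that is reached within
    [H] and missed by [X] leads to all available bags missed by [X], so there is
    no cut.  One such computation for [s] and another one for [t] give distinct
    bags [U1 j] and [U2 j], and since these touch, the union of the two paths and
    the two bags contains a path from [s j] to [t j].  A vertex is in at most [c]
    of these unions, because it is in at most [c] bags and the bags of [F] for [s],
    those for [t], and the bags [U1 j] and [U2 j] are all distinct; a vertex that
    the paths meet outside of these bags is in at most one path for [s] and one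
    for [t], and [2 <= c] ([final_load]).

    The augmentations work on a bipartite graph with the vertices on the left,
    and the vertices and bags on the right ([holed_matching]); the failure of a
    search is a violation of the condition of Hall.  The required choice of the
    paths costs nothing: it suffices that a search stops at the first node from
    which it discovers a free bag ([mate_settled], [move_hole]).

    The program is written with counted loops whose bounds do not change, so its
    running time follows from the nesting of the loops ([run_time]).  As the
    bags are nonempty and a vertex is in at most [c] of them, there are at most
    [c * n] bags; loops over vertices and bags are nested at most twice, as are
    loops over paths and rounds, whence a bound of the order of [k ^ 2 * n ^ 2]
    for a fixed [c]. *)

(** * Loop programs *)

(** The procedure is written with counted loops only: [LFor x h p] runs [p]
    with register [x] equal to 0, ..., [reg h - 1].  Such a program is a total
    function on states, and its running time can be read off its syntax. *)
Inductive loop : Type :=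
| LSkip
| LReg of nat & expr
| LCell of nat & expr & expr & expr
| LSeq of loop & loop
| LIf of expr & loop & loop
| LFor of nat & nat & loop.

Fixpoint compile (p : loop) : cmd :=
  match p with
  | LSkip => Skip
  | LReg x e => SetReg x e
  | LCell a e1 e2 e => SetCell a e1 e2 e
  | LSeq p1 p2 => Seq (compile p1) (compile p2)
  | LIf e p1 p2 => If e (compile p1) (compile p2)
  | LFor x h p =>
      Seq (SetReg x (Lit 0))
        (While (Leq (Add (Reg x) (Lit 1)) (Reg h))
           (Seq (compile p) (SetReg x (Add (Reg x) (Lit 1)))))
  end.

Fixpoint run (p : loop) (st : state) : state :=
  match p with
  | LSkip => st
  | LReg x e => set_reg st x (eval st e)
  | LCell a e1 e2 e => set_cell st a (eval st e1) (eval st e2) (eval st e)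
  | LSeq p1 p2 => run p2 (run p1 st)
  | LIf e p1 p2 => if eval st e != 0 then run p1 st else run p2 st
  | LFor x h p =>
      iteri (reg st h) (fun i st1 => set_reg (run p st1) x i.+1)
        (set_reg st x 0)
  end.

Fixpoint written_regs (p : loop) : seq nat :=
  match p with
  | LSkip | LCell _ _ _ _ => [::]
  | LReg x _ => [:: x]
  | LSeq p1 p2 | LIf _ p1 p2 => written_regs p1 ++ written_regs p2
  | LFor x h p => x :: written_regs p
  end.

Fixpoint written_arrs (p : loop) : seq nat :=
  match p with
  | LSkip | LReg _ _ => [::]
  | LCell a _ _ _ => [:: a]
  | LSeq p1 p2 | LIf _ p1 p2 => written_arrs p1 ++ written_arrs p2
  | LFor x h p => written_arrs p
  end.

Lemma run_reg p st y : y \notin written_regs p -> reg (run p st) y = reg st y.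
Proof.
elim: p st => //= [x e|p1 IH1 p2 IH2|e p1 IH1 p2 IH2|x h p IH] st.
- by rewrite inE => /negbTE->.
- by rewrite mem_cat negb_or => /andP[h1 h2]; rewrite IH2 ?IH1.
- by rewrite mem_cat negb_or => /andP[h1 h2]; case: ifP => _; rewrite (IH1, IH2).
rewrite inE negb_or => /andP[/negbTE yx h2].
by elim: (reg st h) => [|i IHi] /=; rewrite yx // IH.
Qed.

Lemma run_arr p st a i j :
  a \notin written_arrs p -> arr (run p st) a i j = arr st a i j.
Proof.
elim: p st => //= [b e1 e2 e|p1 IH1 p2 IH2|e p1 IH1 p2 IH2|x h p IH] st.
- by rewrite inE => /negbTE->.
- by rewrite mem_cat negb_or => /andP[h1 h2]; rewrite IH2 ?IH1.
- by rewrite mem_cat negb_or => /andP[h1 h2]; case: ifP => _; rewrite (IH1, IH2).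
by move=> h2; elim: (reg st h) => [|l IHl] //=; rewrite IH.
Qed.

Definition frame (p : loop) (st st1 : state) : Prop :=
  (forall y, y \notin written_regs p -> reg st1 y = reg st y) /\
  (forall a, a \notin written_arrs p -> forall i j, arr st1 a i j = arr st a i j).

Lemma run_frame p st : frame p st (run p st).
Proof. by split=> [y|a ha i j]; [exact: run_reg | exact: run_arr]. Qed.

(** The frame hypothesis allows invariants to mention only what the body
    writes. *)
Lemma for_ind (Inv : nat -> state -> Prop) x h p st :
  Inv 0 (set_reg st x 0) ->
  (forall i st1, i < reg st h -> frame (LFor x h p) st st1 -> reg st1 x = i ->
     Inv i st1 -> Inv i.+1 (set_reg (run p st1) x i.+1)) ->
  Inv (reg st h) (run (LFor x h p) st).
Proof.
move=> I0 IS /=.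
set F := fun i st1 => _.
suff: forall i, i <= reg st h ->
  [/\ Inv i (iteri i F (set_reg st x 0)),
      reg (iteri i F (set_reg st x 0)) x = i
    & frame (LFor x h p) st (iteri i F (set_reg st x 0))].
  by move/(_ _ (leqnn _)) => [].
elim=> [_|i IH lti] /=.
  split=> //=; first by rewrite eqxx.
  by split=> //= y; rewrite inE negb_or => /andP[/negbTE->].
have [Ii rx fr] := IH (ltnW lti); split; first exact: IS.
  by rewrite /= eqxx.
case: fr => /= fr fa; split=> /= [y hy|a ha l j]; last by rewrite run_arr ?fa.
by move: (hy); rewrite inE negb_or => /andP[/negbTE -> h2]; rewrite run_reg ?fr.
Qed.

(** * Running times *)

Fixpoint bound_regs (p : loop) : seq nat :=
  match p with
  | LSkip | LReg _ _ | LCell _ _ _ _ => [::]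
  | LSeq p1 p2 | LIf _ p1 p2 => bound_regs p1 ++ bound_regs p2
  | LFor x h p => h :: bound_regs p
  end.

Fixpoint well_bounded (p : loop) : bool :=
  match p with
  | LSkip | LReg _ _ | LCell _ _ _ _ => true
  | LSeq p1 p2 | LIf _ p1 p2 => well_bounded p1 && well_bounded p2
  | LFor x h p =>
      [&& h != x, h \notin written_regs p, x \notin written_regs p
        & well_bounded p]
  end.

Fixpoint code_size (p : loop) : nat :=
  match p with
  | LSkip => 1
  | LReg x e => (ecost e).+1
  | LCell a e1 e2 e => (ecost e1 + ecost e2 + ecost e).+1
  | LSeq p1 p2 => code_size p1 + code_size p2
  | LIf e p1 p2 => (ecost e + (code_size p1 + code_size p2)).+1
  | LFor x h p => code_size p + 10
  end.

(** Loops are of two kinds, according to whether their bounds are of the order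
    of the number of vertices or of the number of paths; [P] selects a kind, so
    that the two orders of magnitude are accounted for separately. *)
Fixpoint depth (P : pred nat) (p : loop) : nat :=
  match p with
  | LSkip | LReg _ _ | LCell _ _ _ _ => 0
  | LSeq p1 p2 | LIf _ p1 p2 => maxn (depth P p1) (depth P p2)
  | LFor x h p => P h + depth P p
  end.

(** Every instruction is charged once for each iteration of the loops around
    it, and there are at most [D ^ depth P p * K ^ depth (predC P) p] of these;
    the overhead of a loop is charged to its body, whence the summand 10 in
    [code_size]. *)
Lemma run_time (P : pred nat) (D K : nat) p st :
  0 < D -> 0 < K -> well_bounded p ->
  {in bound_regs p, forall h, h \notin written_regs p} ->
  {in bound_regs p, forall h, reg st h < (if P h then D else K)} ->
  exists2 t, exec (compile p) st t (run p st) &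
    t <= code_size p * (D ^ depth P p * K ^ depth (predC P) p).
Proof.
move=> D0 K0.
have pos a b : 0 < D ^ a * K ^ b by rewrite muln_gt0 !expn_gt0 D0 K0.
have mon a b a' b' : a <= a' -> b <= b' -> D ^ a * K ^ b <= D ^ a' * K ^ b'.
  by move=> ha hb; apply: leq_mul; apply: leq_pexp2l.
elim: p st => [|x e|a e1 e2 e|p1 IH1 p2 IH2|e p1 IH1 p2 IH2|x h p IH] st /=.
- by exists 1; [exact: exec_skip | rewrite mul1n].
- by exists (ecost e).+1; [exact: exec_set_reg | rewrite muln1].
- by exists (ecost e1 + ecost e2 + ecost e).+1; [exact: exec_set_cell | rewrite muln1].
- move=> /andP[w1 w2] ww bb.
  have [||t1 r1 h1] := IH1 st w1.
  + move=> y hy; have := ww y; rewrite !mem_cat hy => /(_ isT).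
    by rewrite negb_or => /andP[].
  + by move=> y hy; apply: bb; rewrite mem_cat hy.
  have [||t2 r2 h2] := IH2 (run p1 st) w2.
  + move=> y hy; have := ww y; rewrite !mem_cat hy orbT => /(_ isT).
    by rewrite negb_or => /andP[].
  + move=> y hy; have := ww y; rewrite !mem_cat hy orbT => /(_ isT).
    rewrite negb_or => /andP[hy1 _]; rewrite run_reg //.
    by apply: bb; rewrite mem_cat hy orbT.
  exists (t1 + t2); first exact: exec_seq r1 r2.
  rewrite mulnDl; apply: leq_add; [apply: leq_trans h1 _|apply: leq_trans h2 _].
    by rewrite leq_mul2l mon ?orbT // leq_maxl.
  by rewrite leq_mul2l mon ?orbT // leq_maxr.
- move=> /andP[w1 w2] ww bb.
  have H : exists2 t, exec (if eval st e != 0 then compile p1 else compile p2) st t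
       (if eval st e != 0 then run p1 st else run p2 st) &
      t <= (code_size p1 + code_size p2) *
           (D ^ maxn (depth P p1) (depth P p2) *
            K ^ maxn (depth (predC P) p1) (depth (predC P) p2)).
    case: ifP => _.
    + have [||t1 r1 h1] := IH1 st w1.
      * move=> y hy; have := ww y; rewrite !mem_cat hy => /(_ isT).
        by rewrite negb_or => /andP[].
      * by move=> y hy; apply: bb; rewrite mem_cat hy.
      exists t1 => //; apply: leq_trans h1 _.
      by apply: leq_mul; [apply: leq_addr | apply: mon; apply: leq_maxl].
    + have [||t1 r1 h1] := IH2 st w2.
      * move=> y hy; have := ww y; rewrite !mem_cat hy orbT => /(_ isT).
        by rewrite negb_or => /andP[].
      * by move=> y hy; apply: bb; rewrite mem_cat hy orbT.
      exists t1 => //; apply: leq_trans h1 _.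
      by apply: leq_mul; [apply: leq_addl | apply: mon; apply: leq_maxr].
  case: H => t r ht; exists (ecost e + t).+1; first exact: exec_if.
  rewrite -!addSn mulnDl; apply: leq_add => //.
  have := pos (maxn (depth P p1) (depth P p2))
            (maxn (depth (predC P) p1) (depth (predC P) p2)).
  by nia.
move=> /and4P[hx hw xw wb] ww bb.
set q := LFor x h p.
set tb := code_size p * (D ^ depth P p * K ^ depth (predC P) p).
set F := fun i st1 => set_reg (run p st1) x i.+1.
have hh : reg st h < (if P h then D else K) by apply: bb; rewrite mem_head.
suff: forall l st1, frame q st st1 -> reg st1 x + l = reg st h ->
  exists2 t, exec (While (Leq (Add (Reg x) (Lit 1)) (Reg h))
           (Seq (compile p) (SetReg x (Add (Reg x) (Lit 1))))) st1 t
     (iteri l (fun i st2 => set_reg (run p st2) x (reg st1 x + i).+1) st1)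
     & t <= l * (tb + 10) + 6.
  have f0 : frame q st (set_reg st x 0).
    by split=> //= y; rewrite inE negb_or => /andP[/negbTE->].
  move/(_ (reg st h) (set_reg st x 0) f0) => /=; rewrite eqxx.
  case=> // t r ht; exists (2 + t); first by apply: exec_seq r; apply: exec_set_reg.
  apply: (@leq_trans ((reg st h).+1 * (tb + 10))); first by lia.
  apply: (@leq_trans ((if P h then D else K) * (tb + 10))).
    by rewrite leq_mul2r hh orbT.
  have := pos (depth P p) (depth (predC P) p).
  rewrite !expnD /tb; set T := D ^ _ * K ^ _ => T0.
  have -> : (if P h then D else K) = D ^ P h * K ^ (~~ P h).
    by case: (P h) => /=; rewrite ?expn1 ?expn0 ?muln1 ?mul1n.
  rewrite mulnACA -/T; set c0 := D ^ _ * K ^ _.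
  rewrite [X in _ <= X]mulnCA leq_mul2l; apply/orP; right.
  by rewrite mulnDl leq_add2l leq_pmulr.
have rh st1 : frame q st st1 -> reg st1 h = reg st h.
  by case=> -> //=; rewrite ?inE ?negb_or ?hx.
elim=> [|l IHl] st1 fr e1.
  by exists 6 => //=; apply: exec_while_stop; rewrite /= rh //; lia.
have [||t1 r1 h1] := IH st1 wb.
- move=> y hy; have := ww y; rewrite !inE hy orbT => /(_ isT).
  by rewrite negb_or => /andP[].
- move=> y hy; have y1 : y \in h :: bound_regs p by rewrite inE hy orbT.
  by case: fr => -> *; [exact: bb | exact: ww].
have ex : eval (run p st1) (Add (Reg x) (Lit 1)) = (reg st1 x).+1.
  by rewrite /= run_reg // addn1.
have [||t2 r2 h2] := IHl (set_reg (run p st1) x (reg st1 x).+1).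
- case: fr => /= fr fa; split=> /= [y hy|a ha i j]; last by rewrite run_arr ?fa.
  by move: (hy); rewrite inE negb_or => /andP[/negbTE -> h3]; rewrite run_reg ?fr.
- by rewrite /= eqxx; lia.
exists (5 + (t1 + 4) + t2).+1; last by rewrite mulSn; lia.
have -> : iteri l.+1 (fun i st2 => set_reg (run p st2) x (reg st1 x + i).+1) st1
  = iteri l (fun i st2 => set_reg (run p st2) x
       (reg (set_reg (run p st1) x (reg st1 x).+1) x + i).+1)
     (set_reg (run p st1) x (reg st1 x).+1).
  rewrite /= eqxx; elim: (l) => [|j IHj] /=; first by rewrite addn0.
  by rewrite -IHj addSnnS.
apply: exec_while_step r2; first by rewrite /= rh //; lia.
apply: exec_seq r1 _; rewrite -ex.
exact: (exec_set_reg (run p st1) x (Add (Reg x) (Lit 1))).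
Qed.

(** * Disjoint paths as matchings *)

Definition upd (f : nat -> nat) (x v : nat) : nat -> nat :=
  fun y => if y == x then v else f y.

Section Matching.

Variables (n m k : nat) (adj : rel nat) (src : nat -> nat).
Hypothesis src_lt : forall j, j < k -> src j < n.
Hypothesis adj_src : forall l j, l < n -> j < k -> ~~ adj l (src j).
Hypothesis adj_refl : forall l, l < n -> (forall j, j < k -> l != src j) -> adj l l.

(** Every vertex [l < n] occurs on the left; the right nodes are the vertices
    and, from [n] on, the [m] bags.  Matching [l] to itself means that no path
    leaves [l], matching it to another vertex that a path proceeds there, and
    matching it to a bag that a path ends in this bag.  The matching is given by
    its inverse, with [mate r = n] when [r] is free.  No arc enters a source:
    the first [i] sources have been treated and stay free on the right, the
    others are still matched to themselves.  The node [w] is a hole, that is,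
    the free node in the middle of an augmentation (none when [w = n + m]).

    By [mate_settled], a vertex that is left by a path lies in no bag that is
    still free.  This invariant of the augmentations makes the paths stop at the
    first bag that is not the final bag of another path. *)
Record holed_matching (i w : nat) (mate : nat -> nat) : Prop := HoledMatching {
  mate_le : forall r, r < n + m -> mate r <= n;
  mate_inj : forall r r', r < n + m -> r' < n + m -> mate r < n ->
    mate r = mate r' -> r = r';
  mate_sur : forall l, l < n -> exists2 r, r < n + m & mate r = l;
  mate_adj : forall r, r < n + m -> mate r < n ->
    adj (mate r) r \/
    exists2 j, i <= j < k & r = src j /\ mate r = r;
  mate_tot : forall r, r < n -> r != w -> (forall j, j < i -> r != src j) ->
    mate r < n;
  mate_done : forall j, j < i -> mate (src j) = n;
  mate_settled : forall r b, r < n -> mate r < n -> mate r != r -> b < m ->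
    adj (mate r) (n + b) -> mate (n + b) < n \/ n + b = w;
  mate_hole : w < n + m -> mate w = n }.

Definition matching (i : nat) := holed_matching i (n + m).

(** All vertices matched to themselves: the empty family of paths. *)
Lemma matching_init : matching 0 (fun r => if r < n then r else n).
Proof.
have src_or r : (exists2 j, j < k & r = src j) \/ (forall j, j < k -> r != src j).
  have [/existsP[j /eqP e]|/existsPn h] := boolP [exists j : 'I_k, r == src j].
    by left; exists j.
  by right=> j ltj; exact: (h (Ordinal ltj)).
split=> //=.
- by move=> r _; case: ltnP => // /ltnW.
- by move=> r r' _ _; case: (ltnP r n); rewrite ?ltnn // => ltr _; case: ltnP => //; lia.
- by move=> l ltl; exists l; [exact: ltn_addr | rewrite ltl].
- move=> r _; case: (ltnP r n) => [ltr _|]; last by rewrite ltnn.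
  case: (src_or r) => [[j ltj e]|h]; [right|left; exact: adj_refl].
  by exists j.
- by move=> r ltr; rewrite ltr.
- by move=> r b ->; rewrite eqxx.
- by rewrite ltnn.
Qed.

Lemma open_hole i w mate :
  matching i mate -> mate w = n -> holed_matching i w mate.
Proof.
case=> hle hinj hsur hadj htot hdone hset _ hw; split=> //.
- by move=> r ltr _; apply: htot => //; apply/eqP; lia.
- move=> r b ltr hr hrr hb hbb; left.
  by case: (hset r b) => //; lia.
Qed.

(** One step of an augmentation.  Only [mate_settled] needs care, when [w] is a
    vertex: then the mate of [p] is about to be left by a path, and must not lie
    in a free bag. *)
Lemma move_hole i w p mate :
  i <= k -> holed_matching i w mate -> w < n + m -> p < n + m -> p != w ->
  mate p < n -> adj (mate p) w ->
  (w < n -> forall b, b < m -> adj (mate p) (n + b) ->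
     mate (n + b) < n \/ n + b = w) ->
  holed_matching i p (upd (upd mate w (mate p)) p n).
Proof.
move=> lik [hle hinj hsur hadj htot hdone hset hhole] ltw ltp pw mp apw hs.
have mw := hhole ltw; have wp : (w == p) = false by rewrite eq_sym (negbTE pw).
rewrite /upd; split.
- by move=> r ltr; case: (r == p) => //; case: (r == w); rewrite ?hle // ltnW.
- move=> r r' ltr ltr'; case: (eqVneq r p) => [->|rp]; first by rewrite ltnn.
  case: (eqVneq r' p) => [_ ltv e|r'p]; first by rewrite e ltnn in ltv.
  case: (eqVneq r w) => [->|rw]; case: (eqVneq r' w) => [->|r'w] //.
  + by move=> _ e; have := hinj _ _ ltp ltr' mp e => e'; rewrite e' eqxx in r'p.
  + by move=> lt e; have := hinj _ _ ltr ltp lt e => e'; rewrite e' eqxx in rp.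
  + exact: hinj.
- move=> l ltl; have [r ltr e] := hsur l ltl.
  case: (eqVneq r p) => [rp|rp]; first by exists w; rewrite ?wp ?eqxx // -e rp.
  exists r; rewrite // (negbTE rp); case: eqP => // rw.
  by move: e; rewrite rw mw; lia.
- move=> r ltr; case: (eqVneq r p) => [->|rp]; first by rewrite ltnn.
  by case: (eqVneq r w) => [->|rw]; [left | exact: hadj].
- move=> r ltr rp hr; rewrite (negbTE rp).
  by case: (eqVneq r w) => // rw; exact: htot.
- move=> j ltj; case: eqP => // _; case: eqP => [e|_]; last exact: hdone.
  by move: apw; rewrite -e (negbTE (adj_src _ _)) //; lia.
- move=> r b ltr; case: (eqVneq r p) => [->|rp]; first by rewrite ltnn.
  case: (eqVneq (n + b) p) => [->|bp]; first by right.
  case: (eqVneq r w) => [rw|rw] hr hrr hb ha; last first.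
    case: (eqVneq (n + b) w) => [|bw]; first by left.
    by case: (hset r b) => //; [left | lia].
  left; case: (eqVneq (n + b) w) => // bw.
  by case: (hs _ b hb ha) => //; [rewrite -rw | lia].
- by rewrite eqxx.
Qed.

Lemma close_hole i mate :
  i < k -> holed_matching i (src i) mate -> matching i.+1 mate.
Proof.
move=> lik [hle hinj hsur hadj htot hdone hset hhole].
have hole : mate (src i) = n by apply: hhole; have := src_lt lik; lia.
split=> //.
- move=> r ltr hr; case: (hadj r ltr hr) => [|[j hj [e e']]]; first by left.
  right; exists j => //; case: (eqVneq i j) => [ij|]; last by lia.
  by move: hr; rewrite e -ij hole ltnn.
- move=> r ltr _ hr; apply: htot => //; first exact: hr.
  by move=> j hj; apply: hr; lia.
- move=> j hj; case: (eqVneq j i) => [->//|ji]; apply: hdone; lia.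
- move=> r b ltr hr hrr hb ha; case: (hset r b ltr hr hrr hb ha); first by left.
  by have := src_lt lik; lia.
- by rewrite ltnn.
Qed.

End Matching.

Lemma at_ordE n (f : 'I_n -> nat) (i : 'I_n) : at_ord f i = f i.
Proof. by rewrite /at_ord insubT //= => lt; congr f; apply: val_inj. Qed.

Lemma at_ord_lt n (f : 'I_n -> nat) i (lti : i < n) : at_ord f i = f (Ordinal lti).
Proof. exact: (at_ordE f (Ordinal lti)). Qed.

(** ** Following a matching from the sources *)

Section Orbits.

Variables (n m k : nat) (src f : nat -> nat).
Hypothesis src_lt : forall j, j < k -> src j < n.
Hypothesis src_inj : forall j j', j < k -> j' < k -> src j = src j' -> j = j'.
Hypothesis f_inj : forall l l', l < n -> l' < n -> f l = f l' -> l = l'.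
Hypothesis f_src : forall l j, l < n -> j < k -> f l <> src j.

Definition step (x : nat) : nat := if x < n then f x else x.

Lemma step_stop i x : n <= x -> iter i step x = x.
Proof. by move=> h; elim: i => //= i ->; rewrite /step ltnNge h. Qed.

Lemma orbit_prefix i j x : i <= j -> iter j step x < n -> iter i step x < n.
Proof.
move=> lij; rewrite -(subnK lij) iterD; case: (ltnP (iter i step x) n) => // h.
by rewrite step_stop // ltnNge h.
Qed.

Lemma orbit_inj i i' j j' : j < k -> j' < k -> iter i step (src j) < n ->
  iter i step (src j) = iter i' step (src j') -> i = i' /\ j = j'.
Proof.
move=> ltj ltj'; elim: i i' => [|i IH] [|i'] /=.
- by move=> _ /src_inj->.
- move=> lt e; case: (ltnP (iter i' step (src j')) n) => h.
    by move: e; rewrite {1}/step h => /esym /(f_src h).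
  by move: e; rewrite {1}/step ltnNge h /= => e; move: h; rewrite -e leqNgt lt.
- move=> lt e; have h := orbit_prefix (leqnSn i) lt.
  by move: e; rewrite {1}/step h => /(f_src h).
move=> lt e; have h := orbit_prefix (leqnSn i) lt.
have lt' : iter i'.+1 step (src j') < n by rewrite /= -e.
have h' := orbit_prefix (leqnSn i') lt'.
move: e; rewrite {1 3}/step h h' => /(f_inj h h') e.
by have [-> ->] := IH i' h e.
Qed.

(** An orbit takes distinct values as long as it stays among the vertices, so
    it leaves them within [n] steps. *)
Lemma orbit_leaves j : j < k ->
  exists2 d, d < n & iter d step (src j) < n /\ n <= iter d.+1 step (src j).
Proof.
move=> ltj.
have ex : exists i, (i <= n) && (n <= iter i step (src j)).
  have [lt|ge] := ltnP (iter n step (src j)) n; last by exists n; rewrite leqnn.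
  have : uniq (map (fun i => iter i step (src j)) (iota 0 n.+1)).
    rewrite map_inj_in_uniq ?iota_uniq // => i i'; rewrite !mem_iota => hi hi' e.
    by have [] := orbit_inj ltj ltj (@orbit_prefix i n (src j) _ lt) e; lia.
  move/uniq_leq_size => /(_ (iota 0 n)).
  rewrite size_map !size_iota ltnn => h; exfalso; suff: false by []; apply: h.
  move=> y /mapP[i]; rewrite !mem_iota => hi ->.
  by rewrite (@orbit_prefix i n) //; lia.
have [[|d] /andP[dn hd] hmin] := ex_minnP ex.
  by move: hd; rewrite /= leqNgt src_lt.
exists d => //; split=> //; rewrite ltnNge; apply/negP => h.
by have := hmin d; rewrite h (ltnW dn) => /(_ isT); rewrite ltnn.
Qed.

Lemma orbit_end j : j < k -> n <= iter n step (src j).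
Proof.
move=> ltj; have [d ltd [_ h]] := orbit_leaves ltj.
by have := iterD (n - d.+1) d.+1 step (src j); rewrite subnK // => ->; rewrite step_stop.
Qed.

Lemma orbit_last j : j < k -> exists2 d, d < n &
  iter d step (src j) < n /\ f (iter d step (src j)) = iter n step (src j).
Proof.
move=> ltj; have [d ltd [lt h]] := orbit_leaves ltj; exists d => //; split=> //.
have := iterD (n - d.+1) d.+1 step (src j); rewrite subnK // => ->.
by rewrite [RHS]step_stop // iterS /step lt.
Qed.

Lemma orbit_end_inj j j' : j < k -> j' < k ->
  iter n step (src j) = iter n step (src j') -> j = j'.
Proof.
move=> ltj ltj'; have [d ltd [lt <-]] := orbit_last ltj.
have [d' ltd' [lt' <-]] := orbit_last ltj' => /(f_inj lt lt').
by case/(orbit_inj ltj ltj' lt).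
Qed.

End Orbits.

(** * Cuts and brambles *)

Section Side.

Variables (n m k c : nat) (e : rel 'I_n) (bag : 'I_m -> {set 'I_n}).
Variable (s : 'I_k -> 'I_n).
Hypothesis s_inj : injective s.
Hypothesis bag_conn : forall i u v, u \in bag i -> v \in bag i ->
  connect (fun x y => [&& e x y, x \in bag i & y \in bag i]) u v.
Hypothesis bag_touch : forall i j, (exists2 v, v \in bag i & v \in bag j) \/
  (exists u v, [/\ u \in bag i, v \in bag j & e u v]).
Hypothesis bag_cong : forall v, #|[set i | v \in bag i]| <= c.

Definition sources : {set 'I_n} := [set s j | j : 'I_k].

(** The last vertex of a path need not be in [H]: a path may leave [H] when it
    reaches its final bag. *)
Definition lim_arc (H X : {set 'I_n}) : rel 'I_n :=
  fun u v => [&& e u v, u \in H & v \notin X].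

Definition reached (H X : {set 'I_n}) (v : 'I_n) : bool :=
  [exists j, (s j \notin X) && connect (lim_arc H X) (s j) v].

Lemma reached_trans H X u v : reached H X u -> connect (lim_arc H X) u v ->
  reached H X v.
Proof.
case/existsP=> j /andP[hj h1] h2; apply/existsP; exists j.
by rewrite hj (connect_trans h1 h2).
Qed.

Lemma reachedS (H H' X : {set 'I_n}) v : H \subset H' -> reached H X v -> reached H' X v.
Proof.
move=> sHH /existsP[j /andP[hj h]]; apply/existsP; exists j; rewrite hj /=.
apply: connect_sub h => x y /and3P[exy xH yX]; apply: connect1.
by rewrite /lim_arc exy (subsetP sHH) ?yX.
Qed.

Lemma reached_bag (H X : {set 'I_n}) i u v : bag i \subset H -> [disjoint X & bag i] ->
  u \in bag i -> v \in bag i -> reached H X u -> reached H X v.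
Proof.
move=> sH dX ui vi hu; apply: reached_trans hu _.
apply: connect_sub (bag_conn ui vi) => x y /and3P[exy xi yi]; apply: connect1.
by rewrite /lim_arc exy (subsetP sH) //= (disjointFl dX).
Qed.

Lemma reached_touch (H X : {set 'I_n}) i j u : bag i \subset H -> [disjoint X & bag i] ->
  [disjoint X & bag j] -> u \in bag i -> reached H X u ->
  exists2 v, v \in bag j & reached H X v.
Proof.
move=> sH di dj ui hu; case: (bag_touch i j) => [[v vi vj]|[x [y [xi yj exy]]]].
  by exists v => //; exact: (reached_bag sH di ui vi hu).
exists y => //; apply: (@reached_trans _ _ x); first exact: (reached_bag sH di ui xi hu).
by apply: connect1; rewrite /lim_arc exy (subsetP sH) //= (disjointFl dj).
Qed.

Lemma card_hit (X : {set 'I_n}) :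
  #|[set b | ~~ [disjoint X & bag b]]| <= c * #|X|.
Proof.
have -> : [set b | ~~ [disjoint X & bag b]] = \bigcup_(v in X) [set i | v \in bag i].
  apply/setP=> b; rewrite inE disjoint_subset; apply/idP/bigcupP.
    by case/subsetPn=> v vX; rewrite !inE negbK => vb; exists v; rewrite ?inE.
  by case=> v vX; rewrite inE => vb; apply/subsetPn; exists v; rewrite // !inE negbK.
  apply: leq_trans (_ : \sum_(v in X) #|[set i | v \in bag i]| <= _).
  elim/big_ind2: _ => [|A a B b hA hB|v _]; rewrite ?cards0 //.
  by apply: leq_trans (leq_card_setU _ _) _; exact: leq_add.
by rewrite mulnC -sum_nat_const; apply: leq_sum.
Qed.

(** The cut [(X, Y)] hits or contains at most [c * (k - 1)] bags, so some bag
    [b] of [A] is outside of [Y] and disjoint from [X].  A bag [i] missed by [X]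
    touches [b], so if a vertex of [i] were reached, then [b] would be reached
    as well, which the cut forbids.  Hence [X] alone separates the sources from
    all the bags that it misses, whether or not they are in [A]. *)
Lemma cut_isolates (H X : {set 'I_n}) (Y A : {set 'I_m}) i u :
  0 < c -> #|X| + #|Y| < k -> c * (k - 1) < #|A| ->
  (forall v b, reached H X v -> b \in A -> v \in bag b -> b \in Y) ->
  bag i \subset H -> [disjoint X & bag i] -> u \in bag i -> ~~ reached H X u.
Proof.
move=> c0 hXY hA cut sH di ui; apply/negP => hu.
have /subsetPn[b bA] : ~~ (A \subset Y :|: [set b | ~~ [disjoint X & bag b]]).
  apply: contraL hA => /subset_leq_card hle; rewrite -leqNgt.
  apply: leq_trans hle _; apply: leq_trans (leq_card_setU _ _) _.
  have h1 := card_hit X; have h2 : #|Y| <= c * #|Y| by rewrite leq_pmull.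
  have : c * (#|X| + #|Y|) <= c * (k - 1) by rewrite leq_mul2l; lia.
  by rewrite mulnDr; apply: leq_trans; rewrite addnC leq_add.
rewrite !inE negb_or negbK => /andP[bY db].
have [v vb hv] := reached_touch sH di db ui hu.
by rewrite (cut v b) in bY.
Qed.

(** A failed search yields a set violating the condition of Hall, and this set
    translates into a cut: the left side [L] consists of the mates of the nodes
    that are found, [X] of the vertices outside of [L] that are sources or are
    found, and [Y] of the bags that are found. *)
Variables (adj : rel nat) (H : {set 'I_n}) (A : {set 'I_m}).
Hypothesis adjV : forall u v : 'I_n,
  adj u v = (v \notin sources) && ((u == v) || (u \in H) && e u v).
Hypothesis adjB : forall (u : 'I_n) (b : 'I_m),
  adj u (n + b) = (b \in A) && (u \in bag b).

Let src := at_ord (fun j => s j : nat).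

Lemma src_lt j : j < k -> src j < n.
Proof. by move=> lt; rewrite /src at_ord_lt. Qed.

Lemma src_inj j j' : j < k -> j' < k -> src j = src j' -> j = j'.
Proof.
move=> lt lt'; rewrite /src (at_ord_lt _ lt) (at_ord_lt _ lt').
by move/val_inj/s_inj=> [].
Qed.

Lemma src_source j (lt : j < k) : s (Ordinal lt) = src j :> nat.
Proof. by rewrite /src at_ord_lt. Qed.

Section Cut.

Variables (i : nat) (mate : nat -> nat) (q : seq nat).
Hypothesis lt_ik : i < k.
Hypothesis mate_ok : matching n m k adj src i mate.
Hypothesis q_uniq : uniq q.
Hypothesis q_lt : {in q, forall x, x < n + m}.
Hypothesis q_src : src i \in q.
Hypothesis q_mated : {in q, forall x, mate x < n}.
Hypothesis q_closed : forall x y, x \in q -> y < n + m -> adj (mate x) y -> y \in q.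

Definition left_side : {set 'I_n} := [set u : 'I_n | has (fun x => mate x == u) q].
Definition cutV : {set 'I_n} :=
  [set u | (u \notin left_side) && ((u \in sources) || ((u : nat) \in q))].
Definition cutB : {set 'I_m} := [set b : 'I_m | n + b \in q].

Lemma left_sideP (u : 'I_n) : reflect (exists2 x, x \in q & mate x = u) (u \in left_side).
Proof.
rewrite inE; apply: (iffP hasP) => [[x xq /eqP e1]|[x xq e1]]; exists x => //.
by rewrite e1.
Qed.

Lemma left_adj (u : 'I_n) y : u \in left_side -> y < n + m -> adj u y -> y \in q.
Proof. by case/left_sideP=> x xq <-; exact: q_closed. Qed.

(** A path that avoids the cut cannot leave [L]: all the neighbours of [L] are
    found, and those outside of [L] are in the cut. *)
Lemma cut_closed (v : 'I_n) : reached H cutV v -> v \in left_side.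
Proof.
case/existsP=> j /andP[hj /connectP[p]].
have: s j \in left_side.
  apply: contraR hj => h; rewrite inE h /=; apply/orP; left.
  by apply/imsetP; exists j.
move: (s j) => x; elim: p x => [|y p IH] x xL /=; first by move=> _ ->.
case/andP=> /and3P[exy xH yX]; apply: IH.
move: yX; rewrite inE negb_and negbK; case/orP=> //; rewrite negb_or => /andP[yS].
by rewrite (left_adj xL) ?adjV ?yS ?xH ?exy ?orbT ?ltn_addr.
Qed.

Lemma cut_bags (v : 'I_n) (b : 'I_m) :
  reached H cutV v -> b \in A -> v \in bag b -> b \in cutB.
Proof.
move=> /cut_closed hv bA vb; rewrite inE (left_adj hv) ?ltn_add2l //.
by rewrite adjB bA.
Qed.

(** There are as many nodes in [q] as mates in [L].  The nodes in [q] include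
    the source [s0] where the search starts, and every other vertex of [L] that
    is not a source, since it is adjacent to its own copy; what remains is the
    part of the cut outside of the sources. *)
Lemma cut_card : #|cutV| + #|cutB| < k.
Proof.
pose V : {set 'I_n} := [set u : 'I_n | (u : nat) \in q].
have cVB : #|V| + #|cutB| <= #|left_side|.
  have u1 : uniq (map val (enum V) ++ map (fun b : 'I_m => n + b) (enum cutB)).
    rewrite cat_uniq !map_inj_uniq ?enum_uniq ?andbT //=; last first.
    - exact: val_inj.
    - by move=> x y /addnI /val_inj.
    apply/hasPn => x /mapP[b _ ->]; apply/negP => /mapP[v _ /= e1].
    by have := ltn_ord v; lia.
  have s1 : {subset map val (enum V) ++ map (fun b : 'I_m => n + b) (enum cutB) <= q}.
    by move=> x; rewrite mem_cat => /orP[] /mapP[y]; rewrite mem_enum inE => h ->.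
  have := uniq_leq_size u1 s1; rewrite size_cat !size_map -!cardE => h.
  apply: leq_trans h _.
  have u2 : uniq (map mate q).
    rewrite map_inj_in_uniq // => x y xq yq; apply: (mate_inj mate_ok); auto.
  have s2 : {subset map mate q <= map val (enum left_side)}.
    move=> x /mapP[y yq ->]; apply/mapP.
    exists (Ordinal (q_mated yq)) => //; rewrite mem_enum.
    by apply/left_sideP; exists y.
  by have := uniq_leq_size u2 s2; rewrite !size_map -cardE.
pose s0 := s (Ordinal lt_ik).
have s0V : s0 \in V by rewrite inE src_source.
have s0S : s0 \in sources by apply/imsetP; exists (Ordinal lt_ik).
have LV : left_side :\: sources \subset V.
  apply/subsetP=> u; rewrite !inE => /andP[uS uL].
  have uL' : u \in left_side by rewrite inE.
  by rewrite (left_adj uL') ?adjV ?uS ?eqxx ?ltn_addr.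
have cS : #|sources| = k by rewrite card_imset // card_ord.
have h1 : #|cutV :\: sources| + #|left_side :\: sources| < #|V|.
  have d : [disjoint cutV :\: sources & left_side :\: sources].
    rewrite -setI_eq0; apply/eqP/setP=> u; rewrite !inE.
    by case: (u \in sources) => //=; case: (has _ _); rewrite ?andbF.
  have -> : #|cutV :\: sources| + #|left_side :\: sources|
          = #|(cutV :\: sources) :|: (left_side :\: sources)|.
    by apply/esym/eqP; rewrite (leq_card_setU _ _).2.
  apply: proper_card; apply/properP; split.
    rewrite subUset LV andbT; apply/subsetP=> u; rewrite !inE.
    by case: (u \in sources) => //= /andP[].
  by exists s0; rewrite ?s0V // !inE s0S.
have h2 := cardsID sources cutV; have h3 := cardsID sources left_side.
have h4 := cardsID left_side sources.
have h5 : #|cutV :&: sources| <= #|sources :\: left_side|.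
  by apply: subset_leq_card; apply/subsetP=> u; rewrite !inE => /andP[/andP[-> _] ->].
rewrite (setIC left_side) in h3.
by lia.
Qed.

End Cut.

End Side.

(** ** The paths of a complete matching *)

Section Linked.

Variables (n m k c : nat) (e : rel 'I_n) (bag : 'I_m -> {set 'I_n}).
Variable (s : 'I_k -> 'I_n).
Hypothesis s_inj : injective s.
Variables (adj : rel nat) (H : {set 'I_n}) (A : {set 'I_m}).
Hypothesis adjV : forall u v : 'I_n,
  adj u v = (v \notin sources s) && ((u == v) || (u \in H) && e u v).
Hypothesis adjB : forall (u : 'I_n) (b : 'I_m),
  adj u (n + b) = (b \in A) && (u \in bag b).
Let src := at_ord (fun j => s j : nat).
Variables (mate f : nat -> nat).
Hypothesis mate_ok : matching n m k adj src k mate.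
Hypothesis f_lt : forall l, l < n -> f l < n + m.
Hypothesis mate_f : forall l, l < n -> mate (f l) = l.

Let f_inj l l' : l < n -> l' < n -> f l = f l' -> l = l'.
Proof. by move=> h h' eq; rewrite -(mate_f h) -(mate_f h') eq. Qed.

Let f_adj l : l < n -> adj l (f l).
Proof.
move=> h; have := mate_adj mate_ok (f_lt h); rewrite mate_f // => /(_ h) [//|[j]].
by move=> hj; lia.
Qed.

Let f_src l j : l < n -> j < k -> f l <> src j.
Proof.
move=> h hj eq; have := f_adj h.
rewrite eq /src -(src_source s hj) -[l]/(val (Ordinal h)) adjV.
by have -> : s (Ordinal hj) \in sources s by apply: imset_f.
Qed.

Let S_lt j : j < k -> src j < n := @src_lt n k s j.
Let S_inj j j' : j < k -> j' < k -> src j = src j' -> j = j' := @src_inj n k s s_inj j j'.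

(** Besides the vertices that the paths leave, [moving] may contain vertices on
    cycles of the matching; [mate_settled] applies to them as well. *)
Definition moving : {set 'I_n} := [set v : 'I_n | (f v < n) && (f v != v)].
Definition used_bags : {set 'I_m} := [set b : 'I_m | mate (n + b) < n].

Lemma moving_settled v b : v \in moving -> b \in A -> v \in bag b -> b \in used_bags.
Proof.
rewrite inE => /andP[lt ne] bA vb; rewrite inE.
have fv := mate_f (ltn_ord v).
have := mate_settled mate_ok (r := f v) (b := b); rewrite fv adjB bA vb => h.
by have := ltn_ord b; case: h => //; [rewrite eq_sym | lia].
Qed.

Lemma used_avail : used_bags \subset A.
Proof.
apply/subsetP=> b; rewrite inE => lt.
have := mate_adj mate_ok (r := n + b); rewrite ltn_add2l => /(_ (ltn_ord b) lt).
case=> [|[j hj]]; last by lia.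
by rewrite -[mate _]/(val (Ordinal lt)) adjB => /andP[].
Qed.

(** All the right copies of vertices that are not sources are matched, so at
    most [k] of the [n] left vertices remain for the bags. *)
Lemma card_used : #|used_bags| <= k.
Proof.
have cS : #|sources s| = k by rewrite card_imset // card_ord.
pose q := map val (enum (~: sources s)) ++ map (fun b : 'I_m => n + b) (enum used_bags).
have qn x : x \in q -> x < n + m /\ mate x < n.
  rewrite mem_cat => /orP[] /mapP[y]; rewrite mem_enum inE => hy ->.
    split; first exact: ltn_addr (ltn_ord y).
    apply: (mate_tot mate_ok); first exact: ltn_ord.
      by have := ltn_ord y => /= lty; apply/eqP; lia.
    move=> j ltj; apply: contraNneq hy => /= eq; apply/imsetP.
    by exists (Ordinal ltj) => //; apply: val_inj; rewrite /= src_source.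
  by rewrite ltn_add2l.
have u1 : uniq q.
  rewrite cat_uniq !map_inj_uniq ?enum_uniq ?andbT //=; last first.
  - exact: val_inj.
  - by move=> x y /addnI /val_inj.
  apply/hasPn => x /mapP[b _ ->]; apply/negP => /mapP[v _ /= e1].
  by have := ltn_ord v; lia.
have u2 : uniq (map mate q).
  rewrite map_inj_in_uniq // => x y /qn[h1 h2] /qn[h3 h4].
  exact: (mate_inj mate_ok).
have := uniq_leq_size u2 (s2 := iota 0 n).
rewrite !size_map size_cat !size_map size_iota -!cardE => h.
have := cardsC (sources s); rewrite card_ord.
suff: #|~: sources s| + #|used_bags| <= n by lia.
by apply: h => y /mapP[x /qn[_ h] ->]; rewrite mem_iota.
Qed.

Definition orbit_at (j : 'I_k) (d : nat) : nat := iter d (step n f) (src j).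
Definition orbit_set (j : 'I_k) : {set 'I_n} :=
  [set v : 'I_n | [exists d : 'I_n, orbit_at j d == v]].

Lemma orbit_setP (j : 'I_k) (v : 'I_n) :
  reflect (exists d, orbit_at j d = v) (v \in orbit_set j).
Proof.
rewrite inE; apply: (iffP existsP) => [[d /eqP eq]|[d eq]]; first by exists d.
have [d0 lt0 [_ h]] := orbit_leaves S_lt S_inj f_inj f_src (ltn_ord j).
have ltd : d < n.
  apply: leq_ltn_trans lt0; rewrite leqNgt; apply/negP => lt1.
  have := @orbit_prefix n f d0.+1 d (src j) lt1.
  by rewrite -/(orbit_at j d) eq ltn_ord ltnNge h => /(_ isT).
by exists (Ordinal ltd); rewrite /= eq.
Qed.

Lemma orbit_set_inj j j' v : v \in orbit_set j -> v \in orbit_set j' -> j = j'.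
Proof.
move=> /orbit_setP[d ed] /orbit_setP[d' ed']; apply: val_inj.
have [||//] := orbit_inj S_inj f_inj f_src (ltn_ord j) (ltn_ord j') (i := d) (i' := d').
  by rewrite -/(orbit_at j d) ed.
by rewrite -/(orbit_at j d) ed -ed'.
Qed.

Lemma orbit_bag_lt (j : 'I_k) : orbit_at j n - n < m.
Proof.
have [d ltd [lt h]] := orbit_last S_lt S_inj f_inj f_src (ltn_ord j).
rewrite /orbit_at -h; have := f_lt lt.
by have := orbit_end S_lt S_inj f_inj f_src (ltn_ord j); rewrite -h; lia.
Qed.

Definition end_bag (j : 'I_k) : 'I_m := Ordinal (orbit_bag_lt j).

Lemma end_bagE j : n + end_bag j = orbit_at j n.
Proof. by rewrite /= subnKC //; exact: (orbit_end S_lt S_inj f_inj f_src). Qed.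

Lemma end_bag_inj : injective end_bag.
Proof.
move=> j j' eq; apply: val_inj.
apply: (orbit_end_inj S_lt S_inj f_inj f_src (ltn_ord j) (ltn_ord j')).
by rewrite -/(orbit_at j n) -/(orbit_at j' n) -!end_bagE eq.
Qed.

Lemma end_used j : end_bag j \in used_bags.
Proof.
have [d ltd [lt h]] := orbit_last S_lt S_inj f_inj f_src (ltn_ord j).
by rewrite inE end_bagE /orbit_at -h mate_f.
Qed.

Definition orbit_arc (j : 'I_k) : rel 'I_n := fun u v =>
  [&& e u v, u \in moving, u \in H, u \in orbit_set j & v \in orbit_set j].

Lemma orbit_next (j : 'I_k) (d : nat) (u : 'I_n) : orbit_at j d = u ->
  f u < n -> exists2 v : 'I_n, orbit_at j d.+1 = v & orbit_arc j u v.
Proof.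
move=> eu lt; have e1 : orbit_at j d.+1 = f u.
  by rewrite /orbit_at iterS -/(orbit_at j d) eu /step ltn_ord.
exists (Ordinal lt) => //.
have ne : f u != u.
  apply/eqP => eq.
  have [||h _] := orbit_inj S_inj f_inj f_src (ltn_ord j) (ltn_ord j) (i := d) (i' := d.+1).
  - by rewrite -/(orbit_at j d) eu.
  - by rewrite -/(orbit_at j d) -/(orbit_at j d.+1) e1 eu eq.
  by lia.
have := f_adj (ltn_ord u); rewrite -[f u]/(val (Ordinal lt)) adjV.
case/andP=> _ /orP[/eqP eq|/andP[uH eu2]].
  by case/eqP: ne; rewrite {2}eq.
rewrite /orbit_arc eu2 inE lt ne uH /=; apply/andP; split; apply/orbit_setP.
  by exists d.
by exists d.+1.
Qed.

Lemma orbit_connect (j : 'I_k) : exists u : 'I_n,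
  [/\ u \in orbit_set j, u \in bag (end_bag j) & connect (orbit_arc j) (s j) u].
Proof.
have [d ltd [lt h]] := orbit_last S_lt S_inj f_inj f_src (ltn_ord j).
have all_d i : i <= d -> exists2 v : 'I_n, orbit_at j i = v & connect (orbit_arc j) (s j) v.
  elim: i => [|i IH] lid; first by exists (s j); rewrite /orbit_at /= /src ?at_ordE.
  have [u eu cu] := IH (ltnW lid).
  have fu : f u < n.
    have := @orbit_prefix n f i.+1 d (src j) lid lt.
    by rewrite iterS -/(orbit_at j i) eu /step ltn_ord.
  have [v ev ev2] := orbit_next eu fu; exists v => //.
  by apply: connect_trans cu _; apply: connect1.
have [u eu cu] := all_d d (leqnn d); exists u; split=> //.
  by apply/orbit_setP; exists d.
have fu : f u = n + end_bag j by rewrite end_bagE -eu.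
by have := f_adj (ltn_ord u); rewrite fu adjB => /andP[].
Qed.

Lemma orbit_allowed j v : v \in orbit_set j -> v \in H \/ v \in bag (end_bag j).
Proof.
move=> /orbit_setP[d ed]; have [lt|ge] := ltnP (f v) n.
  by have [w _ /and5P[]] := orbit_next ed lt; left.
right; have := f_adj (ltn_ord v).
suff -> : f v = n + end_bag j by rewrite adjB => /andP[].
have [d0 lt0 [lt h]] := orbit_last S_lt S_inj f_inj f_src (ltn_ord j).
have ltd : d < n.
  have := orbit_end S_lt S_inj f_inj f_src (ltn_ord j); rewrite ltnNge => h1.
  apply/negP => h2; have := @orbit_prefix n f n d (src j) h2.
  by rewrite -/(orbit_at j d) ed ltn_ord ltnNge h1 => /(_ isT).
have := iterD (n - d.+1) d.+1 (step n f) (src j); rewrite (subnK ltd) end_bagE.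
rewrite iterS -!/(orbit_at j _) ed => ->.
by rewrite step_stop /step ltn_ord.
Qed.

Lemma linked_bags : exists U : 'I_k -> 'I_m,
  [/\ injective U /\ (forall j, n + U j = orbit_at j n),
      forall j, U j \in A,
      forall j v, v \in orbit_set j -> v \in H \/ v \in bag (U j)
    & forall j, exists u : 'I_n,
      [/\ u \in orbit_set j, u \in bag (U j) & connect (orbit_arc j) (s j) u]].
Proof.
exists end_bag; split.
- by split; [exact: end_bag_inj | exact: end_bagE].
- by move=> j; apply: (subsetP used_avail); exact: end_used.
- exact: orbit_allowed.
- exact: orbit_connect.
Qed.

End Linked.

(** * Robust connections to the bags *)

Section Progress.

Variables (n m k c : nat) (e : rel 'I_n) (bag : 'I_m -> {set 'I_n}).
Variable (s : 'I_k -> 'I_n).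
Hypothesis s_inj : injective s.

Definition reached_bags (H : {set 'I_n}) (F : {set 'I_m}) (X : {set 'I_n}) : {set 'I_m} :=
  [set b in F | [exists v in bag b, reached e s H X v]].

(** The invariant of the rounds.  A vertex hits at most [c] bags, so a set [X] of
    fewer than [k] vertices cannot hit all of the bags counted here once [r]
    exceeds [c * (k - 1)]. *)
Definition progress (r : nat) (H : {set 'I_n}) (F : {set 'I_m}) : Prop :=
  forall X : {set 'I_n}, #|X| < k -> r <= #|reached_bags H F X|.

Lemma progress_spares (r : nat) (H X : {set 'I_n}) (F : {set 'I_m}) :
  (forall v, #|[set i | v \in bag i]| <= c) ->
  progress r H F -> c * (k - 1) < r -> #|X| < k ->
  exists i u, [/\ i \in F, [disjoint X & bag i], u \in bag i & reached e s H X u].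
Proof.
move=> cong pr hr hX.
have /subsetPn[b] :
    ~~ (reached_bags H F X \subset [set b | ~~ [disjoint X & bag b]]).
  apply/negP => /subset_leq_card hle; have h1 := pr X hX.
  have h2 := card_hit cong X; have h3 : c * #|X| <= c * (k - 1).
    by rewrite leq_mul2l; lia.
  by have := leq_trans h1 (leq_trans hle (leq_trans h2 h3)); rewrite leqNgt hr.
rewrite !inE negbK => /andP[bF /existsP[u /andP[ub hu]]] db.
by exists b, u.
Qed.

Section Round.

Variables (adj : rel nat) (H : {set 'I_n}) (A : {set 'I_m}).
Hypothesis adjV : forall u v : 'I_n,
  adj u v = (v \notin sources s) && ((u == v) || (u \in H) && e u v).
Hypothesis adjB : forall (u : 'I_n) (b : 'I_m),
  adj u (n + b) = (b \in A) && (u \in bag b).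
Let src := at_ord (fun j => s j : nat).
Variables (mate f : nat -> nat).
Hypothesis mate_ok : matching n m k adj src k mate.
Hypothesis f_lt : forall l, l < n -> f l < n + m.
Hypothesis mate_f : forall l, l < n -> mate (f l) = l.

Lemma orbit_avoids (X : {set 'I_n}) : #|X| < k ->
  exists j : 'I_k, [disjoint X & orbit_set s f j].
Proof.
move=> hX; apply/existsP; apply: contraLR hX => /existsPn hj; rewrite -leqNgt.
pose h j := odflt (s j) [pick x in X | x \in orbit_set s f j].
have hP j : (h j \in X) && (h j \in orbit_set s f j).
  rewrite /h; case: pickP => [x //|h0]; case/negP: (hj j).
  apply/pred0P => x; exact: h0.
have h_inj : injective h.
  move=> j j' eq; have /andP[_ h1] := hP j; have /andP[_ h2] := hP j'.
  by rewrite -eq in h2; exact: (orbit_set_inj s_inj adjV mate_ok f_lt mate_f h1 h2).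
rewrite -[k]card_ord -(card_codom h_inj); apply: subset_leq_card.
by apply/subsetP=> x /codomP[j ->]; case/andP: (hP j).
Qed.

(** The [k] paths of a round are disjoint, so [X] misses one of them; it ends in
    a bag that no earlier round has used. *)
Lemma progress_round (r : nat) (H0 H' : {set 'I_n}) (F0 : {set 'I_m}) :
  progress r H0 F0 -> H0 \subset H' -> moving n f \subset H' -> [disjoint F0 & A] ->
  progress r.+1 H' (F0 :|: used_bags n m mate).
Proof.
move=> pr sH sM dF X hX; have [j dj] := orbit_avoids hX.
have [u [uo ub hu]] := orbit_connect s_inj adjV adjB mate_ok f_lt mate_f j.
set b := end_bag _ _ _ _ _ _ in ub.
have bU : b \in used_bags n m mate by exact: end_used.
have bA : b \in A by apply: (subsetP (used_avail adjB mate_ok)).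
have sO : s j \in orbit_set s f j.
  by apply/(orbit_setP s_inj adjV mate_ok f_lt mate_f); exists 0; rewrite /orbit_at /= at_ordE.
have hru : reached e s H' X u.
  apply/existsP; exists j; rewrite (disjointFl dj sO) /=.
  apply: connect_sub hu => x y /and5P[exy xM _ _ yO]; apply: connect1.
  by rewrite /lim_arc exy (subsetP sM) //= (disjointFl dj).
have h1 : b \notin reached_bags H0 F0 X.
  by rewrite inE; apply/negP => /andP[/(disjointFr dF)]; rewrite bA.
apply: (@leq_trans #|b |: reached_bags H0 F0 X|).
  by rewrite cardsU1 h1 ltnS; apply: pr.
apply: subset_leq_card; apply/subsetP=> i; rewrite !inE.
case/predU1P=> [->|/andP[iF /existsP[v /andP[vi hv]]]].
  have := bU; rewrite inE => ->; rewrite orbT; apply/existsP; exists u.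
  by rewrite ub hru.
rewrite iF; apply/existsP; exists v; rewrite vi.
exact: reachedS hv.
Qed.

End Round.

End Progress.

(** * The congestion of the final paths *)

(** The paths of [O1] run through the bags of [F1], those of [O2] through the
    bags of [F2], and the final paths also use the bags [U1 j] and [U2 j] of [A].
    A vertex in bags of the three kinds is charged to them, and lies in at most
    [c] bags.  A vertex of [O1] or [O2] outside of [F1], respectively [F2], lies
    in no bag of [A], or else in the bag where its own path ends; in the former
    case it is only met by one path of each family, and [2 <= c]. *)
Lemma final_load (V W J : finType) (c : nat) (bag : W -> {set V})
    (H1 H2 : {set V}) (F1 F2 A : {set W}) (O1 O2 : J -> {set V}) (U1 U2 : J -> W) v :
  2 <= c -> #|[set b | v \in bag b]| <= c ->
  [disjoint F1 & F2] -> [disjoint F1 & A] -> [disjoint F2 & A] ->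
  injective U1 -> injective U2 -> (forall j j', U1 j != U2 j') ->
  (forall j, U1 j \in A) -> (forall j, U2 j \in A) ->
  (forall j j', v \in O1 j -> v \in O1 j' -> j = j') ->
  (forall j j', v \in O2 j -> v \in O2 j' -> j = j') ->
  (forall j, v \in O1 j -> v \in H1 \/ v \in bag (U1 j)) ->
  (forall j, v \in O2 j -> v \in H2 \/ v \in bag (U2 j)) ->
  (v \in H1 -> (exists2 b, b \in F1 & v \in bag b) \/
     (forall b, b \in A -> v \notin bag b)) ->
  (v \in H2 -> (exists2 b, b \in F2 & v \in bag b) \/
     (forall b, b \in A -> v \notin bag b)) ->
  #|[set j | [|| v \in O1 j, v \in bag (U1 j), v \in bag (U2 j) | v \in O2 j]]| <= c.
Proof.
move=> c2 cong d12 d1A d2A U1i U2i U12 U1A U2A O1i O2i O1H O2H H1F H2F.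
pose JO (O : J -> {set V}) := [set j | v \in O j].
have cJO (O : J -> {set V}) : (forall j j', v \in O j -> v \in O j' -> j = j') -> #|JO O| <= 1.
  move=> Oi; apply/card_le1_eqP => j j'; rewrite !inE => h h'; exact: Oi.
have cO1 := cJO _ O1i; have cO2 := cJO _ O2i.
have [/existsP[b0 /andP[b0A vb0]]|/existsPn noA] := boolP [exists b in A, v \in bag b]; last first.
  apply: (@leq_trans #|JO O1 :|: JO O2|); last first.
    by apply: leq_trans (leq_card_setU _ _) _; lia.
  apply: subset_leq_card; apply/subsetP=> j; rewrite !inE.
  have nb b : b \in A -> v \notin bag b by move=> bA; have := noA b; rewrite bA.
  by rewrite (negbTE (nb _ (U1A j))) (negbTE (nb _ (U2A j))).
pose B (F : {set W}) := [set b in F | v \in bag b].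
pose JU1 := [set j | v \in bag (U1 j)]; pose JU2 := [set j | v \in bag (U2 j)].
have cU : #|JU1| + #|JU2| <= #|B A|.
  rewrite -(card_imset JU1 U1i) -(card_imset JU2 U2i).
  have <- : #|(U1 @: JU1) :|: (U2 @: JU2)| = #|U1 @: JU1| + #|U2 @: JU2|.
    apply/eqP; rewrite (leq_card_setU _ _).2 -setI_eq0; apply/eqP/setP => b.
    rewrite !inE; apply/negP => /andP[/imsetP[j _ ->] /imsetP[j' _ eq]].
    by have := U12 j j'; rewrite eq eqxx.
  apply: subset_leq_card; apply/subsetP=> b; rewrite inE.
  by case/orP=> /imsetP[j]; rewrite inE => vj ->; rewrite inE vj ?U1A ?U2A.
have cS (H : {set V}) (F : {set W}) (O : J -> {set V}) (U : J -> W) : #|JO O| <= 1 ->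
    (forall j, v \in O j -> v \in H \/ v \in bag (U j)) ->
    (v \in H -> (exists2 b, b \in F & v \in bag b) \/
     (forall b, b \in A -> v \notin bag b)) ->
    #|JO O :\: [set j | v \in bag (U j)]| <= #|B F|.
  move=> cO OH HF; have [->|/set0Pn[j]] := eqVneq (JO O :\: [set j | v \in bag (U j)]) set0.
    by rewrite cards0.
  rewrite !inE => /andP[nv vO]; apply: leq_trans (subset_leq_card (subsetDl _ _)) _.
  apply: leq_trans cO _; rewrite card_gt0.
  case: (OH j vO) => [vH|]; last by rewrite (negbTE nv).
  case: (HF vH) => [[b bF vb]|/(_ b0 b0A)]; last by rewrite vb0.
  by apply/set0Pn; exists b; rewrite inE bF.
have c1 := cS H1 F1 O1 U1 cO1 O1H H1F; have c3 := cS H2 F2 O2 U2 cO2 O2H H2F.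
have cB : #|B F1| + #|B F2| + #|B A| <= c.
  apply: leq_trans cong.
  have <- : #|B F1 :|: B F2| = #|B F1| + #|B F2|.
    apply/eqP; rewrite (leq_card_setU _ _).2 -setI_eq0; apply/eqP/setP => b.
    rewrite !inE; apply/negP => /andP[/andP[b1 _] /andP[b2 _]].
    by rewrite (disjointFr d12 b1) in b2.
  have <- : #|B F1 :|: B F2 :|: B A| = #|B F1 :|: B F2| + #|B A|.
    apply/eqP; rewrite (leq_card_setU _ _).2 -setI_eq0; apply/eqP/setP => b.
    rewrite !inE; apply/negP => /andP[/orP[]/andP[b1 _] /andP[b2 _]].
      by rewrite (disjointFr d1A b1) in b2.
    by rewrite (disjointFr d2A b1) in b2.
  apply: subset_leq_card; apply/subsetP=> b; rewrite !inE.
  by case/orP=> [/orP[]|] /andP[].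
apply: leq_trans cB.
apply: (@leq_trans #|(JO O1 :\: JU1) :|: (JO O2 :\: JU2) :|: (JU1 :|: JU2)|).
  apply: subset_leq_card; apply/subsetP=> j; rewrite !inE.
  by do 4!case: (_ \in _).
apply: leq_trans (leq_card_setU _ _) _; apply: leq_add.
  by apply: leq_trans (leq_card_setU _ _) _; apply: leq_add.
exact: leq_trans (leq_card_setU _ _) cU.
Qed.

(** * The program *)

Notation "p1 ;; p2" := (LSeq p1 p2) (at level 60, right associativity).
Notation And e1 e2 :=
  (Leq (Lit 2) (Add (Leq (Lit 1) e1) (Leq (Lit 1) e2))) (only parsing).
Notation Row a e := (Cell a (Lit 0) e) (only parsing).
Notation SetRow a e1 e2 := (LCell a (Lit 0) e1 e2) (only parsing).

(* Registers 0-3 and arrays 0-3 hold the input and the output; a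
   one-dimensional array occupies row 0. *)
Notation rn := 0 (only parsing).
Notation rk := 1 (only parsing).
Notation rc := 2 (only parsing).
Notation rm := 3 (only parsing).
Notation rN := 4 (only parsing).       (* n + m *)
Notation rrounds := 5 (only parsing).  (* c * (k - 1) + 1 *)
Notation rk1 := 6 (only parsing).      (* k - 1 *)
Notation rfail := 7 (only parsing).
Notation rfound := 8 (only parsing).
Notation rstart := 9 (only parsing).
Notation rhead := 10 (only parsing).
Notation rtail := 11 (only parsing).
Notation rw := 12 (only parsing).
Notation rnode := 13 (only parsing).
Notation rcur := 14 (only parsing).
Notation ri := 15 (only parsing).
Notation rr := 16 (only parsing).
Notation rx := 17 (only parsing).
Notation ry := 18 (only parsing).
Notation rcnt := 19 (only parsing).
Notation rres := 20 (only parsing).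
Notation rt := 21 (only parsing).
Notation rpar := 22 (only parsing).

Notation aG := 0 (only parsing).
Notation abag := 1 (only parsing).
Notation aterm := 2 (only parsing).
Notation aout := 3 (only parsing).
Notation aadj := 4 (only parsing).
Notation amate := 5 (only parsing).
Notation afwd := 6 (only parsing).
Notation aqueue := 7 (only parsing).
Notation avis := 8 (only parsing).
Notation apar := 9 (only parsing).
Notation aavail := 10 (only parsing).
Notation aH := 11 (only parsing).
Notation asrc := 12 (only parsing).
Notation aM := 13 (only parsing).
Notation aX := 14 (only parsing).
Notation akeep := 15 (only parsing).

(** An alternating search moves from a node [u] to the nodes adjacent to the mate
    of [u].  It stops after the first node whose scan discovers a free node, so
    that the mates of all earlier nodes have no free neighbour: this keeps the
    matching settled.  When every node is its own mate, this is a plain graph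
    search. *)
Definition scan_body : loop :=
  LIf (And (Cell aadj (Row amate (Reg rnode)) (Reg rw)) (Eqn (Row avis (Reg rw)) (Lit 0)))
    (SetRow avis (Reg rw) (Lit 1) ;;
     SetRow apar (Reg rw) (Reg rnode) ;;
     SetRow aqueue (Reg rtail) (Reg rw) ;;
     LReg rtail (Add (Reg rtail) (Lit 1)) ;;
     LIf (Eqn (Row amate (Reg rw)) (Reg rn)) (LReg rfound (Add (Reg rw) (Lit 1))) LSkip)
    LSkip.

Definition scan (bound : nat) : loop := LFor rw bound scan_body.

Definition search_body (bound : nat) : loop :=
  LIf (And (Leq (Add (Reg rhead) (Lit 1)) (Reg rtail)) (Eqn (Reg rfound) (Lit 0)))
    (LReg rnode (Row aqueue (Reg rhead)) ;; scan bound)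
    LSkip.

Definition search (bound : nat) : loop :=
  LFor rw bound (SetRow avis (Reg rw) (Lit 0)) ;;
  SetRow aqueue (Lit 0) (Reg rstart) ;;
  SetRow avis (Reg rstart) (Lit 1) ;;
  LReg rtail (Lit 1) ;;
  LReg rfound (Lit 0) ;;
  LFor rhead bound (search_body bound).

Definition augment : loop :=
  LReg rcur (Defs.Sub (Reg rfound) (Lit 1)) ;;
  LFor rt rN
    (LIf (Eqn (Reg rcur) (Reg rstart)) LSkip
      (LReg rpar (Row apar (Reg rcur)) ;;
       SetRow amate (Reg rcur) (Row amate (Reg rpar)) ;;
       LReg rcur (Reg rpar))) ;;
  SetRow amate (Reg rcur) (Reg rn).

(** Paths to the second row of terminals are searched backwards, so [side]
    selects both the terminals and the direction of the arcs.  The expression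
    [allow] tells whether paths may leave the vertex in register [rx]. *)
Definition arc_expr (side : nat) (x y : expr) : expr :=
  if side == 0 then Cell aG x y else Cell aG y x.

Definition mark_sources (side : nat) : loop :=
  LFor rx rn (SetRow asrc (Reg rx) (Lit 0)) ;;
  LFor rx rk (SetRow asrc (Cell aterm (Lit side) (Reg rx)) (Lit 1)).

Definition build_vertices (side : nat) (allow : expr) : loop :=
  LFor ry rn
    (LCell aadj (Reg rx) (Reg ry)
       (And (Eqn (Row asrc (Reg ry)) (Lit 0))
            (Add (Eqn (Reg rx) (Reg ry)) (And allow (arc_expr side (Reg rx) (Reg ry)))))).

Definition build_bags : loop :=
  LFor ry rm
    (LCell aadj (Reg rx) (Add (Reg rn) (Reg ry))
       (And (Row aavail (Reg ry)) (Cell abag (Reg ry) (Reg rx)))).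

Definition build (side : nat) (allow : expr) : loop :=
  mark_sources side ;;
  LFor rx rn (build_vertices side allow ;; build_bags) ;;
  LFor rx rN (SetRow amate (Reg rx) (Defs.Sub (Reg rx) (Defs.Sub (Reg rx) (Reg rn)))).

Definition menger_body (side : nat) : loop :=
  LIf (Eqn (Reg rfail) (Lit 0))
    (LReg rstart (Cell aterm (Lit side) (Reg ri)) ;;
     search rN ;;
     LIf (Reg rfound) augment (LReg rfail (Lit 1)))
    LSkip.

(** Disjoint paths from all the terminals to distinct available bags, unless a
    search fails, in which case the marks [avis] of this search are left for the
    computation of a cut.  Array [afwd] inverts [amate]. *)
Definition menger (side : nat) (allow : expr) : loop :=
  build side allow ;;
  LFor ri rk (menger_body side) ;;
  LFor rx rN (SetRow afwd (Row amate (Reg rx)) (Reg rx)).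

(** Row [side] of [aH] is the vertex set within which the final paths will be
    sought: the vertices left by the paths of the rounds, and all the vertices of
    their final bags. *)
Definition mark_moving (side : nat) : loop :=
  LFor rx rn
    (LIf (And (Leq (Add (Row afwd (Reg rx)) (Lit 1)) (Reg rn))
              (Eqn (Eqn (Row afwd (Reg rx)) (Reg rx)) (Lit 0)))
       (LCell aH (Lit side) (Reg rx) (Lit 1)) LSkip).

Definition mark_bags (side : nat) : loop :=
  LFor rx rm
    (LIf (Leq (Add (Row amate (Add (Reg rn) (Reg rx))) (Lit 1)) (Reg rn))
       (SetRow aavail (Reg rx) (Lit 0) ;;
        LFor ry rn
          (LIf (Cell abag (Reg rx) (Reg ry)) (LCell aH (Lit side) (Reg ry) (Lit 1)) LSkip))
       LSkip).

Definition rounds (side : nat) : loop :=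
  LFor rr rrounds
    (LIf (Eqn (Reg rfail) (Lit 0))
       (menger side (Lit 1) ;;
        LIf (Eqn (Reg rfail) (Lit 0)) (mark_moving side ;; mark_bags side) LSkip)
       LSkip).

Definition collect (row a bound : nat) : loop :=
  LReg rcnt (Lit 0) ;;
  LFor rx bound
    (LIf (Row a (Reg rx))
       (LReg rcnt (Add (Reg rcnt) (Lit 1)) ;;
        LCell aout (Lit row) (Reg rcnt) (Reg rx))
       LSkip) ;;
  LCell aout (Lit row) (Lit 0) (Reg rcnt).

(** The mate of a node found by the search is a vertex [v] with [afwd v]
    found. *)
Definition cut_vertices : loop :=
  LFor rx rn
    (SetRow aX (Reg rx)
       (And (Eqn (Row avis (Row afwd (Reg rx))) (Lit 0))
            (Add (Row asrc (Reg rx)) (Row avis (Reg rx))))).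

Definition spare_bags : loop :=
  LFor rx rm
    (SetRow akeep (Reg rx) (Lit 1) ;;
     LFor ry rn
       (LIf (And (Row aX (Reg ry)) (Cell abag (Reg rx) (Reg ry)))
          (SetRow akeep (Reg rx) (Lit 0)) LSkip)).

Definition output_cut : loop :=
  cut_vertices ;; spare_bags ;; collect 0 akeep rm ;; collect 1 aX rn.

(** Row [i] of [aM] receives the path from the [i]-th terminal and its final bag.
    Following [afwd] for [n] steps is enough, as a path has at most [n]
    vertices. *)
Definition follow : loop :=
  LFor ry rn
    (LIf (Leq (Add (Reg rcur) (Lit 1)) (Reg rn))
       (LCell aM (Reg ri) (Reg rcur) (Lit 1) ;; LReg rcur (Row afwd (Reg rcur)))
       LSkip).

Definition mark_final_bag : loop :=
  LFor ry rn
    (LIf (Cell abag (Reg rcur) (Reg ry)) (LCell aM (Reg ri) (Reg ry) (Lit 1)) LSkip).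

Definition walk (side : nat) : loop :=
  LReg rcur (Cell aterm (Lit side) (Reg ri)) ;;
  follow ;;
  LReg rcur (Defs.Sub (Reg rcur) (Reg rn)) ;;
  SetRow aavail (Reg rcur) (Lit 0) ;;
  mark_final_bag.

Definition walks (side : nat) : loop := LFor ri rk (walk side).

(** The path of the linkage is sought within row [ri] of [aM], backwards from its
    last vertex, so that following the parents yields it in the right order.
    Making its first vertex free makes the search stop there. *)
Definition route_graph : loop :=
  LFor rx rn
    (SetRow amate (Reg rx) (Reg rx) ;;
     LFor ry rn
       (LCell aadj (Reg rx) (Reg ry)
          (And (And (Cell aM (Reg ri) (Reg rx)) (Cell aM (Reg ri) (Reg ry)))
               (Cell aG (Reg ry) (Reg rx))))).

Definition route_setup : loop :=
  LReg rstart (Cell aterm (Lit 1) (Reg ri)) ;;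
  LReg rcur (Cell aterm (Lit 0) (Reg ri)) ;;
  SetRow amate (Reg rcur) (Reg rn) ;;
  SetRow amate (Reg rstart) (Reg rstart).

Definition route_first : loop :=
  LReg rcnt (Lit 1) ;; LCell aout (Reg ri) (Lit 1) (Reg rcur).

Definition route_rest : loop :=
  LFor rt rn
    (LIf (Eqn (Reg rcur) (Reg rstart)) LSkip
      (LReg rcur (Row apar (Reg rcur)) ;;
       LReg rcnt (Add (Reg rcnt) (Lit 1)) ;;
       LCell aout (Reg ri) (Reg rcnt) (Reg rcur))).

Definition route : loop :=
  route_graph ;; route_setup ;; search rn ;; route_first ;; route_rest ;;
  LCell aout (Reg ri) (Lit 0) (Reg rcnt).

Definition finish : loop :=
  menger 0 (Cell aH (Lit 0) (Reg rx)) ;;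
  walks 0 ;;
  menger 1 (Cell aH (Lit 1) (Reg rx)) ;;
  walks 1 ;;
  LFor ri rk route ;;
  LReg rres (Lit 3).

Definition init_size : loop :=
  LReg rN (Add (Reg rn) (Reg rm)) ;;
  LReg rk1 (Defs.Sub (Reg rk) (Lit 1)) ;;
  LReg rrounds (Lit 1).

Definition init_rounds : loop :=
  LFor rx rk1 (LReg rrounds (Add (Reg rrounds) (Reg rc))).

Definition linkage : loop :=
  LFor rx rm (SetRow aavail (Reg rx) (Lit 1)) ;;
  rounds 0 ;;
  LIf (Reg rfail) (output_cut ;; LReg rres (Lit 1))
    (rounds 1 ;;
     LIf (Reg rfail) (output_cut ;; LReg rres (Lit 2)) finish).

Definition program : cmd :=
  Seq (compile init_size)
    (Seq (compile init_rounds)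
       (Seq (compile linkage) (SetReg rn (Reg rres)))).

Arguments run : simpl never.

Lemma run_seq p1 p2 st : run (p1 ;; p2) st = run p2 (run p1 st).
Proof. by []. Qed.
Lemma run_set x e st : run (LReg x e) st = set_reg st x (eval st e).
Proof. by []. Qed.
Lemma run_cell a e1 e2 e st :
  run (LCell a e1 e2 e) st = set_cell st a (eval st e1) (eval st e2) (eval st e).
Proof. by []. Qed.
Lemma run_if e p1 p2 st :
  run (LIf e p1 p2) st = if eval st e != 0 then run p1 st else run p2 st.
Proof. by []. Qed.
Lemma run_skip st : run LSkip st = st.
Proof. by []. Qed.
Definition runE := (run_seq, run_set, run_cell, run_if, run_skip).

Lemma eval_and st e1 e2 :
  (eval st (And e1 e2) != 0) = (eval st e1 != 0) && (eval st e2 != 0).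
Proof. by rewrite /= -!lt0n; case: (0 < eval st e1); case: (0 < eval st e2). Qed.

Lemma eval_andE st e1 e2 :
  eval st (And e1 e2) = (eval st e1 != 0) && (eval st e2 != 0) :> nat.
Proof. by rewrite /= -!lt0n; case: (0 < eval st e1); case: (0 < eval st e2). Qed.

Lemma nat_boolK (a : bool) : ((a : nat) != 0) = a.
Proof. by case: a. Qed.

Lemma frameW p q st st' :
  all (mem (written_regs q)) (written_regs p) ->
  all (mem (written_arrs q)) (written_arrs p) -> frame p st st' -> frame q st st'.
Proof.
move=> /allP hr /allP ha [fr fa]; split=> [y hy|a haq i j].
  by apply: fr; apply: contra hy; apply: hr.
by apply: fa; apply: contra haq; apply: ha.
Qed.

Lemma frame_trans p st1 st2 st3 : frame p st1 st2 -> frame p st2 st3 -> frame p st1 st3.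
Proof.
by case=> r1 a1 [r2 a2]; split=> [y hy|a ha i j]; rewrite (r2, a2) // (r1, a1).
Qed.

(** * Correctness of the search *)

(** The queue [q] after the nodes of index below [h] have been scanned and that
    of index [h] has been scanned up to [w]; [found] is 0, or one more than a
    free node. *)
Record explored (arc : rel nat) (free : pred nat) (B s h w found : nat)
    (par : nat -> nat) (q : seq nat) : Prop := Explored {
  ex_uniq : uniq q;
  ex_lt : {in q, forall x, x < B};
  ex_pos : 0 < size q;
  ex_head : nth 0 q 0 = s;
  ex_par : forall j, 0 < j < size q -> exists2 i, i < j /\ i <= h &
     par (nth 0 q j) = nth 0 q i /\ arc (nth 0 q i) (nth 0 q j);
  ex_closed : forall i x, i < size q -> i < h \/ i = h /\ x < w -> x < B ->
     arc (nth 0 q i) x -> x \in q;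
  ex_scan : forall i x, i < h -> i < size q -> x < B -> arc (nth 0 q i) x -> ~~ free x;
  ex_found : if found is f.+1 then [&& f \in q, free f & f != s]
             else all (predC free) q }.

Section Explored.

Variables (arc : rel nat) (free : pred nat) (B s : nat).

Lemma explored_init par : s < B -> ~~ free s -> explored arc free B s 0 0 0 par [:: s].
Proof.
move=> lts fs; split=> //=; try by rewrite fs.
- by move=> x; rewrite inE => /eqP->.
- by move=> j; case: j => [|[]].
- by move=> i x _ [|[]].
Qed.

Lemma explored_old h w found par q : explored arc free B s h w found par q ->
  ~~ (arc (nth 0 q h) w && (w \notin q)) -> explored arc free B s h w.+1 found par q.
Proof.
case=> hu hl hp hh hpar hc hs hf hn; split=> // i x ltq [lt|[eq lt]] ltx ax.
  by apply: (hc i) => //; left.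
move: lt; rewrite ltnS leq_eqVlt => /orP[/eqP ex|lt]; last by apply: (hc i) => //; right.
by move: hn; rewrite -ex -eq ax /= negbK.
Qed.

Lemma explored_new h w found par par' q : explored arc free B s h w found par q ->
  h < size q -> w < B -> arc (nth 0 q h) w -> w \notin q ->
  par' w = nth 0 q h -> (forall x, x != w -> par' x = par x) ->
  explored arc free B s h w.+1 (if free w then w.+1 else found) par' (rcons q w).
Proof.
case=> hu hl hp hh hpar hc hs hf lth ltw aw wq pw po.
have nthq i : i < size q -> nth 0 (rcons q w) i = nth 0 q i.
  by move=> lt; rewrite nth_rcons lt.
split=> //.
- by rewrite rcons_uniq wq.
- by move=> x; rewrite mem_rcons inE => /predU1P[->|/hl].
- by rewrite size_rcons.
- by rewrite nthq.
- move=> j; rewrite size_rcons ltnS => /andP[j0 lej].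
  case: (ltnP j (size q)) => [ltj|gej].
    have [|i [lti lih] [e1 e2]] := hpar j; first by rewrite j0.
    exists i => //; rewrite !nthq //; last by lia.
    rewrite po //; apply: contraNneq wq => <-; exact: mem_nth.
  have -> : j = size q by lia.
  by exists h => //; rewrite nth_rcons ltnn eqxx nthq.
- move=> i x; rewrite size_rcons ltnS => lei hix ltx.
  have lti : i < size q by case: hix => [|[]]; lia.
  rewrite nthq // mem_rcons inE => ax.
  have [//|xw] := eqVneq x w; apply: (hc i) => //.
  by case: hix => [|[-> lt]]; [left | right; lia].
- move=> i x lti _ ltx; rewrite nthq; last by lia.
  by apply: hs => //; lia.
- case: ifP => [fw|nfw].
    rewrite mem_rcons mem_head fw /=; apply: contraNneq wq => ->.
    by rewrite -hh mem_nth.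
  case: found hf => [|f]; first by rewrite all_rcons /= nfw.
  by rewrite mem_rcons inE => /and3P[-> -> ->]; rewrite orbT.
Qed.

Lemma explored_next h par q : explored arc free B s h B 0 par q ->
  explored arc free B s h.+1 0 0 par q.
Proof.
case=> hu hl hp hh hpar hc hs hf; split=> //.
- move=> j hj; have [i [h1 h2] h3] := hpar j hj; exists i => //; split=> //.
  exact: leqW.
- move=> i x ltq [lti|[_]]; last by rewrite ltn0.
  move=> ltx ax; apply: (hc i) => //; move: lti; rewrite ltnS leq_eqVlt.
  by case/orP=> [/eqP->|]; [right | left].
- move=> i x; rewrite ltnS leq_eqVlt => /orP[/eqP e|lt] ltq ltx ax.
    have xq : x \in q by apply: (hc i) => //; right.
    exact: (allP hf).
  exact: (hs i).
Qed.

End Explored.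

Section SearchSpec.

Variables (b nn : nat) (st0 : state) (mt : nat -> nat) (adj : rel nat).
Hypothesis st0_mt : forall x, arr st0 amate 0 x = mt x.
Hypothesis st0_adj : forall x y, (arr st0 aadj x y != 0) = adj x y.
Hypothesis st0_n : reg st0 rn = nn.
(* The registers written by a search do not depend on its bound. *)
Hypothesis b_ok : b \notin written_regs (search 0).

Let arc : rel nat := fun u w => adj (mt u) w.
Let free : pred nat := fun w => mt w == nn.
Let B := reg st0 b.
Let s := reg st0 rstart.

Definition search_rel (st : state) (h w : nat) (q : seq nat) : Prop :=
  [/\ explored arc free B s h w (reg st rfound) (arr st apar 0) q,
      reg st rtail = size q,
      forall x, x < B -> arr st avis 0 x = (x \in q)
    & forall j, j < size q -> arr st aqueue 0 j = nth 0 q j].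

Lemma scan_spec st h q :
  frame (search b) st0 st -> search_rel st h 0 q -> h < size q ->
  reg st rnode = nth 0 q h ->
  exists q', search_rel (run (scan b) st) h B q' /\ h < size q'.
Proof.
move=> [frR frA] hst lth hnode.
have eB : reg st b = B by rewrite frR.
pose Inv w st1 := exists q', [/\ search_rel st1 h w q', h < size q'
  & reg st1 rnode = nth 0 q' h].
suff : Inv (reg st b) (run (scan b) st) by rewrite eB => -[q' []]; exists q'.
apply: for_ind; first by exists q.
move=> w st1 ltw [fr1 fa1] ew [q' [[hex ht hv hq] lth' hn]].
have e_mate x : arr st1 amate 0 x = mt x by rewrite fa1 ?frA.
have e_adj x y : (arr st1 aadj x y != 0) = adj x y by rewrite fa1 ?frA.
have e_n : reg st1 rn = nn by rewrite fr1 ?frR.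
have ltwB : w < B by rewrite -eB.
rewrite run_if eval_and /= ew hn e_mate e_adj hv //.
rewrite eqb0 nat_boolK.
case: ifP => [/andP[aw wq]|/negbT hno]; last first.
  exists q'; split=> //; split=> //=; exact: explored_old.
rewrite !runE /= !ew e_mate e_n.
have hnew par' := explored_new (par' := par') hex lth' ltwB aw wq.
rewrite nat_boolK -/(free w); exists (rcons q' w); split; last first.
- by case: ifP => _ /=; rewrite hn nth_rcons lth'.
- by rewrite size_rcons leqW.
split.
- case: (free w) hnew => hnew /=; rewrite ?addn1; apply: hnew => /=;
    rewrite ?eqxx ?hn // => x /negbTE->; by [].
- by case: ifP => _ /=; rewrite ht size_rcons addn1.
- move=> x ltx; rewrite mem_rcons inE; case: ifP => _ /=.
    by case: eqP => //= _; exact: hv.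
  by case: eqP => //= _; exact: hv.
move=> j; rewrite size_rcons ltnS nth_rcons => lej.
  case: ifP => _ /=; rewrite ht; case: (ltnP j (size q')) => ltj;
    [have -> : (j == size q') = false by lia | have -> : j = size q' by lia
    |have -> : (j == size q') = false by lia | have -> : j = size q' by lia];
    rewrite ?eqxx ?hq //.
Qed.

Definition search_init : loop :=
  LFor rw b (SetRow avis (Reg rw) (Lit 0)) ;;
  SetRow aqueue (Lit 0) (Reg rstart) ;;
  SetRow avis (Reg rstart) (Lit 1) ;;
  LReg rtail (Lit 1) ;;
  LReg rfound (Lit 0).

Lemma search_init_spec : s < B -> ~~ free s ->
  search_rel (run search_init st0) 0 0 [:: s] /\ reg (run search_init st0) rfound = 0.
Proof.
move=> lts fs; rewrite /search_init; set p0 := LFor _ _ _; rewrite !runE.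
set st := run p0 st0.
have hs : reg st rstart = s by rewrite /st run_reg.
have hv x : x < B -> arr st avis 0 x = 0.
  move: x; pose Inv w st1 := forall x, x < w -> arr st1 avis 0 x = 0.
  apply: (for_ind (Inv := Inv)) => // w st1 ltw _ ew IH x /=.
  by rewrite ew ltnS leq_eqVlt; case: eqP => //= _; exact: IH.
split=> //; split=> //=.
- exact: explored_init.
- move=> x ltx; rewrite inE /= hs; case: eqP => //= _; exact: hv.
- by case=> //= _; rewrite hs.
Qed.

Lemma search_spec : s < B -> ~~ free s -> let st := run (search b) st0 in exists q,
  (reg st rfound = 0 /\ search_rel st (size q) 0 q) \/
  (reg st rfound != 0 /\ exists h, search_rel st h B q /\ h < size q).
Proof.
move=> lts fs /=; have [h0 f0] := search_init_spec lts fs.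
have -> : run (search b) st0 = run (LFor rhead b (search_body b)) (run search_init st0) by [].
set st := run search_init st0 in h0 f0 *.
have fr0 : frame (search b) st0 st by apply: (@frameW search_init) (run_frame _ _).
have eB : reg st b = B by case: fr0 => ->.
pose Inv i st1 := exists q,
  [\/ [/\ reg st1 rfound = 0, i <= size q & search_rel st1 i 0 q],
      [/\ reg st1 rfound = 0, size q <= i & search_rel st1 (size q) 0 q]
    | reg st1 rfound != 0 /\ exists h, search_rel st1 h B q /\ h < size q].
have: Inv (reg st b) (run (LFor rhead b (search_body b)) st).
  apply: for_ind; first by exists [:: s]; constructor 1.
  move=> i st1 lti fr1 ei [q hq].
  have fr : frame (search b) st0 st1.
    by apply: frame_trans fr0 _; apply: frameW fr1.
  rewrite run_if eval_and /= ei nat_boolK nat_boolK.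
  case: hq => [[f1 li sr]|[f1 li sr]|[f1 [h [sr lh]]]]; last first.
  - by rewrite (negbTE f1) andbF /=; exists q; constructor 3; split=> //; exists h.
  - have -> : (i + 1 <= reg st1 rtail) = false by case: sr => _ -> _ _; lia.
    by exists q; constructor 2; split=> //; lia.
  have et : reg st1 rtail = size q by case: sr.
  rewrite f1 eqxx et andbT; case: leqP => [lt|]; last first.
    move=> lt; have e : i = size q by lia.
    by exists q; constructor 2; rewrite -e; split=> //=; lia.
  rewrite run_seq run_set /= ei.
  set st2 := set_reg st1 rnode _.
  have [||||q' [sr' lt']] := @scan_spec st2 i q.
  - apply: frame_trans fr _; apply: frameW (run_frame (LReg rnode (Lit _)) _) => //.
  - by case: sr => *; split.
  - by lia.
  - by case: sr => _ _ _ h; rewrite /= h //; lia.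
  case f2: (reg (run (scan b) st2) rfound) => [|f].
    exists q'; constructor 1; split; [exact: f2 | exact: lt' |].
    case: sr'; rewrite f2 => ex *; split=> //=; rewrite f2; exact: explored_next.
  by exists q'; constructor 3; split; rewrite /= ?f2 //; exists i.
rewrite eB; set st' := run _ _ => -[q hq].
case: hq => [[f1 li sr]|[f1 li sr]|[f1 h]]; exists q; [|by left|by right].
(* The queue holds at most [B] nodes, so all of them have been scanned. *)
left; split=> //; have := sr; case=> ex _ _ _.
suff <- : B = size q by [].
apply/eqP; rewrite eqn_leq li /= -[B](size_iota 0); apply: uniq_leq_size.
  exact: ex_uniq ex.
by move=> x /(ex_lt ex); rewrite mem_iota.
Qed.

End SearchSpec.

(** * Correctness of the augmentation *)

Lemma explored_mated arc free B s h w found par q i :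
  explored arc free B s h w found par q -> ~~ free s -> i <= h -> i < size q ->
  ~~ free (nth 0 q i).
Proof.
move=> ex fs lih ltq; case: (posnP i) => [->|i0]; first by rewrite (ex_head ex).
have [|j [ltj _] [_ a]] := ex_par ex (j := i); first by rewrite i0.
apply: (ex_scan ex) a; [lia|lia|].
by apply: (ex_lt ex); rewrite mem_nth.
Qed.

Section Augment.

Variables (n m k : nat) (adj : rel nat) (src : nat -> nat).
Hypothesis src_lt : forall j, j < k -> src j < n.
Hypothesis src_inj : forall j j', j < k -> j' < k -> src j = src j' -> j = j'.
Hypothesis adj_src : forall l j, l < n -> j < k -> ~~ adj l (src j).

Lemma holed_matching_ext i w mate mate' :
  (forall r, r < n + m -> mate r = mate' r) -> i <= k ->
  holed_matching n m k adj src i w mate -> holed_matching n m k adj src i w mate'.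
Proof.
move=> eq lik [hle hinj hsur hadj htot hdone hset hhole].
have eqn r : r < n -> mate r = mate' r by move=> lt; apply: eq; rewrite ltn_addr.
split.
- by move=> r lt; rewrite -eq //; exact: hle.
- by move=> r r' lt lt'; rewrite -!eq //; exact: hinj.
- by move=> l lt; have [r ltr e] := hsur l lt; exists r; rewrite -?eq.
- by move=> r lt; rewrite -eq //; exact: hadj.
- by move=> r lt; rewrite -eqn //; exact: htot.
- by move=> j lt; rewrite -eqn; [exact: hdone | apply: src_lt; lia].
- by move=> r b ltr; rewrite -eqn // => h1 h2 lb; rewrite -eq ?ltn_add2l //; exact: hset.
- by move=> lt; rewrite -eq //; exact: hhole.
Qed.

Variables (i : nat) (mate0 par : nat -> nat) (q : seq nat) (h f : nat).
Hypothesis lt_ik : i < k.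
Hypothesis mate0_ok : matching n m k adj src i mate0.

Let arc : rel nat := fun u w => adj (mate0 u) w.
Let free : pred nat := fun w => mate0 w == n.
Let s := src i.

Lemma source_mated : mate0 s < n.
Proof.
apply: (mate_tot mate0_ok); first exact: src_lt.
  by apply/eqP; have := src_lt lt_ik; rewrite -/s; lia.
by move=> j ltj; apply/eqP => /(src_inj lt_ik) e; have := e (ltn_trans ltj lt_ik); lia.
Qed.

Hypothesis q_ok : explored arc free (n + m) s h (n + m) f.+1 par q.
Hypothesis lt_hq : h < size q.

Lemma mate0_lt x : x < n + m -> ~~ free x -> mate0 x < n.
Proof. by move=> lt fx; rewrite ltn_neqAle fx (mate_le mate0_ok). Qed.

(** The hole moves from [f] towards the source along the parents.  The nodes with
    smaller index still have their original mates, and no node that was matched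
    becomes free, so that the neighbours of the mates of scanned nodes remain
    matched. *)
Definition augmenting (w : nat) (mate : nat -> nat) : Prop :=
  exists mh, [/\ [/\ holed_matching n m k adj src i w mh,
      w \in q & w = f \/ index w q <= h],
      forall x, x != w -> mate x = mh x,
      forall x, x \in q -> index x q < index w q -> mate x = mate0 x
    & forall x, x < n + m -> mate0 x < n -> mh x < n \/ x = w].

Lemma augmenting_init : augmenting f mate0.
Proof.
have /and3P[fq /eqP ff _] := ex_found q_ok.
exists mate0; split=> // [|x _ ->]; last by left.
by split=> //; [exact: open_hole | left].
Qed.

Lemma augmenting_step w mate mate' : augmenting w mate -> w != s ->
  mate' w = mate (par w) -> (forall x, x != w -> mate' x = mate x) ->
  augmenting (par w) mate' /\ index (par w) q < index w q.
Proof.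
case=> mh [[hh wq wf] eqm orig keep] ws mw mo.
have qlt := ex_lt q_ok; have ltw := qlt _ wq.
have j0 : 0 < index w q.
  by rewrite lt0n; apply: contraNneq ws => e; rewrite -(ex_head q_ok) -e nth_index.
have lj : index w q < size q by rewrite index_mem.
have [|i' [lti lih]] := ex_par q_ok (j := index w q); first by rewrite j0.
rewrite nth_index // => -[epar ap].
have lti' : i' < size q by lia.
have ip : index (par w) q = i' by rewrite epar index_uniq ?(ex_uniq q_ok).
have pq : par w \in q by rewrite epar mem_nth.
have ltp := qlt _ pq.
have fs : ~~ free s by rewrite /free; have := source_mated; case: eqP => //; lia.
have fp : ~~ free (par w) by rewrite epar; exact: (explored_mated q_ok).
have m0p := mate0_lt ltp fp.
have pw : par w != w by apply: contraTneq lti => e; rewrite -ip e ltnn.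
have mp : mh (par w) = mate0 (par w) by rewrite -eqm // orig // ip.
have aw : adj (mh (par w)) w by move: ap; rewrite -epar /arc mp.
have hset : w < n -> forall b, b < m -> adj (mh (par w)) (n + b) ->
    mh (n + b) < n \/ n + b = w.
  move=> wn b ltb ab; case: wf => [wf|wh].
    (* A free node that can be found is a bag: among the copies of vertices,
       only those of the treated sources are free. *)
    have /and3P[_ /eqP ff _] := ex_found q_ok.
    have := mate_tot mate0_ok wn; rewrite wf ff ltnn => hc; suff: false by []; apply: hc.
      by apply/eqP; lia.
    move=> j ltj; apply: contraTneq aw => e.
    have ew : w = src j by rewrite wf.
    by rewrite {2}ew; apply: adj_src; [rewrite mp | exact: ltn_trans lt_ik].
  have lb : n + b < n + m by rewrite ltn_add2l.
  (* Here [par w] was scanned before the last node. *)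
  apply: keep => //; apply: mate0_lt => //.
  apply: (ex_scan q_ok (i := i')) => //; first by lia.
  by rewrite /arc -epar -mp.
have hnew := move_hole adj_src (ltnW lt_ik) hh ltw ltp pw _ aw hset.
split; last by rewrite ip.
exists (upd (upd mh w (mh (par w))) (par w) n); split.
- split=> //; first by apply: hnew; rewrite mp.
  by right; rewrite ip.
- move=> x xp; rewrite /upd (negbTE xp); case: eqP => [->|/eqP xw].
    by rewrite mw eqm.
  by rewrite mo // eqm.
- move=> x xq ltx; rewrite mo; first by apply: orig; lia.
  by apply: contraTneq ltx => ->; rewrite ip; lia.
- move=> x ltx hx; rewrite /upd; case: eqP => [|/eqP xp]; first by right.
  left; case: eqP => [_|/eqP xw]; first by rewrite mp.
  by case: (keep x ltx hx) => // e; rewrite e eqxx in xw.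
Qed.

Lemma augmenting_end mate mate' : augmenting s mate ->
  mate' s = n -> (forall x, x != s -> mate' x = mate x) ->
  matching n m k adj src i.+1 mate'.
Proof.
case=> mh [[hh _ _] eqm _ _] ms mo.
apply: (@holed_matching_ext i.+1 (n + m) mh) => //.
  move=> r ltr; case: (eqVneq r s) => [->|rs]; last by rewrite mo // eqm.
  by rewrite ms; apply: (mate_hole hh); apply: ltn_addr; exact: src_lt.
exact: close_hole.
Qed.

Lemma augment_spec st :
  reg st rn = n -> reg st rN = n + m -> reg st rstart = s -> reg st rfound = f.+1 ->
  (forall x, arr st amate 0 x = mate0 x) -> (forall x, arr st apar 0 x = par x) ->
  matching n m k adj src i.+1 (arr (run augment st) amate 0).
Proof.
move=> en eN es ef emate epar; rewrite /augment !run_seq run_set.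
set st1 := set_reg st _ _.
have ecur : reg st1 rcur = f by rewrite /= ef subn1.
pose Inv t st2 := augmenting (reg st2 rcur) (arr st2 amate 0) /\
  (reg st2 rcur = s \/ index (reg st2 rcur) q + t < n + m).
have szq : size q <= n + m.
  rewrite -[n + m](size_iota 0); apply: uniq_leq_size; first exact: (ex_uniq q_ok).
  by move=> x /(ex_lt q_ok); rewrite mem_iota.
set p := LFor _ _ _.
have : Inv (reg st1 rN) (run p st1).
  apply: for_ind.
    split.
      have [mh [h1 h2 h3 h4]] := augmenting_init.
      rewrite /= ef subn1; exists mh; split=> // x; rewrite emate; exact: h2.
    right; rewrite /= ef subn1 addn0; apply: leq_trans szq.
    by have /and3P[fq _ _] := ex_found q_ok; rewrite index_mem.
  move=> t st2 ltt [fr fa] et [ha hi].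
  have e1 : reg st2 rstart = s by rewrite fr.
  have e2 x : arr st2 apar 0 x = par x by rewrite fa //= epar.
  rewrite !runE /= nat_boolK e1.
  case: eqP => [e|/eqP ne] /=; first by split=> //; left.
  rewrite e2; set v := arr st2 amate 0 _.
  have [||ha' hi'] :=
    augmenting_step (mate' := arr (set_cell st2 amate 0 (reg st2 rcur) v) amate 0) ha ne.
  - by rewrite /= eqxx.
  - by move=> x /negbTE /= ->.
  - by split=> //=; right; case: hi => [e|]; [rewrite e eqxx in ne | lia].
case=> ha hi; set st2 := run p st1 in ha hi *.
have e2 : reg st2 rcur = s.
  by case: hi => // lt; move: lt; rewrite /= eN; lia.
rewrite run_cell /= e2.
have -> : reg st2 rn = n by rewrite run_reg //= en.
by apply: (augmenting_end (mate := arr st2 amate 0)); rewrite ?e2 /= ?eqxx // -?e2 // => x /negbTE->.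
Qed.

End Augment.

(** * Correctness of the disjoint paths computation *)

(** The frame hypothesis of the premise gives the values of everything but array
    [a] and register [x]. *)
Lemma fill_spec x h a er ec e st (R O : nat) (val : nat -> nat) :
  let p := LFor x h (LCell a er ec e) in
  (forall st1 i, frame p st st1 -> reg st1 x = i -> i < reg st h ->
     [/\ eval st1 er = R, eval st1 ec = O + i & eval st1 e = val i]) ->
  forall r j, arr (run p st) a r j =
    if (r == R) && (O <= j < O + reg st h) then val (j - O) else arr st a r j.
Proof.
move=> p hp r j.
pose Inv i st1 := arr st1 a r j =
    if (r == R) && (O <= j < O + i) then val (j - O) else arr st a r j.
apply: (for_ind (Inv := Inv)) => [|i st1 lti fr ei]; rewrite /Inv.
  by rewrite addn0; case: ifP => // /and3P[_ h1]; rewrite ltnNge h1.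
rewrite run_cell /= eqxx /=; have [-> -> ->] := hp st1 i fr ei lti.
move=> ->; case: (r == R) => //=; case: eqP => [->|ne].
  by rewrite leq_addr ltn_add2l ltnSn /= addKn.
have -> : (O <= j < O + i.+1) = (O <= j < O + i) by lia.
by [].
Qed.

Section Menger.

Variables (n k c m rho : nat) (gm bm tm : nat -> nat -> nat).

Definition static_regs := [:: rn; rk; rc; rm; rN; rrounds].
Definition static_arrs := [:: aG; abag; aterm].

Record static (st : state) : Prop := Static {
  st_n : reg st rn = n;
  st_k : reg st rk = k;
  st_c : reg st rc = c;
  st_m : reg st rm = m;
  st_N : reg st rN = n + m;
  st_rho : reg st rrounds = rho;
  st_G : forall u v, arr st aG u v = gm u v;
  st_bag : forall b v, arr st abag b v = bm b v;
  st_term : forall i j, i < 2 -> arr st aterm i j = tm i j }.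

Lemma static_frame p st st1 :
  all (fun x => x \notin written_regs p) static_regs ->
  all (fun a => a \notin written_arrs p) static_arrs ->
  frame p st st1 -> static st -> static st1.
Proof.
move=> /allP hr /allP ha [fr fa] [h1 h2 h3 h4 h5 h6 h7 h8 h9].
split; rewrite ?fr ?hr //; first by move=> u v; rewrite fa ?ha.
  by move=> u v; rewrite fa ?ha.
by move=> i j lti; rewrite fa ?ha ?h9.
Qed.

Lemma static_run p st :
  all (fun x => x \notin written_regs p) static_regs ->
  all (fun a => a \notin written_arrs p) static_arrs ->
  static st -> static (run p st).
Proof. by move=> hr ha; apply: static_frame (run_frame p st). Qed.

Variables (side : nat) (allow : expr) (allowf : nat -> bool).
Hypothesis side2 : side < 2.

Definition arcf (x y : nat) : bool :=
  if side == 0 then gm x y != 0 else gm y x != 0.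

Lemma eval_arc st x y : static st -> reg st rx = x -> reg st ry = y ->
  (eval st (arc_expr side (Reg rx) (Reg ry)) != 0) = arcf x y.
Proof.
by move=> hst ex ey; rewrite /arc_expr /arcf; case: ifP => _ /=;
  rewrite ex ey (st_G hst).
Qed.

Let src := tm side.
Hypothesis src_lt : forall j, j < k -> src j < n.
Hypothesis src_inj : forall j j', j < k -> j' < k -> src j = src j' -> j = j'.

Definition is_source (v : nat) : bool := has (fun j => src j == v) (iota 0 k).

Lemma mark_sources_spec st : static st ->
  forall v, v < n -> arr (run (mark_sources side) st) asrc 0 v = is_source v.
Proof.
move=> hst v ltv; rewrite /mark_sources run_seq; set st1 := run (LFor rx rn _) st.
have h1 : arr st1 asrc 0 v = 0.
  rewrite /st1 (@fill_spec rx rn asrc _ _ _ st 0 0 (fun=> 0)) //=.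
  by rewrite (st_n hst) ltv.
have hst1 : static st1 by apply: static_run.
pose Inv i st2 := arr st2 asrc 0 v = has (fun j => src j == v) (iota 0 i).
rewrite /is_source -(st_k hst1); apply: (for_ind (Inv := Inv)) => //= i st2 lti fr ei.
have hst2 : static st2 by apply: static_frame fr hst1.
rewrite /Inv -[i.+1]addn1 iotaD has_cat run_cell /= ei (st_term hst2) // orbF => ->.
rewrite -/(src i) [v == _]eq_sym; case: (src i == v); rewrite ?orbT //.
by rewrite orbF.
Qed.

Variable st0 : state.
Hypothesis st0_static : static st0.
Hypothesis allow_ok : forall st x,
  (forall i j, arr st aH i j = arr st0 aH i j) -> x < n -> reg st rx = x ->
  (eval st allow != 0) = allowf x.

Definition built (st : state) : Prop :=
  [/\ forall x y, x < n -> y < n -> (arr st aadj x y != 0) =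
        ~~ is_source y && ((x == y) || allowf x && arcf x y),
      forall x b, x < n -> b < m -> (arr st aadj x (n + b) != 0) =
        (arr st0 aavail 0 b != 0) && (bm b x != 0)
    & forall v, v < n -> arr st asrc 0 v = is_source v].

Lemma build_spec : let st := run (build side allow) st0 in
  built st /\ forall x, x < n + m -> arr st amate 0 x = if x < n then x else n.
Proof.
move=> st; rewrite /st /build !run_seq.
set st1 := run (mark_sources side) st0.
have hst1 : static st1 by apply: static_run.
have hsrc := mark_sources_spec st0_static; rewrite -/st1 in hsrc.
set p := LFor rx rn _; set st2 := run p st1.
have hst2 : static st2 by apply: static_run.
split; last first.
  move=> x ltx; rewrite (@fill_spec rx rN amate _ _ _ st2 0 0 (fun x => if x < n then x else n)) /=.
    by rewrite (st_N hst2) ltx subn0.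
  move=> st3 i fr ei lti; have hst3 : static st3 by apply: static_frame fr hst2.
  rewrite ei (st_n hst3); split=> //; case: ltnP; lia.
suff [h1 h2] : (forall x y, x < n -> y < n -> (arr st2 aadj x y != 0) =
        ~~ is_source y && ((x == y) || allowf x && arcf x y)) /\
      (forall x b, x < n -> b < m -> (arr st2 aadj x (n + b) != 0) =
        (arr st0 aavail 0 b != 0) && (bm b x != 0)).
  split; first by move=> x y ltx lty; rewrite run_arr ?h1.
    by move=> x b ltx ltb; rewrite run_arr ?h2.
  by move=> v ltv; rewrite run_arr // run_arr // hsrc.
pose Inv i st3 := (forall x y, x < i -> y < n -> (arr st3 aadj x y != 0) =
        ~~ is_source y && ((x == y) || allowf x && arcf x y)) /\
      (forall x b, x < i -> b < m -> (arr st3 aadj x (n + b) != 0) =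
        (arr st0 aavail 0 b != 0) && (bm b x != 0)).
rewrite -{1 3}(st_n hst1); apply: (for_ind (Inv := Inv)); first by [].
move=> i st3; rewrite (st_n hst1) => lti fr ei [IH1 IH2].
have hst3 : static st3 by apply: static_frame fr hst1.
have hs3 v : v < n -> arr st3 asrc 0 v = is_source v.
  by move=> ltv; case: fr => _ -> //; rewrite hsrc.
have hH u v : arr st3 aH u v = arr st0 aH u v by case: fr => _ -> //; rewrite run_arr.
have hav b : arr st3 aavail 0 b = arr st0 aavail 0 b by case: fr => _ -> //; rewrite run_arr.
rewrite run_seq; set st4 := run (build_vertices _ _) st3.
pose val y : nat := ~~ is_source y && ((i == y) || allowf i && arcf i y).
have h4 r j : arr st4 aadj r j = if (r == i) && (j < n) then val j : nat else arr st3 aadj r j.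
  rewrite (@fill_spec ry rn aadj _ _ _ st3 i 0 val); first by rewrite (st_n hst3) subn0.
  move=> st5 y fr5 ey; rewrite (st_n hst3) => lty.
  have hst5 : static st5 by apply: static_frame fr5 hst3.
  have e5 : reg st5 rx = i by case: fr5 => ->.
  split; rewrite ?e5 ?ey //.
  rewrite eval_andE /val; congr (nat_of_bool (_ && _)).
    by rewrite /= ey nat_boolK; case: fr5 => _ ->; rewrite // hs3 // eqb0.
  rewrite /= e5 ey addn_eq0 negb_and nat_boolK.
  have := eval_and st5 allow (arc_expr side (Reg rx) (Reg ry)); rewrite /= => ->.
  rewrite (eval_arc hst5 e5 ey) (allow_ok (x := i)) //.
  by move=> u v; case: fr5 => _ ->.
have hst4 : static st4 by apply: static_run.
pose val2 b : nat := (arr st0 aavail 0 b != 0) && (bm b i != 0).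
have e4 : reg st4 rx = i by rewrite run_reg.
set st5 := run build_bags st4.
have h5 r j : arr st5 aadj r j =
    if (r == i) && (n <= j < n + m) then val2 (j - n) else arr st4 aadj r j.
  rewrite (@fill_spec ry rm aadj _ _ _ st4 i n val2); first by rewrite (st_m hst4).
  move=> st6 b fr6 eb; rewrite (st_m hst4) => ltb.
  have hst6 : static st6 by apply: static_frame fr6 hst4.
  have e6 : reg st6 rx = i by case: fr6 => ->.
  split; [exact: e6 | by rewrite /= (st_n hst6) eb |].
  rewrite eval_andE /val2 /= eb e6 (st_bag hst6).
  by case: fr6 => _ -> //; rewrite run_arr // hav.
split=> [x y|x b]; rewrite ltnS => lex lt /=.
  rewrite h5 [n <= y]leqNgt lt andbF h4 lt andbT.
  by case: (eqVneq x i) => [->|ne]; [rewrite /val nat_boolK | apply: IH1; lia].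
rewrite h5 leq_addr ltn_add2l lt andbT addKn.
case: (eqVneq x i) => [->|ne]; first by rewrite /val2 nat_boolK.
by rewrite h4 (negbTE ne); apply: IH2; lia.
Qed.

Definition adj_spec (adj : rel nat) : Prop :=
  (forall x y, x < n -> y < n ->
     adj x y = ~~ is_source y && ((x == y) || allowf x && arcf x y)) /\
  (forall x b, x < n -> b < m ->
     adj x (n + b) = (arr st0 aavail 0 b != 0) && (bm b x != 0)).

(** The outcome of a failed search: a set [q] of matched nodes, containing an
    untreated source and closed under the moves of the search. *)
Definition failed (adj : rel nat) (st : state) : Prop :=
  exists i q, [/\ i < k /\ matching n m k adj src i (arr st amate 0),
    uniq q /\ {in q, forall x, x < n + m},
    src i \in q /\ {in q, forall x, arr st amate 0 x < n},
    forall x y, x \in q -> y < n + m -> adj (arr st amate 0 x) y -> y \in q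
  & forall x, x < n + m -> arr st avis 0 x = (x \in q)].

Lemma source_is_source j : j < k -> is_source (src j).
Proof. by move=> ltj; apply/hasP; exists j; rewrite ?mem_iota. Qed.

Section Adj.

Variable adj : rel nat.
Hypothesis adj_ok : adj_spec adj.

Lemma adj_src l j : l < n -> j < k -> ~~ adj l (src j).
Proof.
move=> ltl ltj; rewrite (adj_ok.1) //; last exact: src_lt.
by rewrite source_is_source.
Qed.

Lemma adj_refl l : l < n -> (forall j, j < k -> l != src j) -> adj l l.
Proof.
move=> ltl h; rewrite (adj_ok.1) // eqxx andbT; apply/hasPn => j.
by rewrite mem_iota eq_sym => /h.
Qed.

Definition menger_state (st : state) (i : nat) : Prop :=
  (reg st rfail = 0 /\ matching n m k adj src i (arr st amate 0)) \/
  (reg st rfail = 1 /\ failed adj st).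

Lemma menger_body_spec st i : static st -> (forall x y, (arr st aadj x y != 0) = adj x y) ->
  i < k -> reg st ri = i -> menger_state st i ->
  menger_state (run (menger_body side) st) i.+1.
Proof.
move=> hst hadj lti ei hs; rewrite /menger_body run_if /=.
case: hs => [[rf mt_ok]|[rf hf]]; rewrite rf /=; last by right.
rewrite run_seq run_set run_seq /= ei (st_term hst) // -/(src i).
set st1 := set_reg st rstart (src i).
have hst1 : static st1.
  by apply: (static_frame (p := LReg rstart (Lit _))) (run_frame _ _) hst.
have lts := src_lt lti.
have mts := source_mated src_lt src_inj lti mt_ok.
have [||q hq] := @search_spec rN n st1 (arr st1 amate 0) adj (fun=> erefl) hadj (st_n hst1) isT.
- by rewrite /= (st_N hst) ltn_addr.
- by rewrite /= neq_ltn mts.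
set st2 := run (search rN) st1 in hq *.
have hst2 : static st2 by apply: static_run.
have rf2 : reg st2 rfail = 0 by rewrite run_reg.
have mt2 x : arr st2 amate 0 x = arr st amate 0 x by rewrite run_arr.
have mt2_ok : matching n m k adj src i (arr st2 amate 0).
  by apply: holed_matching_ext mt_ok => //; exact: ltnW.
rewrite run_if /=; case: hq => [[f0 sr]|[f1 [h [sr lth]]]].
  rewrite f0 /= run_set; right; split=> //.
  move: sr => [ex _ ev _]; move: ex; rewrite f0 /= (st_N hst) => ex.
  exists i, q; split=> //=.
  - by split; [exact: ex_uniq ex | exact: ex_lt ex].
  - split; first by rewrite -(ex_head ex) mem_nth ?(ex_pos ex).
    move=> x xq; have := ex_lt ex xq => ltx; rewrite mt2.
    rewrite ltn_neqAle (mate_le mt_ok) // andbT.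
    exact: (allP (ex_found ex)).
  - move=> x y xq lty; rewrite mt2 => axy.
    rewrite -(nth_index 0 xq) in axy; apply: (ex_closed ex) axy => //.
      by rewrite index_mem.
    by left; rewrite index_mem.
  - by move=> x ltx; apply: ev; rewrite /= (st_N hst).
rewrite f1; left; split; first by rewrite run_reg.
case: sr => ex _ _ _; move: ex; rewrite /= (st_N hst).
case ef: (reg st2 rfound) f1 => [|f] // _ ex.
apply: (augment_spec src_lt src_inj adj_src lti mt_ok ex lth) => //.
- exact: st_n.
- exact: st_N.
- by rewrite run_reg.
Qed.

End Adj.

Lemma fwd_spec adj i st : static st -> i <= k ->
  matching n m k adj src i (arr st amate 0) ->
  let st1 := run (LFor rx rN (SetRow afwd (Row amate (Reg rx)) (Reg rx))) st in
  forall l, l < n -> arr st1 afwd 0 l < n + m /\ arr st amate 0 (arr st1 afwd 0 l) = l.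
Proof.
move=> hst lik mt_ok st1 l ltl; have [r ltr er] := mate_sur mt_ok ltl.
suff -> : arr st1 afwd 0 l = r by [].
have ltr' : r < reg st rN by rewrite (st_N hst).
move: ltr'; pose Inv x st2 := x <= n + m -> r < x -> arr st2 afwd 0 l = r.
suff: Inv (reg st rN) st1 by rewrite /Inv (st_N hst); apply.
apply: for_ind => // x st2 ltx fr ex IH lex.
rewrite run_cell /= ex ltnS leq_eqVlt.
have -> : arr st2 amate 0 x = arr st amate 0 x by case: fr => _ ->.
case: eqP => [<- _|_ /= ltrx]; first by rewrite er eqxx.
case: eqP => [e|_]; last by apply: IH => //; lia.
by apply: (mate_inj mt_ok); rewrite -?e //.
Qed.

Lemma menger_spec : reg st0 rfail = 0 ->
  let st := run (menger side allow) st0 in exists2 adj, adj_spec adj &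
  [/\ forall v, v < n -> arr st asrc 0 v = is_source v,
      forall l, l < n -> arr st afwd 0 l < n + m /\ arr st amate 0 (arr st afwd 0 l) = l
    & menger_state adj st k].
Proof.
move=> rf0; rewrite /menger !run_seq.
have [[b1 b2 b3] bmate] := build_spec.
set st1 := run (build side allow) st0 in b1 b2 b3 bmate *.
have hst1 : static st1 by apply: static_run.
pose adj : rel nat := fun x y => arr st1 aadj x y != 0.
have adj_ok : adj_spec adj by split.
exists adj => //.
have i0 : menger_state adj st1 0.
  left; split; first by rewrite run_reg.
  apply: (holed_matching_ext src_lt) (matching_init _ _) => //.
    by move=> r /bmate ->.
  exact: adj_refl.
set p := LFor ri rk _; set st2 := run p st1.
have hst2 : static st2 by apply: static_run.
have i2 : menger_state adj st2 k.
  rewrite -(st_k hst1); pose Inv i st := menger_state adj st i.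
  apply: (for_ind (Inv := Inv)) => // i st; rewrite (st_k hst1) => lti fr ei IH.
  have hst : static st by apply: static_frame fr hst1.
  have hadj x y : (arr st aadj x y != 0) = adj x y by case: fr => _ ->.
  exact: menger_body_spec IH.
have [i lik mt_ok] : exists2 i, i <= k & matching n m k adj src i (arr st2 amate 0).
  by case: i2 => [[_ h]|[_ [i [q [[/ltnW lti h]]]]]]; [exists k | exists i].
have hf := fwd_spec hst2 lik mt_ok.
set p3 := LFor rx rN _ in hf *; set st3 := run p3 st2 in hf *.
have mt3 x : arr st3 amate 0 x = arr st2 amate 0 x by rewrite run_arr.
split=> [v ltv|l /hf[h1 h2]|].
- by rewrite run_arr // run_arr // b3.
- by rewrite mt3.
have ext i' := holed_matching_ext (adj := adj) src_lt (i := i') (fun r _ => esym (mt3 r)).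
case: i2 => [[rf h]|[rf [i' [q [[h0 h1] h2 [h3 h4] h5 h6]]]]].
  by left; split; [rewrite run_reg | exact: ext].
right; split; first by rewrite run_reg.
exists i', q; split=> //.
- by split=> //; apply: ext => //; exact: ltnW.
- by split=> // x xq; rewrite mt3; exact: h4.
- by move=> x y xq lty; rewrite mt3; exact: h5.
- by move=> x ltx; rewrite run_arr // h6.
Qed.

End Menger.

(** * Marking vertices *)

Lemma mark_spec x h a er cond st (R : nat) (P : pred nat) :
  let p := LFor x h (LIf cond (LCell a er (Reg x) (Lit 1)) LSkip) in
  (forall st1 i, frame p st st1 -> reg st1 x = i -> i < reg st h ->
     eval st1 er = R /\ (eval st1 cond != 0) = P i) ->
  forall r j, arr (run p st) a r j =
    if [&& r == R, j < reg st h & P j] then 1 else arr st a r j.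
Proof.
move=> p hp r j.
pose Inv i st1 := arr st1 a r j = if [&& r == R, j < i & P j] then 1 else arr st a r j.
apply: (for_ind (Inv := Inv)) => [|i st1 lti fr ei]; rewrite /Inv.
  by rewrite ltn0 andbF.
have [eR eP] := hp st1 i fr ei lti; rewrite run_if eP => h1.
rewrite ltnS leq_eqVlt; move: h1; case: (eqVneq j i) => [->|ne] h1 /=.
  case: ifP => Pi; last by rewrite andbF h1 Pi !andbF.
  by rewrite run_cell /= eR ei !eqxx !andbT h1 ltnn andbF.
by case: ifP => Pi; rewrite ?run_cell /= ?eR ?ei ?(negbTE ne) ?andbF h1.
Qed.

Section Marks.

Variables (n k c m rho : nat) (gm bm tm : nat -> nat -> nat).
Let static := static n k c m rho gm bm tm.
Variable side : nat.

Lemma mark_moving_spec st : static st -> forall r v,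
  arr (run (mark_moving side) st) aH r v =
  if [&& r == side, v < n & (arr st afwd 0 v < n) && (arr st afwd 0 v != v)]
  then 1 else arr st aH r v.
Proof.
move=> hst r v.
rewrite (@mark_spec rx rn aH _ _ st side
  (fun v => (arr st afwd 0 v < n) && (arr st afwd 0 v != v))) ?(st_n hst) //.
move=> st1 i fr ei lti; split=> //; rewrite eval_and /= ei.
have hst1 : static st1 by apply: static_frame fr hst.
rewrite (st_n hst1); case: fr => _ -> //; rewrite nat_boolK addn1; congr (_ && _).
by case: (_ == i).
Qed.

Lemma mark_bag_spec a er b st R x : static st -> reg st x = b -> x != ry -> a != abag ->
  (forall st1, (forall y, y != ry -> reg st1 y = reg st y) -> eval st1 er = R) ->
  let p := LFor ry rn (LIf (Cell abag (Reg x) (Reg ry)) (LCell a er (Reg ry) (Lit 1)) LSkip) in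
  forall r v, arr (run p st) a r v =
  if [&& r == R, v < n & bm b v != 0] then 1 else arr st a r v.
Proof.
move=> hst eb xy ab hR p r v.
rewrite (@mark_spec ry rn a _ _ st R (fun v => bm b v != 0)) ?(st_n hst) //.
move=> st1 i fr ei lti; split.
  by apply: hR => y ne; case: fr => -> //; rewrite inE.
rewrite /= ei; case: fr => fr ->; last by rewrite inE eq_sym.
by rewrite fr ?inE // eb (st_bag hst).
Qed.

Lemma mark_bags_spec st : static st ->
  (forall b, b < m -> arr (run (mark_bags side) st) aavail 0 b =
     if arr st amate 0 (n + b) < n then 0 else arr st aavail 0 b) /\
  (forall r v, arr (run (mark_bags side) st) aH r v =
     if [&& r == side, v < n & has (fun b => (arr st amate 0 (n + b) < n) && (bm b v != 0))
                                 (iota 0 m)]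
     then 1 else arr st aH r v).
Proof.
move=> hst.
pose used b := arr st amate 0 (n + b) < n.
pose Inv i st1 :=
  (forall b, arr st1 aavail 0 b = if (b < i) && used b then 0 else arr st aavail 0 b) /\
  (forall r v, arr st1 aH r v =
     if [&& r == side, v < n & has (fun b => used b && (bm b v != 0)) (iota 0 i)]
     then 1 else arr st aH r v).
suff : Inv (reg st rm) (run (mark_bags side) st).
  by rewrite (st_m hst) => -[h1 h2]; split=> // b ltb; rewrite h1 ltb.
apply: for_ind.
  by split=> [b|r v] //=; rewrite !andbF.
move=> i st1 lti fr ei [IH1 IH2].
have hst1 : static st1 by apply: static_frame fr hst.
have eu : (arr st1 amate 0 (n + i) < n) = used i by case: fr => _ ->.
rewrite run_if /= ei (st_n hst1) nat_boolK addn1 eu.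
split=> [b|r v].
  rewrite ltnS leq_eqVlt; case: ifP => ui /=.
    rewrite run_seq run_arr // run_cell /= ei.
    by case: (eqVneq b i) => [->|ne]; rewrite ?ui ?IH1.
  by case: (eqVneq b i) => [->|ne]; rewrite ?ui IH1 ?ui ?andbF.
rewrite -[i.+1]addn1 iotaD has_cat [has _ (iota (0 + i) 1)]/= orbF.
case: ifP => ui /=; last by rewrite orbF IH2.
rewrite run_seq (@mark_bag_spec aH _ i _ side rx) //.
- rewrite run_cell /= IH2; case: (r == side); case: (v < n) => //=.
  by case: (has _ _); case: (bm i v).
- by rewrite run_cell; apply: (static_frame (p := SetRow aavail (Reg rx) (Lit 0))) (run_frame _ _) hst1.
Qed.

End Marks.

(** * Output of a cut *)

Lemma collect_spec row a h st : a != aout -> h \notin [:: rcnt; rx] ->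
  let st1 := run (collect row a h) st in
  out_list st1 row = [seq x <- iota 0 (reg st h) | arr st a 0 x != 0] /\
  forall r j, r != row -> arr st1 aout r j = arr st aout r j.
Proof.
move=> ha; rewrite !inE negb_or => /andP[hc hx].
rewrite /collect !run_seq run_set /=; set st1 := set_reg st rcnt 0.
set p := LFor _ _ _.
have eh : reg st1 h = reg st h by rewrite /= (negbTE hc).
pose l i := [seq x <- iota 0 i | arr st a 0 x != 0].
pose Inv i st2 := [/\ reg st2 rcnt = size (l i),
   forall j, j < size (l i) -> arr st2 aout row j.+1 = nth 0 (l i) j
 & forall r j, r != row -> arr st2 aout r j = arr st aout r j].
have : Inv (reg st1 h) (run p st1).
  apply: for_ind => // i st2 lti fr ei [h1 h2 h3].
  have ea : arr st2 a 0 i = arr st a 0 i.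
    by case: fr => _ -> //; rewrite inE.
  have el : l i.+1 = l i ++ (if arr st a 0 i != 0 then [:: i] else [::]).
    by rewrite /l -[i.+1]addn1 iotaD filter_cat /= add0n.
  rewrite run_if /= ei ea /Inv el; case: ifP => _; last by rewrite cats0.
  rewrite !runE /= ei h1 cats1 size_rcons addn1; split=> // [j|r j ne].
    rewrite ltnS nth_rcons eqxx /= eqSS => lej.
    case: (eqVneq j (size (l i))) => [->|ne]; first by rewrite ltnn.
    by have ltj : j < size (l i) by [lia]; rewrite ltj h2.
  by rewrite (negbTE ne) /= h3.
rewrite eh => -[h1 h2 h3]; rewrite run_cell /= h1; split; last first.
  by move=> r j ne; rewrite /= (negbTE ne) /= h3.
rewrite /out_list /= !eqxx /=; apply: (@eq_from_nth _ 0).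
  by rewrite size_mkseq.
by move=> j; rewrite size_mkseq => ltj; rewrite nth_mkseq //= ?andbF h2.
Qed.

Lemma out_set_filter (N : nat) st row (P : pred nat) :
  out_list st row = [seq x <- iota 0 N | P x] ->
  out_set st row [set x : 'I_N | P x].
Proof.
move=> e; exists [seq x <- enum 'I_N | P (val x)].
  by rewrite e -val_enum_ord filter_map.
by apply/setP=> x; rewrite !inE mem_filter mem_enum andbT.
Qed.

Lemma path_reached (n k : nat) (e : rel 'I_n) (s : 'I_k -> 'I_n) (X : {set 'I_n}) j x p :
  path e x p -> x = s j -> all (fun v => v \notin X) (x :: p) ->
  reached e s setT X (last x p).
Proof.
move=> pth ex /= /andP[xX pX]; apply/existsP; exists j; rewrite -ex xX /=.
apply/connectP; exists p => //; elim: p x {ex xX} pth pX => //= y p IH x.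
by case/andP=> exy pth /andP[yX pX]; rewrite /lim_arc exy inE yX IH.
Qed.


(** * The bramble and its disjoint paths *)

Section Main.

Variables (n k c m : nat) (G : digraph 'I_n) (B : 'I_m -> subgraph G).
Variables (s t : 'I_k -> 'I_n).
Hypothesis k_gt0 : 0 < k.
Hypothesis c_gt1 : 1 < c.
Hypothesis B_bramble : bramble B.
Hypothesis B_cong : congestion B c.
Hypothesis s_inj : injective s.
Hypothesis t_inj : injective t.
Hypothesis m_large : g k c <= m.

Definition bag (i : 'I_m) : {set 'I_n} := sverts (B i).
Definition sarcs (side : nat) : rel 'I_n :=
  fun u v => if side == 0 then Defs.arc G u v else Defs.arc G v u.
Definition term (side : nat) : 'I_k -> 'I_n := if side == 0 then s else t.

Lemma term_inj side : injective (term side).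
Proof. by rewrite /term; case: ifP. Qed.

Lemma bag_strong i u v : u \in bag i -> v \in bag i ->
  connect (fun x y => [&& Defs.arc G x y, x \in bag i & y \in bag i]) u v.
Proof.
move=> ui vi; have := B_bramble.1 i u v ui vi; apply: connect_sub => x y.
move=> /existsP[a /and3P[ain /eqP sx /eqP ty]]; apply: connect1.
have /andP[h1 h2] := sedgesP ain; rewrite -sx -ty /bag h1 h2 !andbT.
by apply/existsP; exists a; rewrite !eqxx.
Qed.

Lemma side_conn side i u v : u \in bag i -> v \in bag i ->
  connect (fun x y => [&& sarcs side x y, x \in bag i & y \in bag i]) u v.
Proof.
move=> ui vi; rewrite /sarcs; case: (side == 0); first exact: bag_strong.
pose r x y := [&& Defs.arc G x y, x \in bag i & y \in bag i].
have h : connect r v u := bag_strong vi ui.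
have : connect (fun x y => r y x) u v by exact: etrans (connect_rev r u v) h.
by apply: connect_sub => x y; rewrite /= /r => /and3P[h1 h2 h3]; apply: connect1; rewrite h1 h2 h3.
Qed.

Lemma side_touch side i j : (exists2 v, v \in bag i & v \in bag j) \/
  (exists u v, [/\ u \in bag i, v \in bag j & sarcs side u v]).
Proof.
case: (B_bramble.2 i j) => [/set0Pn[v]|[[a [sa ta]] [a' [sa' ta']]]].
  by rewrite inE => /andP[h1 h2]; left; exists v.
right; rewrite /sarcs; case: (side == 0).
  by exists (src a), (tgt a); split=> //; apply/existsP; exists a; rewrite !eqxx.
by exists (tgt a'), (src a'); split=> //; apply/existsP; exists a'; rewrite !eqxx.
Qed.

Lemma bag_neq0 i : exists v, v \in bag i.
Proof.
by case: (side_touch 0 i i) => [[v h _]|[v [_ [h _ _]]]]; exists v.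
Qed.

Definition gm (u v : nat) : nat :=
  at_ord (fun u => at_ord (fun v => multiplicity G u v) v) u.
Definition bm (b v : nat) : nat :=
  at_ord (fun b => at_ord (fun v => v \in sverts (B b) : nat) v) b.
Definition tm (i : nat) : nat -> nat := at_ord (fun l => term i l : nat).

Lemma gmE (u v : 'I_n) : (gm u v != 0) = Defs.arc G u v.
Proof.
rewrite /gm !at_ordE -lt0n card_gt0; apply/set0Pn/existsP => [[a]|[a h]].
  by rewrite inE; exists a.
by exists a; rewrite inE.
Qed.

Lemma bmE (b : 'I_m) (v : 'I_n) : bm b v = (v \in bag b).
Proof. by rewrite /bm !at_ordE. Qed.

Lemma tmE i (j : 'I_k) : tm i j = term i j.
Proof. by rewrite /tm at_ordE. Qed.

Let rho := c * (k - 1) + 1.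
Let static := static n k c m rho gm bm tm.

Lemma arcfE side (u v : 'I_n) : arcf gm side u v = sarcs side u v.
Proof. by rewrite /arcf /sarcs; case: ifP => _; exact: gmE. Qed.

Lemma is_sourceE side (v : 'I_n) : is_source k tm side v = (v \in sources (term side)).
Proof.
apply/hasP/imsetP => [[j]|[j _ ->]].
  rewrite mem_iota => ltj /eqP e; exists (Ordinal ltj) => //; apply: val_inj.
  by rewrite /= -tmE e.
by exists (j : nat); rewrite ?mem_iota //= tmE.
Qed.

Definition set_of_row (N : nat) (f : nat -> nat) : {set 'I_N} := [set x : 'I_N | f x != 0].

Definition Aset (st : state) : {set 'I_m} := set_of_row m (arr st aavail 0).
Definition Hset (st : state) (side : nat) : {set 'I_n} := set_of_row n (arr st aH side).

Section AdjSets.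

Variables (side : nat) (allowf : nat -> bool) (st0 : state) (adj : rel nat).
Hypothesis adj_ok : adj_spec n k m gm bm tm side allowf st0 adj.

Let H := [set x : 'I_n | allowf x].

Lemma adj_vertices (u v : 'I_n) : adj u v =
  (v \notin sources (term side)) && ((u == v) || (u \in H) && sarcs side u v).
Proof. by rewrite (adj_ok.1) // is_sourceE inE arcfE. Qed.

Lemma adj_bags (u : 'I_n) (b : 'I_m) : adj u (n + b) = (b \in Aset st0) && (u \in bag b).
Proof. by rewrite (adj_ok.2) // bmE inE nat_boolK. Qed.

End AdjSets.

(** ** The rounds *)

(** What a failed round leaves behind, in the form in which the program computes
    the cut. *)
Definition cut_state (side : nat) (st : state) : Prop :=
  exists X : {set 'I_n}, [/\ #|X| < k,
    forall v : 'I_n, (v \in X) = (arr st avis 0 (arr st afwd 0 v) == 0) &&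
      ((arr st asrc 0 v != 0) || (arr st avis 0 v != 0))
    & forall i u, [disjoint X & bag i] -> u \in bag i ->
        ~~ reached (sarcs side) (term side) setT X u].

Lemma failed_cut side allowf st0 adj st :
  adj_spec n k m gm bm tm side allowf st0 adj ->
  failed n k m tm side adj st ->
  (forall v, v < n -> arr st asrc 0 v = is_source k tm side v) ->
  (forall l, l < n -> arr st afwd 0 l < n + m /\ arr st amate 0 (arr st afwd 0 l) = l) ->
  let H := [set x : 'I_n | allowf x] in
  exists (X : {set 'I_n}) (Y : {set 'I_m}), [/\ #|X| + #|Y| < k,
    forall v : 'I_n, (v \in X) = (arr st avis 0 (arr st afwd 0 v) == 0) &&
      ((arr st asrc 0 v != 0) || (arr st avis 0 v != 0))
    & forall v b, reached (sarcs side) (term side) H X v -> b \in Aset st0 ->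
        v \in bag b -> b \in Y].
Proof.
move=> adj_ok [i [q [[lti mt_ok] [qu ql] [sq qm] qc qv]]] hsrc hfwd H.
have aV := adj_vertices adj_ok; have aB := adj_bags adj_ok.
exists (cutV (term side) (arr st amate 0) q), (cutB n m q); split.
- exact: (cut_card (@term_inj side) aV lti mt_ok qu ql sq qm qc).
- move=> v; rewrite inE; have [f1 f2] := hfwd v (ltn_ord v).
  rewrite (qv _ f1) (qv _ (ltn_addr _ (ltn_ord v))) hsrc // is_sourceE !nat_boolK eqb0.
  congr (~~ _ && _); apply/left_sideP/idP => [[x xq ex]|fq].
    suff -> : arr st afwd 0 v = x by [].
    by apply: (mate_inj mt_ok) => //; rewrite ?f2 ?ex //; exact: ql.
  by exists (arr st afwd 0 v).
- by move=> v b; exact: (cut_bags aV aB qc).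
Qed.

Lemma src_lt_side side j : j < k -> tm side j < n.
Proof. exact: (@src_lt n k (term side)). Qed.

Lemma src_inj_side side j j' : j < k -> j' < k -> tm side j = tm side j' -> j = j'.
Proof. exact: (@src_inj n k (term side) (@term_inj side)). Qed.

(** [A0] is the set of bags available before the rounds, so [A0 :\: Aset st] is
    the set of final bags of the rounds. *)
Record round_inv (side : nat) (A0 : {set 'I_m}) (st0 : state) (r : nat) (st : state) : Prop :=
  RoundInv {
    ri_avail : Aset st \subset A0;
    ri_card : #|A0 :\: Aset st| <= k * r;
    ri_progress : progress (sarcs side) bag (term side) r (Hset st side) (A0 :\: Aset st);
    ri_bags : forall b, b \in A0 :\: Aset st -> bag b \subset Hset st side;
    ri_settled : forall v, v \in Hset st side ->
      (exists2 b, b \in A0 :\: Aset st & v \in bag b) \/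
      (forall b, b \in Aset st -> v \notin bag b);
    ri_other : forall i v, i != side -> arr st aH i v = arr st0 aH i v }.

Definition round_state side A0 st0 r st : Prop :=
  static st /\ ((reg st rfail = 0 /\ round_inv side A0 st0 r st) \/
                (reg st rfail = 1 /\ cut_state side st)).

Section Marked.

Variables (side : nat) (st1 : state) (adj : rel nat).
Hypothesis st1_static : static st1.

Let st3 := run (mark_bags side) (run (mark_moving side) st1).
Let used := used_bags n m (arr st1 amate 0).
Let mov := moving n (arr st1 afwd 0).

Lemma marked_H (v : 'I_n) : (v \in Hset st3 side) =
  [|| v \in Hset st1 side, v \in mov | [exists b in used, v \in bag b]].
Proof.
have hst2 : static (run (mark_moving side) st1) by apply: static_run.
rewrite !inE /st3 (mark_bags_spec side hst2).2 eqxx ltn_ord /= (mark_moving_spec side st1_static).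
rewrite eqxx ltn_ord /=; set h := has _ _; set h' := [exists b in used, v \in bag b].
have -> : h = h'.
  apply/hasP/existsP => [[b]|[b /andP[bu vb]]].
    rewrite mem_iota => /= ltb /andP[h1 h2]; exists (Ordinal ltb).
    rewrite inE -[_ \in bag _]nat_boolK -bmE h2 andbT /=.
    by move: h1; rewrite run_arr.
  exists (b : nat); rewrite ?mem_iota //= bmE nat_boolK vb andbT run_arr //.
  by move: bu; rewrite inE.
case: h'; rewrite ?orbT //= orbF.
by case: ifP => _; rewrite ?orbT ?orbF.
Qed.

Lemma marked_A : Aset st3 = Aset st1 :\: used.
Proof.
have hst2 : static (run (mark_moving side) st1) by apply: static_run.
apply/setP=> b; rewrite !inE /st3 (mark_bags_spec side hst2).1 //.
by rewrite run_arr // run_arr //; case: ifP.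
Qed.

Lemma marked_other i v : i != side -> arr st3 aH i v = arr st1 aH i v.
Proof.
have hst2 : static (run (mark_moving side) st1) by apply: static_run.
move=> /negbTE ne; rewrite /st3 (mark_bags_spec side hst2).2 ne /=.
by rewrite (mark_moving_spec side st1_static) ne.
Qed.

End Marked.

(** At most [k] bags per round become unavailable, so that more than
    [c * (k - 1)] remain, and a failure gives a cut by [cut_isolates]. *)
Lemma round_step side (A0 : {set 'I_m}) st0 r st : side < 2 -> r < rho ->
  k * rho + c * (k - 1) < #|A0| ->
  round_state side A0 st0 r st ->
  round_state side A0 st0 r.+1
    (run (LIf (Eqn (Reg rfail) (Lit 0))
       (menger side (Lit 1) ;;
        LIf (Eqn (Reg rfail) (Lit 0)) (mark_moving side ;; mark_bags side) LSkip)
       LSkip) st).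
Proof.
move=> side2 ltr hA [hst hs]; rewrite run_if /=.
case: hs => [[rf [iav icard iprog ibags iset ioth]]|[rf hc]]; rewrite rf /=; last first.
  by split=> //; right.
rewrite run_seq; set st1 := run (menger side (Lit 1)) st.
have hst1 : static st1 by rewrite /st1; case: (side) side2 => [|[]] // _; apply: static_run.
have [adj adj_ok [hsrc hfwd hstate]] :=
  menger_spec (allow := Lit 1) (allowf := fun=> true) side2 (@src_lt_side side) (@src_inj_side side)
    hst (fun _ _ _ _ _ => erefl) rf.
rewrite -/st1 in hsrc hfwd hstate.
have aH1 i v : arr st1 aH i v = arr st aH i v by rewrite run_arr.
have eA1 : Aset st1 = Aset st by apply/setP=> b; rewrite !inE run_arr.
have eH1 : Hset st1 side = Hset st side by apply/setP=> v; rewrite !inE aH1.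
have aV := adj_vertices adj_ok; have aB := adj_bags adj_ok.
have cardA : c * (k - 1) < #|Aset st|.
  have := cardsID (Aset st) A0; have -> : A0 :&: Aset st = Aset st.
    by apply/setIidPr.
  have : k * r <= k * rho by rewrite leq_mul2l ltnW ?orbT.
  by lia.
rewrite run_if /=; case: hstate => [[rf1 mt_ok]|[rf1 hfail]]; rewrite rf1 /=; last first.
  split; first exact: hst1.
  right; split=> //.
  have [X [Y [h1 h2 h3]]] := failed_cut adj_ok hfail hsrc hfwd.
  exists X; split=> //; first by lia.
  move=> i u di ui.
  have eT : [set x : 'I_n | true] = setT by apply/setP=> x; rewrite !inE.
  rewrite eT in h3.
  exact: (cut_isolates (side_conn side) (side_touch side) B_cong (ltnW c_gt1) h1 cardA h3
            (subsetT _) di ui).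
set st3 := run _ _; have hst3 : static st3.
  by rewrite /st3; case: (side) side2 => [|[]] // _; apply: static_run.
split=> //; left; split; first by rewrite run_reg.
have f_lt l : l < n -> arr st1 afwd 0 l < n + m by case/hfwd.
have mate_f l : l < n -> arr st1 amate 0 (arr st1 afwd 0 l) = l by case/hfwd.
pose used := used_bags n m (arr st1 amate 0).
have eA3 : Aset st3 = Aset st :\: used by rewrite /st3 run_seq marked_A // eA1.
have eH3 v : (v \in Hset st3 side) =
   [|| v \in Hset st side, v \in moving n (arr st1 afwd 0) | [exists b in used, v \in bag b]].
  by rewrite /st3 run_seq marked_H // eH1.
have uA : used \subset Aset st by apply: (used_avail aB mt_ok).
have eF : A0 :\: Aset st3 = (A0 :\: Aset st) :|: used.
  apply/setP=> b; rewrite eA3 !in_setD in_setU in_setD negb_and negbK.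
  have [bu|bu] := boolP (b \in used); rewrite ?orbT ?orbF //=.
  by rewrite (subsetP iav) // (subsetP uA).
have subH : Hset st side \subset Hset st3 side.
  by apply/subsetP=> v hv; rewrite eH3 hv.
split.
- by rewrite eA3; apply: subset_trans (subsetDl _ _) iav.
- rewrite eF; apply: leq_trans (leq_card_setU _ _) _; rewrite mulnS addnC.
  by apply: leq_add => //; apply: (card_used (@term_inj side) mt_ok).
- rewrite eF; apply: (progress_round (@term_inj side) aV aB mt_ok f_lt mate_f iprog subH).
    by apply/subsetP=> v hv; rewrite eH3 hv orbT.
  by rewrite -setI_eq0; apply/eqP/setP=> b; rewrite !inE; case: (_ != 0); rewrite ?andbF.
- move=> b; rewrite eF in_setU => /orP[bF|bu].
    by apply: subset_trans (ibags b bF) subH.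
  apply/subsetP=> v vb; rewrite eH3; apply/orP; right; apply/orP; right.
  by apply/existsP; exists b; rewrite bu.
- move=> v; rewrite eH3 eF; case/or3P => [vH|vM|/existsP[b /andP[bu vb]]].
  + case: (iset v vH) => [[b bF vb]|nv]; first by left; exists b; rewrite // in_setU bF.
    by right=> b; rewrite eA3 in_setD => /andP[_]; exact: nv.
  + right=> b; rewrite eA3 in_setD => /andP[nu bA]; apply/negP => vb.
    by case/negP: nu; exact: (moving_settled aB mt_ok mate_f vM bA vb).
  + by left; exists b; rewrite // in_setU bu orbT.
- by move=> i v ne; rewrite /st3 run_seq marked_other // aH1 ioth.
Qed.

Lemma rounds_spec side st : side < 2 -> static st -> reg st rfail = 0 ->
  k * rho + c * (k - 1) < #|Aset st| ->
  (forall v : 'I_n, v \notin Hset st side) ->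
  round_state side (Aset st) st rho (run (rounds side) st).
Proof.
move=> side2 hst rf hA hH.
rewrite -{1}(st_rho hst); apply: (for_ind (Inv := round_state side (Aset st) st)).
  split; first by apply: (static_frame (p := LReg rr (Lit _))) (run_frame _ _) hst.
  have eA : Aset (set_reg st rr 0) = Aset st by [].
  left; split=> //; split; rewrite ?eA //.
  - by rewrite setDv cards0.
  - by move=> b; rewrite setDv inE.
  - by move=> v; rewrite (negbTE (hH v)).
move=> i st1; rewrite (st_rho hst) => lti fr ei IH.
have [h1 h2] := round_step side2 lti hA IH; set st2 := run _ _ in h1 h2 *.
split; first by apply: (static_frame (p := LReg rr (Lit _))) (run_frame _ _) h1.
by case: h2 => [[h3 [h4 h5 h6 h7 h8 h9]]|[h3 h4]]; [left | right]; split.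
Qed.


Definition spared (X : {set 'I_n}) : {set 'I_m} := [set b | [disjoint X & bag b]].

Lemma card_spared (X : {set 'I_n}) : #|X| < k -> g k c - c * (k - 1) <= #|spared X|.
Proof.
move=> hX; have hhit : #|~: spared X| <= c * (k - 1).
  have -> : ~: spared X = [set b | ~~ [disjoint X & bag b]].
    by apply/setP=> b; rewrite !inE.
  apply: leq_trans (card_hit (bag := bag) B_cong X) _.
  by rewrite leq_mul2l; apply/orP; right; lia.
by have := cardsC (spared X); rewrite card_ord; lia.
Qed.

Lemma output_cut_spec st (X : {set 'I_n}) : static st ->
  (forall v : 'I_n, (v \in X) = (arr st avis 0 (arr st afwd 0 v) == 0) &&
      ((arr st asrc 0 v != 0) || (arr st avis 0 v != 0))) ->
  let st1 := run output_cut st in out_set st1 0 (spared X) /\ out_set st1 1 X.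
Proof.
move=> hst hX; rewrite /output_cut 3!run_seq.
set st1 := run cut_vertices st.
have hst1 : static st1 by apply: static_run.
have hX1 (v : 'I_n) : (arr st1 aX 0 v != 0) = (v \in X).
  rewrite /st1 (@fill_spec rx rn aX _ _ _ st 0 0 (fun v =>
    (arr st avis 0 (arr st afwd 0 v) == 0) &&
      ((arr st asrc 0 v != 0) || (arr st avis 0 v != 0)))).
    by rewrite (st_n hst) /= ltn_ord subn0 nat_boolK hX.
  move=> st2 i [fr fa] ei lti; split=> //.
  by rewrite eval_andE /= ei !fa // nat_boolK addn_eq0 negb_and.
set st2 := run spare_bags st1.
have hst2 : static st2 by apply: static_run.
have hk (b : 'I_m) : (arr st2 akeep 0 b != 0) = (b \in spared X).
  pose hit b := has (fun v => (arr st1 aX 0 v != 0) && (bm b v != 0)) (iota 0 n).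
  have ehit : hit b = (b \notin spared X).
    rewrite inE disjoint_subset; apply/hasP/subsetPn => [[v]|[v vX vb]].
      rewrite mem_iota => /= ltv /andP[h1 h2]; exists (Ordinal ltv).
        by rewrite -hX1.
      by rewrite inE negbK -[_ \in bag _]nat_boolK -bmE.
    exists (v : nat); first by rewrite mem_iota ltn_ord.
    by rewrite hX1 vX bmE nat_boolK; move: vb; rewrite inE negbK.
  rewrite -[b \in _]negbK -ehit.
  pose Inv i st3 := forall b, b < i -> (arr st3 akeep 0 b != 0) = ~~ hit b.
  suff: Inv (reg st1 rm) st2 by apply; rewrite (st_m hst1).
  apply: for_ind => // i st3; rewrite (st_m hst1) => lti fr ei IH b'.
  have hst3 : static st3 by apply: static_frame fr hst1.
  rewrite run_seq run_cell /= ei; set st4 := set_cell st3 _ _ _ _.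
  have hst4 : static st4.
    by apply: (static_frame (p := SetRow akeep (Lit i) (Lit 1))) (run_frame _ _) hst3.
  pose Inv2 j st5 := forall b', arr st5 akeep 0 b' =
    if (b' == i) && has (fun v => (arr st1 aX 0 v != 0) && (bm i v != 0)) (iota 0 j)
    then 0 else arr st4 akeep 0 b'.
  have /(_ b') -> : Inv2 (reg st4 rn) (run (LFor ry rn
       (LIf (And (Row aX (Reg ry)) (Cell abag (Reg rx) (Reg ry)))
          (SetRow akeep (Reg rx) (Lit 0)) LSkip)) st4).
    apply: for_ind; first by move=> b2 /=; rewrite andbF.
    move=> j st5 ltj fr5 ej IH5 b2.
    have hst5 : static st5 by apply: static_frame fr5 hst4.
    have e5 : reg st5 rx = i by case: fr5 => ->.
    have eX : arr st5 aX 0 j = arr st1 aX 0 j.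
      by case: fr5 => _ -> //; case: fr => _ /= ->.
    rewrite -[j.+1]addn1 iotaD has_cat [has _ (iota (0 + j) 1)]/= orbF.
    rewrite run_if eval_and /= ej e5 eX (st_bag hst5).
    case: ifP => hj; last by rewrite /= orbF IH5.
    rewrite run_cell /= e5 orbT andbT; case: (eqVneq b2 i) => [//|ne].
    by rewrite IH5 /= !(negbTE ne).
  rewrite (st_n hst4) -/(hit i) /= ltnS leq_eqVlt.
  case: (eqVneq b' i) => [-> _|ne /= ltb]; last exact: IH.
  by case: (hit i).
have hX2 (v : 'I_n) : (arr st2 aX 0 v != 0) = (v \in X) by rewrite run_arr.
set st3 := run (collect 0 akeep rm) st2.
have hst3 : static st3 by apply: static_run.
have [o0 _] := @collect_spec 0 akeep rm st2 isT isT.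
have [o1 o2] := @collect_spec 1 aX rn st3 isT isT.
rewrite -/st3 (st_m hst2) in o0; rewrite (st_n hst3) in o1.
split.
  have -> : spared X = [set x : 'I_m | arr st2 akeep 0 x != 0].
    by apply/setP=> b; rewrite [in RHS]inE hk.
  apply: (out_set_filter (P := fun x => arr st2 akeep 0 x != 0)).
  by rewrite -o0 /out_list !o2 //; apply: eq_mkseq => j; rewrite o2.
have -> : X = [set x : 'I_n | arr st3 aX 0 x != 0].
  by apply/setP=> v; rewrite [in RHS]inE run_arr.
exact: (out_set_filter (P := fun x => arr st3 aX 0 x != 0)).
Qed.

Section Found.

Variables (X : {set 'I_n}) (st : state).
Hypothesis X_small : #|X| < k.
Hypothesis X_out : out_set st 0 (spared X) /\ out_set st 1 X.

Let spared_disjoint b : b \in spared X -> [disjoint X & sverts (B b)].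
Proof. by rewrite inE. Qed.

Lemma cut_found_from :
  (forall i u, [disjoint X & bag i] -> u \in bag i ->
        ~~ reached (sarcs 0) (term 0) setT X u) ->
  found_separator_from c B s st.
Proof.
move=> hcut; exists (spared X), X; split=> //; [exact: card_spared | | lia].
move=> [x [p [y [/imsetP[j _ ex] /bigcupP[b bI yb] /and3P[pth _ /eqP ey] hX]]]].
have h := path_reached (e := sarcs 0) (s := term 0) pth ex hX.
by move/negP: (hcut b y (spared_disjoint bI) yb); rewrite -ey.
Qed.

Lemma cut_found_to :
  (forall i u, [disjoint X & bag i] -> u \in bag i ->
        ~~ reached (sarcs 1) (term 1) setT X u) ->
  found_separator_to c B t st.
Proof.
move=> hcut; exists (spared X), X; split=> //; [exact: card_spared | | lia].
move=> [x [p [y [/bigcupP[b bI xb] /imsetP[j _ ey] /and3P[pth _ /eqP el] hX]]]].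
have pth' : path (sarcs 1) (last x p) (rev (belast x p)) by rewrite rev_path.
have h := path_reached (s := term 1) (j := j) pth' _ _.
move/negP: (hcut b x (spared_disjoint bI) xb); apply.
have -> : x = last (last x p) (rev (belast x p)).
  by case: (p) => //= z q; rewrite rev_cons last_rcons.
apply: h; first by rewrite el ey.
have : all (fun v => v \notin X) (rcons (belast x p) (last x p)) by rewrite -lastI.
by rewrite all_rcons /= all_rev.
Qed.

End Found.


(** * The final linkage *)

(** The last computation of disjoint paths cannot fail.  A cut has fewer than [k]
    vertices, so [progress_spares] gives a final bag of the rounds that the cut
    misses and that is reached within [Hset]; this contradicts [cut_isolates]. *)
Lemma final_menger side st F : side < 2 -> static st -> reg st rfail = 0 ->
  progress (sarcs side) bag (term side) rho (Hset st side) F ->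
  (forall b, b \in F -> bag b \subset Hset st side) ->
  c * (k - 1) < #|Aset st| ->
  let st1 := run (menger side (Cell aH (Lit side) (Reg rx))) st in
  let f := arr st1 afwd 0 in
  [/\ static st1, reg st1 rfail = 0 & exists U : 'I_k -> 'I_m,
  [/\ injective U /\ (forall j, n + U j = orbit_at (term side) f j n),
      forall j, U j \in Aset st,
      forall j j' v, v \in orbit_set (term side) f j -> v \in orbit_set (term side) f j' -> j = j',
      forall j v, v \in orbit_set (term side) f j -> v \in Hset st side \/ v \in bag (U j)
    & forall j, exists u : 'I_n,
      [/\ u \in orbit_set (term side) f j, u \in bag (U j) &
        connect (orbit_arc (sarcs side) (term side) (Hset st side) f j) (term side j) u]]].
Proof.
move=> side2 hst rf prog bags hA st1 f.
have hst1 : static st1 by rewrite /st1; case: (side) side2 => [|[]] // _; apply: static_run.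
have [|adj adj_ok [hsrc hfwd hstate]] :=
  menger_spec (allow := Cell aH (Lit side) (Reg rx)) (allowf := fun x => arr st aH side x != 0)
    side2 (@src_lt_side side) (@src_inj_side side) hst _ rf.
  by move=> st2 x eH ltx ex; rewrite /= ex eH.
rewrite -/st1 in hsrc hfwd hstate.
have aV := adj_vertices adj_ok; have aB := adj_bags adj_ok.
case: hstate => [[rf1 mt_ok]|[rf1 hfail]]; last first.
  have [X [Y [h1 h2 h3]]] := failed_cut adj_ok hfail hsrc hfwd.
  have hX : #|X| < k by lia.
  have hr : c * (k - 1) < rho by rewrite /rho addn1.
  have [i [u [iF di ui hu]]] := progress_spares B_cong prog hr hX.
  have := cut_isolates (side_conn side) (side_touch side) B_cong
    (ltnW c_gt1) h1 hA h3 (bags i iF) di ui.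
  by rewrite hu.
split=> //.
have f_lt l : l < n -> f l < n + m by case/hfwd.
have mate_f l : l < n -> arr st1 amate 0 (f l) = l by case/hfwd.
have [U [h1 h2 h3 h4]] := linked_bags (@term_inj side) aV aB mt_ok f_lt mate_f.
exists U; split=> // j j' v.
exact: (orbit_set_inj (@term_inj side) aV mt_ok f_lt mate_f).
Qed.

Lemma walk_spec side st (i b : nat) : side < 2 -> static st -> reg st ri = i ->
  iter n (step n (arr st afwd 0)) (tm side i) = n + b ->
  let st1 := run (walk side) st in
  (forall b', arr st1 aavail 0 b' = if b' == b then 0 else arr st aavail 0 b') /\
  (forall r v, v < n -> (arr st1 aM r v != 0) = (arr st aM r v != 0) ||
     (r == i) && (has (fun d => iter d (step n (arr st afwd 0)) (tm side i) == v) (iota 0 n)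
                  || (bm b v != 0))).
Proof.
move=> side2 hst ei hb; set f := step n _ in hb *; set x0 := tm side i in hb *.
rewrite /walk run_seq run_set /= ei (st_term hst) // -/x0.
set st1 := set_reg st rcur x0.
have hst1 : static st1 by apply: (static_frame (p := LReg rcur (Lit _))) (run_frame _ _) hst.
rewrite run_seq; set st2 := run follow st1.
pose Inv j st2 := reg st2 rcur = iter j f x0 /\ forall r v, v < n ->
  (arr st2 aM r v != 0) = (arr st aM r v != 0) ||
     (r == i) && has (fun d => iter d f x0 == v) (iota 0 j).
have [h1 h2] : Inv (reg st1 rn) st2.
  apply: for_ind.
    by split=> //= r v _; rewrite andbF orbF.
  move=> j st3 ltj fr ej [IH1 IH2].
  have hst3 : static st3 by apply: static_frame fr hst1.
  have e3 : reg st3 ri = i by case: fr => ->.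
  have ef v : arr st3 afwd 0 v = arr st afwd 0 v by case: fr => _ ->.
  rewrite run_if /= IH1 (st_n hst3) nat_boolK addn1.
  set y := iter j f x0; split.
    by rewrite iterS -/y /f /step; case: ifP => lty; rewrite ?runE /= IH1 ?ef.
  move=> r v ltv; rewrite -[j.+1]addn1 iotaD has_cat [has _ (iota (0 + j) 1)]/= orbF -/y.
  case: ifP => lty.
    rewrite !runE /= e3 IH1 -/y; case: (eqVneq r i) => [->|ne] /=; last by rewrite IH2 ?(negbTE ne).
    case: (eqVneq v y) => [->|nv] /=; first by rewrite ?eqxx ?orbT.
    by rewrite IH2 // ?eqxx ?orbF.
  rewrite IH2 //; case: (eqVneq y v) lty => [->|_ _]; first by rewrite ltv.
  by rewrite orbF.
rewrite (st_n hst1) in h1 h2.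
have hst2 : static st2 by apply: static_run.
rewrite run_seq run_set run_seq run_cell /= h1 hb (st_n hst2) addKn.
set st3 := set_cell _ _ _ _ _.
have hst3 : static st3.
  apply: (static_frame (p := LReg rcur (Lit b) ;; SetRow aavail (Reg rcur) (Lit 0))) hst2 => //.
  exact: run_frame.
split.
  by move=> b'; rewrite run_arr //= run_arr.
move=> r v ltv.
rewrite (@mark_bag_spec _ _ _ _ _ _ _ _ aM _ b _ i rcur hst3) //; last first.
- by move=> st4 h; rewrite /= h //= run_reg.
rewrite ltv [arr st3 aM r v]/(arr st2 aM r v) /=.
by have := h2 r v ltv; case: (r == i) => //=; case: (bm b v != 0); rewrite ?orbT ?orbF.
Qed.

Lemma walks_spec side st (U : 'I_k -> 'I_m) : side < 2 -> static st ->
  (forall j, n + U j = orbit_at (term side) (arr st afwd 0) j n) ->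
  let st1 := run (walks side) st in
  Aset st1 = Aset st :\: [set U j | j : 'I_k] /\
  forall (j : 'I_k) (v : 'I_n), (arr st1 aM j v != 0) =
    [|| arr st aM j v != 0, [exists d : 'I_n, orbit_at (term side) (arr st afwd 0) j d == v]
      | v \in bag (U j)].
Proof.
move=> side2 hst hU.
pose Inv i st1 :=
  (forall b : 'I_m, (arr st1 aavail 0 b != 0) =
     (arr st aavail 0 b != 0) && [forall j : 'I_k, (j < i) ==> (U j != b)]) /\
  (forall (j : 'I_k) (v : 'I_n), (arr st1 aM j v != 0) = (arr st aM j v != 0) || (j < i) &&
    ([exists d : 'I_n, orbit_at (term side) (arr st afwd 0) j d == v] || (v \in bag (U j)))).
have [h1 h2] : Inv (reg st rk) (run (walks side) st).
  apply: for_ind.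
    split=> [b|j v] /=; last by rewrite orbF.
    by rewrite (introT forallP) ?andbT.
  move=> i st1; rewrite (st_k hst) => lti fr ei [IH1 IH2].
  have hst1 : static st1.
    by move: fr; case: (side) side2 => [|[]] // _ fr; apply: static_frame fr hst.
  have ef v : arr st1 afwd 0 v = arr st afwd 0 v by case: fr => _ ->.
  pose j := Ordinal lti.
  have eit d x : iter d (step n (arr st1 afwd 0)) x = iter d (step n (arr st afwd 0)) x.
    by elim: d => //= d ->; rewrite /step ef.
  have hb : iter n (step n (arr st1 afwd 0)) (tm side i) = n + U j.
    by rewrite eit hU.
  have [w1 w2] := walk_spec side2 hst1 ei hb.
  split=> [b|j' v] /=.
    rewrite w1; have -> : (b == U j :> nat) = (b == U j) by [].
    have [->|ne] := eqVneq b (U j).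
      apply/esym/negbTE; rewrite negb_and; apply/orP; right.
      by apply/forallPn; exists j; rewrite /= ltnSn eqxx.
    rewrite IH1; congr (_ && _); apply: eq_forallb => j'.
    rewrite [in RHS]ltnS [in RHS]leq_eqVlt; case: (eqVneq (j' : nat) i) => // e.
    have -> : j' = j by apply: val_inj.
    by rewrite /= ltnn eq_sym ne.
  rewrite w2 // IH2 [in RHS]ltnS [in RHS]leq_eqVlt.
  case: (eqVneq (j' : nat) i) => [e|ne] /=; last by rewrite orbF.
  have ej : j' = j by apply: val_inj.
  rewrite e ltnn /= orbF ej; congr (_ || (_ || _)); last by rewrite (bmE (U j)) nat_boolK.
  apply/hasP/existsP => [[d]|[d /eqP ed]].
    by rewrite mem_iota eit => /= ltd ed; exists (Ordinal ltd).
  by exists (d : nat); [rewrite mem_iota ltn_ord | rewrite eit -ed].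
rewrite (st_k hst) in h1 h2; split.
  apply/setP=> b; rewrite !inE h1 andbC; congr (_ && _).
  apply/forallP/idP => [h|h j].
    by apply/imsetP => -[j _ eb]; have := h j; rewrite ltn_ord eb eqxx.
  by rewrite ltn_ord; apply: contraNneq h => <-; apply: imset_f.
by move=> j v; rewrite h2 ltn_ord.
Qed.


Lemma route_graph_spec st i : static st -> reg st ri = i ->
  let st1 := run route_graph st in
  (forall x, x < n -> arr st1 amate 0 x = x) /\
  (forall x y, x < n -> y < n -> (arr st1 aadj x y != 0) =
     [&& arr st aM i x != 0, arr st aM i y != 0 & gm y x != 0]).
Proof.
move=> hst ei.
pose val x y := [&& arr st aM i x != 0, arr st aM i y != 0 & gm y x != 0].
pose Inv l st1 := (forall x, x < l -> arr st1 amate 0 x = x) /\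
  (forall x y, x < l -> y < n -> (arr st1 aadj x y != 0) = val x y).
suff : Inv (reg st rn) (run route_graph st) by rewrite (st_n hst).
apply: for_ind => // l st1; rewrite (st_n hst) => ltl fr el [IH1 IH2].
have hst1 : static st1 by apply: static_frame fr hst.
have e1 : reg st1 ri = i by case: fr => ->.
have eM r v : arr st1 aM r v = arr st aM r v by case: fr => _ ->.
rewrite run_seq; set st2 := run (SetRow amate (Reg rx) (Reg rx)) st1.
have hst2 : static st2 by apply: static_run.
have hadj x y : arr (run (LFor ry rn
       (LCell aadj (Reg rx) (Reg ry)
          (And (And (Cell aM (Reg ri) (Reg rx)) (Cell aM (Reg ri) (Reg ry)))
               (Cell aG (Reg ry) (Reg rx))))) st2) aadj x y =
    if (x == l) && (y < n) then val l y : nat else arr st1 aadj x y.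
  rewrite (@fill_spec ry rn aadj _ _ _ st2 l 0 (fun y => val l y : nat)).
    by rewrite (st_n hst2) subn0.
  move=> st3 y' fr3 ey lty; have hst3 : static st3 by apply: static_frame fr3 hst2.
  have el3 : reg st3 rx = l by case: fr3 => -> //; rewrite run_reg.
  have ei3 : reg st3 ri = i by case: fr3 => -> //; rewrite run_reg.
  have eM3 r v : arr st3 aM r v = arr st aM r v by case: fr3 => _ -> //; rewrite run_arr.
  split=> //; rewrite eval_andE eval_and /= el3 ey ei3 !eM3 (st_G hst3) /val.
  by rewrite andbA.
split=> [x|x y]; rewrite ltnS leq_eqVlt.
  move=> h /=; rewrite run_arr // /st2 run_cell /= el.
  by case: (eqVneq x l) h => [->|ne] //= ltx; exact: IH1.
move=> h lty /=; rewrite hadj lty andbT.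
by case: (eqVneq x l) h => [->|ne] /= h; [rewrite nat_boolK | exact: IH2].
Qed.

(** The parents of the vertices have smaller indices in [q], so the list is free
    of repetitions and reaches [y0] in time. *)
Lemma route_rest_spec st i (q : seq nat) (M : {set 'I_n}) (x0 y0 : 'I_n) :
  static st -> reg st ri = i -> reg st rstart = y0 -> reg st rcur = x0 -> reg st rcnt = 1 ->
  arr st aout i 1 = x0 ->
  (x0 = y0 \/ (x0 : nat) \in q) -> size q <= n ->
  (forall w : 'I_n, (w : nat) \in q -> w != y0 -> exists w' : 'I_n,
     [/\ arr st apar 0 w = w', (w' : nat) \in q, index (w' : nat) q < index (w : nat) q,
         Defs.arc G w w' & w' \in M]) ->
  let st1 := run route_rest st in
  exists P : seq 'I_n, [/\ reg st1 rcnt = (size P).+1,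
    forall j, j <= size P -> arr st1 aout i j.+1 = nth 0 (map val (x0 :: P)) j,
    dipath G x0 P y0, {subset P <= M}
  & forall r j, r != i -> arr st1 aout r j = arr st aout r j].
Proof.
move=> hst ei es ec en e0 hx0 szq hpar.
pose Inv l st1 := exists P : seq 'I_n, let w := last x0 P in
  [/\ [/\ reg st1 rcur = w, reg st1 rcnt = (size P).+1 &
      forall j, j <= size P -> arr st1 aout i j.+1 = nth 0 (map val (x0 :: P)) j],
      [/\ path (Defs.arc G) x0 P, uniq (x0 :: P) & {subset P <= M}],
      forall x : 'I_n, x \in x0 :: P -> index (w : nat) q <= index (x : nat) q,
      w = y0 \/ (w : nat) \in q /\ index (w : nat) q + l < n
    & forall r j, r != i -> arr st1 aout r j = arr st aout r j].
have : Inv (reg st rn) (run route_rest st).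
  apply: for_ind.
    exists [::] => /=; split=> //.
    - by split=> //; case.
    - by move=> x; rewrite inE => /eqP->.
    case: hx0 => [|x0q]; [by left | right; split=> //].
    by rewrite addn0; apply: leq_trans szq; rewrite index_mem.
  move=> l st1; rewrite (st_n hst) => ltl fr el [P].
  set w := last x0 P => -[[h1 h2 h3] [h4 h5 h6] h7 h8 h9].
  have es1 : reg st1 rstart = y0 by case: fr => ->.
  have ei1 : reg st1 ri = i by case: fr => ->.
  have ep v : arr st1 apar 0 v = arr st apar 0 v by case: fr => _ ->.
  rewrite run_if /= h1 es1 nat_boolK; case: eqP => [e|/eqP ne].
    by exists P; split=> //; left; apply: val_inj.
  case: h8 => [e|[wq hw]]; first by rewrite e eqxx in ne.
  have [w' [p1 p2 p3 p4 p5]] := hpar w wq ne.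
  exists (rcons P w'); rewrite last_rcons !runE /= ei1 h1 h2 ep p1 addn1; split.
  - rewrite size_rcons; split=> // j.
    rewrite leq_eqVlt => /orP[/eqP->|ltj].
      by rewrite !eqxx /= map_rcons nth_rcons size_map ltnn eqxx.
    have -> : (j.+1 == (size P).+2) = false by lia.
    rewrite andbF h3 // -[_ :: map _ (rcons _ _)]/(map val (rcons (x0 :: P) w')) map_rcons.
    by rewrite nth_rcons size_map /= ltj.
  - have wP : w' \notin x0 :: P by apply/negP => /h7; rewrite leqNgt p3.
    split; first by rewrite rcons_path h4.
      by rewrite -[_ && _]/(uniq (rcons (x0 :: P) w')) rcons_uniq wP h5.
    by move=> x; rewrite mem_rcons inE => /predU1P[->|/h6].
  - move=> x; rewrite -rcons_cons mem_rcons inE => /predU1P[->//|/h7 h].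
    by apply: leq_trans h; exact: ltnW.
  - by right; split=> //; lia.
  - by move=> r j rne; rewrite (negbTE rne) /= h9.
rewrite (st_n hst) => -[P [[h1 h2 h3] [h4 h5 h6] h7 h8 h9]]; exists P; split=> //.
rewrite /dipath h4 h5 /=; apply/eqP; case: h8 => // -[_]; lia.
Qed.

Lemma route_spec st (i : 'I_k) : static st -> reg st ri = i ->
  let M := [set v : 'I_n | arr st aM i v != 0] in
  connect (fun x y => [&& Defs.arc G x y, x \in M & y \in M]) (s i) (t i) ->
  let st1 := run route st in
  (exists P : seq 'I_n, [/\ out_list st1 i = map val (s i :: P),
     dipath G (s i) P (t i) & {subset P <= M}]) /\
  forall (r : nat) j, r != i -> arr st1 aout r j = arr st aout r j.
Proof.
move=> hst ei M hcon.
have [g1 g2] := route_graph_spec hst ei.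
rewrite /route 5!run_seq; set st1 := run route_graph st in g1 g2 *.
have hst1 : static st1 by apply: static_run.
have ei1 : reg st1 ri = i by rewrite run_reg.
set st2 := run route_setup st1; set st3 := run (search rn) st2.
set st4 := run route_first st3.
have hst2 : static st2 by apply: static_run.
have hst3 : static st3 by apply: static_run.
have hst4 : static st4 by apply: static_run.
have es2 : reg st2 rstart = t i by rewrite /= ei1 (st_term hst1) // tmE.
have ec2 : reg st2 rcur = s i.
  by rewrite /st2 /route_setup !runE /= ei1 (st_term hst1) // tmE.
have mt2 x : x < n -> arr st2 amate 0 x =
    if x == t i then t i : nat else if x == s i then n else x.
  by move=> ltx; rewrite /st2 /route_setup !runE /= ei1 !(st_term hst1) // (st_n hst1) !tmE g1.
have adj2 x y : x < n -> y < n -> (arr st2 aadj x y != 0) =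
     [&& arr st aM i x != 0, arr st aM i y != 0 & gm y x != 0].
  by move=> ltx lty; rewrite run_arr // g2.
have ei2 : reg st2 ri = i by rewrite run_reg.
have eo2 r j : arr st2 aout r j = arr st aout r j by rewrite run_arr // run_arr.
clearbody st2.
have [||q hq] := @search_spec rn n st2 (arr st2 amate 0) (fun x y => arr st2 aadj x y != 0)
   (fun=> erefl) (fun _ _ => erefl) (st_n hst2) isT.
- by rewrite es2 (st_n hst2).
- by rewrite es2 mt2 // eqxx neq_ltn ltn_ord.
rewrite /= -/st3 /search_rel es2 (st_n hst2) in hq.
pose arcq : rel nat := fun u w => arr st2 aadj (arr st2 amate 0 u) w != 0.
pose free : pred nat := fun w => arr st2 amate 0 w == n.
have mate_id (y : 'I_n) : ~~ free y -> arr st2 amate 0 y = y.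
  rewrite /free mt2 //; case: (eqVneq (y : nat) (t i)) => [->|_] //.
  by case: (eqVneq (y : nat) (s i)) => // _; rewrite eqxx.
have parents h w f : explored arcq free n (t i) h w f (arr st3 apar 0) q ->
  forall v : 'I_n, (v : nat) \in q -> v != t i -> exists v' : 'I_n,
     [/\ arr st3 apar 0 v = v', (v' : nat) \in q, index (v' : nat) q < index (v : nat) q,
         Defs.arc G v v' & v' \in M].
  move=> ex v vq vt.
  have hj : 0 < index (v : nat) q < size q.
    rewrite index_mem vq andbT lt0n; apply: contraNneq vt => e; apply/eqP/val_inj.
    by rewrite /= -(ex_head ex) -e nth_index.
  have [j' [lt1 lt2] [e1 e2]] := ex_par ex hj; rewrite nth_index // in e1 e2.
  have lt3 : j' < size q by lia.
  have v'q : nth 0 q j' \in q by rewrite mem_nth.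
  pose v' := Ordinal (ex_lt ex v'q).
  have nf : ~~ free v'.
    apply: (explored_mated ex) lt2 lt3.
    by rewrite /free mt2 // eqxx neq_ltn ltn_ord.
  move: e2; rewrite /arcq -[nth 0 q j']/(v' : nat) mate_id // adj2 // gmE.
  case/and3P=> h1 h2 h3; exists v'; split=> //; last by rewrite inE.
  by rewrite /= index_uniq // (ex_uniq ex).
have [q' [szq sq hpar]] : exists q' : seq nat, [/\ size q' <= n,
    s i = t i \/ (s i : nat) \in q'
  & forall v : 'I_n, (v : nat) \in q' -> v != t i -> exists v' : 'I_n,
     [/\ arr st3 apar 0 v = v', (v' : nat) \in q', index (v' : nat) q' < index (v : nat) q',
         Defs.arc G v v' & v' \in M]].
  (* If both ends coincide, the path is a single vertex, whatever the search
     has found. *)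
  have [e|nst] := eqVneq (s i) (t i); first by exists [::]; split=> //; left.
  have sz h w f : explored arcq free n (t i) h w f (arr st3 apar 0) q -> size q <= n.
    move=> ex; rewrite -[n](size_iota 0); apply: uniq_leq_size; first exact: ex_uniq ex.
    by move=> x /(ex_lt ex); rewrite mem_iota.
  exists q; case: hq => [[f0 [ex _ _ _]]|[f1 [h [[ex _ _ _] lth]]]]; last first.
    split; [exact: sz ex | right | exact: parents ex].
    case: (reg st3 rfound) ex f1 => [|w'] // ex _.
    have /and3P[fq ff _] := ex_found ex.
    have ltf := ex_lt ex fq; have : arr st2 amate 0 w' == n := ff; rewrite mt2 //.
    case: (eqVneq w' (t i : nat)) => _; first by rewrite -[_ == _]negbK neq_ltn ltn_ord.
    by case: (eqVneq w' (s i : nat)) => [<- //|_]; rewrite -[_ == _]negbK neq_ltn ltf.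
  rewrite f0 in ex; split; [exact: sz ex | right | exact: parents ex].
  have clos : forall p x, path (fun x y => [&& Defs.arc G x y, x \in M & y \in M]) x p ->
      ((last x p : 'I_n) : nat) \in q -> (x : nat) \in q.
    elim=> //= y p IH x /andP[/and3P[axy xM yM] pth] lq.
    have yq := IH y pth lq.
    have nf : ~~ free y := allP (ex_found ex) _ yq.
    apply: (ex_closed ex (i := index (y : nat) q)); rewrite ?index_mem //.
      by left.
    rewrite nth_index // mate_id // adj2 // gmE axy.
    by move: xM yM; rewrite !inE => -> ->.
  case/connectP: hcon => p pth lst; apply: (clos p) => //.
  by rewrite -lst -(ex_head ex) mem_nth // (ex_pos ex).
have [||||||||P [r1 r2 r3 r4 r5]] := @route_rest_spec st4 i q' M (s i) (t i) hst4.
- by rewrite run_reg // run_reg.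
- by rewrite run_reg // run_reg.
- by rewrite run_reg // run_reg.
- by [].
- by rewrite /st4 /route_first run_seq run_set run_cell /= !run_reg // ei2 ec2 !eqxx.
- by [].
- by [].
- by move=> v vq vt; rewrite run_arr //; exact: hpar.
rewrite run_cell /=; set st5 := run route_rest st4 in r1 r2 r3 r4 r5 *.
have e5 : reg st5 ri = i by rewrite run_reg // run_reg // run_reg.
rewrite e5 r1; split; last first.
  move=> r j ne; rewrite /= (negbTE ne) r5 //.
  rewrite /st4 /route_first run_seq run_set run_cell /= run_reg // ei2 (negbTE ne) /=.
  by rewrite run_arr // eo2.
exists P; split=> //.
rewrite /out_list /= !eqxx /=; apply: (@eq_from_nth _ 0).
  by rewrite size_mkseq /= size_map.
move=> j; rewrite size_mkseq ltnS => ltj.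
by rewrite nth_mkseq //= ?andbF r2.
Qed.


Lemma routes_spec st : static st ->
  (forall j : 'I_k, let M := [set v : 'I_n | arr st aM j v != 0] in
     connect (fun x y => [&& Defs.arc G x y, x \in M & y \in M]) (s j) (t j)) ->
  exists P : 'I_k -> seq 'I_n, forall j : 'I_k,
    [/\ out_list (run (LFor ri rk route) st) j = map val (s j :: P j),
        dipath G (s j) (P j) (t j)
      & {subset P j <= [set v : 'I_n | arr st aM j v != 0]}].
Proof.
move=> hst hcon.
suff H : forall j : 'I_k, exists P : seq 'I_n,
    [/\ out_list (run (LFor ri rk route) st) j = map val (s j :: P),
        dipath G (s j) P (t j)
      & {subset P <= [set v : 'I_n | arr st aM j v != 0]}].
  exact: fin_all_exists H.
move=> j0.
pose Inv i st1 := forall j : 'I_k, j < i -> exists P : seq 'I_n,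
  [/\ out_list st1 j = map val (s j :: P), dipath G (s j) P (t j)
    & {subset P <= [set v : 'I_n | arr st aM j v != 0]}].
suff: Inv (reg st rk) (run (LFor ri rk route) st).
  by apply; rewrite (st_k hst).
apply: for_ind => // i st1; rewrite (st_k hst) => lti fr ei IH.
have hst1 : static st1 by apply: static_frame fr hst.
have eM j v : arr st1 aM j v = arr st aM j v by case: fr => _ ->.
pose i' := Ordinal lti.
have eMs (j : 'I_k) : [set v : 'I_n | arr st1 aM j v != 0] = [set v : 'I_n | arr st aM j v != 0].
  by apply/setP=> v; rewrite !inE eM.
have [|[P [p1 p2 p3]] po] := @route_spec st1 i' hst1 ei.
  by rewrite eMs; exact: hcon.
move: (run route st1) p1 po => st2 p1 po.
move=> j; rewrite ltnS leq_eqVlt; case: (eqVneq (j : nat) i) => [e _|ne /= ltj].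
  have -> : j = i' by apply: val_inj.
  by exists P; rewrite -eMs.
have [P' [q1 q2 q3]] := IH j ltj; exists P'; split; [|exact: q2|exact: q3].
apply: etrans q1; rewrite /out_list /= po //.
by apply: eq_mkseq => l; exact: po.
Qed.

(** The [j]-th path exists within the union of the [j]-th path from [s], its
    final bag [U1 j], the bag [U2 j], which touches [U1 j], and the [j]-th path
    to [t]; [final_load] bounds the number of these unions at a vertex. *)
Lemma finish_spec st (F1 F2 : {set 'I_m}) :
  static st -> reg st rfail = 0 -> (forall i v, arr st aM i v = 0) ->
  k + c * (k - 1) < #|Aset st| ->
  [disjoint F1 & F2] -> [disjoint F1 & Aset st] -> [disjoint F2 & Aset st] ->
  progress (sarcs 0) bag (term 0) rho (Hset st 0) F1 ->
  progress (sarcs 1) bag (term 1) rho (Hset st 1) F2 ->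
  (forall b, b \in F1 -> bag b \subset Hset st 0) ->
  (forall b, b \in F2 -> bag b \subset Hset st 1) ->
  (forall v, v \in Hset st 0 -> (exists2 b, b \in F1 & v \in bag b) \/
     (forall b, b \in Aset st -> v \notin bag b)) ->
  (forall v, v \in Hset st 1 -> (exists2 b, b \in F2 & v \in bag b) \/
     (forall b, b \in Aset st -> v \notin bag b)) ->
  found_linkage c G s t (run finish st) /\ reg (run finish st) rres = 3.
Proof.
move=> hst rf M0 hA d12 d1A d2A pr1 pr2 bg1 bg2 set1 set2.
rewrite /finish 5!run_seq; set st1 := run (menger 0 _) st.
have hA1 : c * (k - 1) < #|Aset st| by lia.
have [hst1 rf1 [U1 [[U1i U1e] U1A O1i O1H O1c]]] :=
  final_menger (isT : 0 < 2) hst rf pr1 bg1 hA1.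
rewrite -/st1 in hst1 rf1 U1i U1e U1A O1i O1H O1c.
set f1 := arr st1 afwd 0 in U1e O1i O1H O1c.
have eA1 : Aset st1 = Aset st by apply/setP=> b; rewrite !inE run_arr.
set st2 := run (walks 0) st1.
have [w1 w2] := walks_spec (isT : 0 < 2) hst1 U1e.
rewrite -/st2 in w1 w2.
have hst2 : static st2 by apply: static_run.
have rf2 : reg st2 rfail = 0 by rewrite run_reg.
have eH2 : Hset st2 1 = Hset st 1.
  by apply/setP=> v; rewrite !inE run_arr // run_arr.
have hA2 : c * (k - 1) < #|Aset st2|.
  have hI : #|Aset st :&: [set U1 j | j : 'I_k]| <= k.
    apply: leq_trans (subset_leq_card (subsetIr _ _)) _.
    by apply: leq_trans (leq_imset_card _ _) _; rewrite card_ord.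
  rewrite w1 eA1 -(ltn_add2l #|Aset st :&: [set U1 j | j : 'I_k]|) cardsID.
  by apply: leq_ltn_trans hA; rewrite leq_add2r.
set st3 := run (menger 1 _) st2.
have [||hst3 rf3 [U2 [[U2i U2e] U2A O2i O2H O2c]]] :=
  final_menger (isT : 1 < 2) hst2 rf2 (F := F2) _ _ hA2.
- by rewrite eH2.
- by rewrite eH2.
rewrite -/st3 eH2 in hst3 rf3 U2i U2e U2A O2i O2H O2c.
set f2 := arr st3 afwd 0 in U2e O2i O2H O2c.
set st4 := run (walks 1) st3.
have [_ w4] := walks_spec (isT : 1 < 2) hst3 U2e.
rewrite -/st4 in w4.
have hst4 : static st4 by apply: static_run.
pose O1 := orbit_set (term 0) f1; pose O2 := orbit_set (term 1) f2.
pose M j := [set v : 'I_n | arr st4 aM j v != 0].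
have MP (j : 'I_k) v : (v \in M j) = [|| v \in O1 j, v \in bag (U1 j), v \in bag (U2 j) | v \in O2 j].
  have eM3 : arr st3 aM j v = arr st2 aM j v by rewrite /st3 run_arr.
  have eM1 : arr st1 aM j v = 0 by rewrite /st1 run_arr.
  rewrite inE w4 eM3 w2 eM1 eqxx /O1 /O2 [v \in orbit_set _ f1 _]inE
    [v \in orbit_set _ f2 _]inE.
  rewrite [~~ true]/= orFb -!orbA; congr (_ || (_ || _)); exact: orbC.
have hcon (j : 'I_k) : connect (fun x y => [&& Defs.arc G x y, x \in M j & y \in M j]) (s j) (t j).
  set R := (fun x y => _).
  have [u1 [u1O u1b c1]] := O1c j; have [u2 [u2O u2b c2]] := O2c j.
  have h1 : connect R (s j) u1.
    apply: connect_sub c1 => x y /and5P[axy _ _ xO yO]; apply: connect1.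
    by rewrite /R (axy : Defs.arc G x y) !MP /O1 xO yO.
  have h2 : connect R u2 (t j).
    have : connect (fun x y => R y x) (t j) u2.
      apply: connect_sub c2 => x y /and5P[axy _ _ xO yO]; apply: connect1.
      by rewrite /R (axy : Defs.arc G y x) !MP /O2 xO yO !orbT.
    by move=> h; exact: etrans (esym (connect_rev R (t j) u2)) h.
  have hb i x y : (i = U1 j \/ i = U2 j) -> x \in bag i -> y \in bag i -> connect R x y.
    move=> hi xi yi; apply: connect_sub (bag_strong xi yi) => a b.
    move=> /and3P[aab ai bi]; apply: connect1; rewrite /R aab !MP.
    by case: hi => <-; rewrite /bag ai bi !orbT.
  apply: connect_trans h1 _; apply: connect_trans _ h2.
  case: (side_touch 0 (U1 j) (U2 j)) => [[v v1 v2]|[x [y [x1 y2 axy]]]].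
    by apply: (connect_trans (hb _ _ _ (or_introl erefl) u1b v1)); apply: hb v2 u2b; right.
  apply: (connect_trans (hb _ _ _ (or_introl erefl) u1b x1)).
  apply: (@connect_trans _ _ y); last by apply: hb y2 u2b; right.
  by apply: connect1; rewrite /R (axy : Defs.arc G x y) !MP /bag x1 y2 !orbT.
have [P hP] := routes_spec hst4 hcon.
split; last by [].
exists P; split=> [l|l|v]; first by have [] := hP l.
  by have [] := hP l.
apply: (@leq_trans #|[set j | [|| v \in O1 j, v \in bag (U1 j), v \in bag (U2 j) | v \in O2 j]]|).
  apply: subset_leq_card; apply/subsetP=> l; rewrite inE in_cons [l \in _]inE -MP.
  case/predU1P=> [->|vP]; last by have [_ _ /(_ v vP)] := hP l.
  rewrite MP; apply/orP; left; rewrite inE; apply/existsP.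
  have n_gt0 : 0 < n by apply: leq_ltn_trans (ltn_ord (s l)).
  by exists (Ordinal n_gt0); rewrite /orbit_at /= at_ordE.
apply: (final_load c_gt1 (B_cong v) d12 d1A d2A U1i U2i _ U1A) => //.
- by move=> j j'; have := U2A j'; rewrite w1 in_setD => /andP[h _]; apply: contraNneq h => <-; apply: imset_f.
- by move=> j; have := U2A j; rewrite w1 eA1 in_setD => /andP[].
- by move=> j j'; exact: O1i.
- by move=> j j'; exact: O2i.
- by move=> j; exact: O1H.
- by move=> j; exact: O2H.
- exact: set1.
- exact: set2.
Qed.


(** The [rho] rounds of each side use at most [k * rho] bags, out of at least
    [2 * k * (rho + 1) + c * (k - 1)]: until the last computation of paths, more
    than [c * (k - 1)] bags are available. *)
Lemma linkage_correct st : static st -> reg st rfail = 0 ->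
  (forall i v, arr st aH i v = 0) -> (forall i v, arr st aM i v = 0) ->
  let st1 := run linkage st in
  correct_output c B s t (set_reg st1 rn (reg st1 rres)).
Proof.
move=> hst rf H0 M0.
have hm : 2 * (k * rho) + 2 * k + c * (k - 1) <= m.
  apply: leq_trans m_large; rewrite /g /rho.
  have -> : c * k - c + 2 = c * (k - 1) + 2 by rewrite mulnBr muln1.
  by rewrite -mulnA -!mulnDr; nia.
rewrite /linkage run_seq; set st1 := run (LFor _ _ _) st.
have hst1 : static st1 by apply: static_run.
have rf1 : reg st1 rfail = 0 by rewrite run_reg.
have eA1 : Aset st1 = setT.
  apply/setP=> b; rewrite !inE /st1 (@fill_spec rx rm aavail _ _ _ st 0 0 (fun=> 1)) //.
  by rewrite (st_m hst) /= ltn_ord.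
rewrite run_seq; set st2 := run (rounds 0) st1.
have hc1 : k * rho + c * (k - 1) < #|Aset st1| by rewrite eA1 cardsT card_ord; lia.
have hH1 (v : 'I_n) : v \notin Hset st1 0 by rewrite !inE run_arr // H0.
have [hst2 hs2] := rounds_spec (isT : 0 < 2) hst1 rf1 hc1 hH1.
rewrite -/st2 in hst2 hs2.
rewrite run_if /=; case: hs2 => [[rf2 [i1 i2 i3 i4 i5 i6]]|[rf2 [X [X1 X2 X3]]]]; rewrite rf2 /=; last first.
  constructor 1; split=> //; rewrite run_seq.
  have hout := output_cut_spec hst2 X2.
  exact: (cut_found_from (st := run output_cut st2) X1 hout X3).
rewrite run_seq; set st3 := run (rounds 1) st2.
have cA2 : m - k * rho <= #|Aset st2|.
  have := cardsCs (Aset st2); rewrite card_ord -setTD -eA1; lia.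
have hc2 : k * rho + c * (k - 1) < #|Aset st2| by lia.
have hH2 (v : 'I_n) : v \notin Hset st2 1.
  by rewrite !inE i6 // run_arr // H0.
have [hst3 hs3] := rounds_spec (isT : 1 < 2) hst2 rf2 hc2 hH2.
rewrite -/st3 in hst3 hs3.
rewrite run_if /=; case: hs3 => [[rf3 [j1 j2 j3 j4 j5 j6]]|[rf3 [X [X1 X2 X3]]]]; rewrite rf3 /=; last first.
  constructor 2; split=> //; rewrite run_seq.
  have hout := output_cut_spec hst3 X2.
  exact: (cut_found_to (st := run output_cut st3) X1 hout X3).
have eH3 : Hset st3 0 = Hset st2 0 by apply/setP=> v; rewrite !inE j6.
have cA3 : #|Aset st2| <= #|Aset st3| + k * rho.
  have := cardsID (Aset st3) (Aset st2); rewrite (setIidPr j1); lia.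
have [] : found_linkage c G s t (run finish st3) /\ reg (run finish st3) rres = 3.
  apply: (@finish_spec st3 (Aset st1 :\: Aset st2) (Aset st2 :\: Aset st3)) => //.
  - by move=> i v; rewrite run_arr // run_arr // run_arr.
  - by lia.
  - rewrite -setI_eq0; apply/eqP/setP=> b; rewrite !in_setI !in_setD in_set0.
    by case: (b \in Aset st2); rewrite ?andbF.
  - rewrite -setI_eq0; apply/eqP/setP=> b; rewrite !in_setI !in_setD in_set0.
    have := subsetP j1 b; case: (b \in Aset st3) => [-> //|_]; by rewrite andbF.
  - rewrite -setI_eq0; apply/eqP/setP=> b; rewrite !in_setI !in_setD in_set0.
    by case: (b \in Aset st3); rewrite ?andbF.
  - by rewrite eH3.
  - by rewrite eH3.
  - move=> v; rewrite eH3 => /i5[h|h]; [by left | right=> b bA].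
    by apply: h; exact: (subsetP j1).
by move: (run finish st3) => st4 hl hr; constructor 3.
Qed.

(** No bag is empty, so the bags are hit by the set of all vertices. *)
Lemma size_le : m <= c * n.
Proof.
have := card_hit B_cong (bag := bag) [set: 'I_n]; rewrite cardsT card_ord.
apply: leq_trans; rewrite -[leqLHS]card_ord -cardsT; apply: subset_leq_card.
apply/subsetP=> b _; rewrite inE -setI_eq0 setTI; apply/set0Pn.
exact: (bag_neq0).
Qed.


End Main.

(** * Running time and correctness *)

Lemma init_spec n k c m (G : digraph 'I_n) (B : 'I_m -> subgraph G) (s t : 'I_k -> 'I_n) :
  let st := run init_rounds (run init_size (input c B s t)) in
  [/\ static n k c m (c * (k - 1) + 1) (gm G) (bm B) (tm s t) st, reg st rfail = 0,
      forall i v, arr st aH i v = 0 & forall i v, arr st aM i v = 0].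
Proof.
set st0 := input c B s t; set st1 := run init_size st0 => st.
have hrho : reg st rrounds = c * (k - 1) + 1.
  have -> : k - 1 = reg st1 rk1 by [].
  apply: (for_ind (Inv := fun i st => reg st rrounds = c * i + 1)).
    by rewrite muln0.
  move=> i st2 lti fr ei IH; rewrite /= IH.
  have -> : reg st2 rc = c by case: fr => ->.
  by rewrite mulnS; lia.
have er x : x \notin written_regs init_rounds -> reg st x = reg st1 x by exact: run_reg.
split; try by move=> i v; rewrite run_arr // run_arr.
  split; try exact: er; first exact: hrho.
  - by move=> u v; rewrite run_arr // run_arr.
  - by move=> b v; rewrite run_arr // run_arr.
  - by move=> i j; rewrite run_arr // run_arr //; case: i => [|[]].
by rewrite run_reg // run_reg.
Qed.

(** The registers bounding the loops over vertices, bags and nodes; the other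
    loops are bounded by [rk], [rk1] and [rrounds], hence by a multiple of [k]. *)
Definition vertex_bound : pred nat := pred3 rn rm rN.

(** The arguments [x], [y], [z] are the code sizes of the three parts of the
    program; the loops of the last part are nested twice in each kind. *)
Lemma time_arith c k n x y z :
  0 < k -> 0 < n -> 0 < c ->
  x + (y * ((c + 1) * k) + (z * (((c + 2) * n) ^ 2 * ((c + 1) * k) ^ 2) + 2)) <=
  (x + y + z + 2) * (((c + 2) * (c + 1)) ^ 2) * (k ^ 4 * n ^ 2).
Proof.
move=> k0 n0 c0; set D := (c + 2) * n; set K := (c + 1) * k.
have K0 : 0 < K by rewrite muln_gt0 addn1.
have D0 : 0 < D by rewrite muln_gt0 addn2.
set W := D ^ 2 * K ^ 2.
have W0 : 0 < W by rewrite muln_gt0 !expn_gt0 D0 K0.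
have KW : K <= W.
  have h : K <= K ^ 2 by rewrite -[leqLHS]expn1 leq_pexp2l.
  by apply: leq_trans h _; rewrite leq_pmull ?expn_gt0 ?D0.
have WE : W <= ((c + 2) * (c + 1)) ^ 2 * (k ^ 4 * n ^ 2).
  rewrite /W /D /K !expnMn mulnACA leq_mul2l; apply/orP; right.
  by rewrite mulnC leq_mul2r leq_pexp2l ?orbT.
rewrite -mulnA; apply: leq_trans (_ : (x + y + z + 2) * W <= _); last by rewrite leq_mul2l WE orbT.
rewrite !mulnDl -!addnA; apply: leq_add; first by rewrite leq_pmulr.
apply: leq_add; first by rewrite leq_mul2l KW orbT.
by rewrite leq_add2l leq_pmulr.
Qed.

Theorem theorem33 :
  exists prog : cmd, forall c : nat, 2 <= c ->
  exists C : nat,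
  forall (k n m : nat) (G : digraph 'I_n) (B : 'I_m -> subgraph G)
         (s t : 'I_k -> 'I_n),
    2 <= k ->
    bramble B -> congestion B c -> g k c <= m ->
    injective s -> injective t ->
    exists (T : nat) (st : state),
      [/\ exec prog (input c B s t) T st,
          T <= C * (k ^ 4 * n ^ 2)
        & correct_output c B s t st].
Proof.
exists program => c c2.
exists ((code_size init_size + code_size init_rounds + code_size linkage + 2) *
   (((c + 2) * (c + 1)) ^ 2)).
move=> k n m G B s t k2 Bb Bc gm s_inj t_inj.
have k0 : 0 < k by apply: ltnW.
have n0 : 0 < n by apply: leq_ltn_trans (ltn_ord (s (Ordinal k0))).
have c0 : 0 < c by apply: ltnW.
have lemn := size_le Bb Bc.
set D := (c + 2) * n; set K := (c + 1) * k.
have D0 : 0 < D by rewrite muln_gt0 addn2.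
have K0 : 0 < K by rewrite muln_gt0 addn1.
set st0 := input c B s t.
have [t1 e1 h1] : exists2 T, exec (compile init_size) st0 T (run init_size st0) &
    T <= code_size init_size.
  have [||T r h] := @run_time vertex_bound 1 1 init_size st0 isT isT isT; try by [].
  by exists T; rewrite // -[code_size _]muln1.
set st1 := run init_size st0 in e1.
have [|||t2 e2 h2] := @run_time vertex_bound D K init_rounds st1 D0 K0.
- by [].
- by move=> h; rewrite inE => /eqP->.
- move=> h; rewrite inE => /eqP-> /=; rewrite /K; lia.
set st2 := run init_rounds st1 in e2.
have [hst rf H0 M0] := init_spec c B s t.
rewrite -/st0 -/st1 -/st2 in hst rf H0 M0.
have [|||t3 e3 h3] := @run_time vertex_bound D K linkage st2 D0 K0.
- by [].
- by apply/allP.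
- have hn : n < D by rewrite /D; lia.
  have hm : m < D by rewrite /D; lia.
  have hN : n + m < D by rewrite /D; lia.
  have hk : k < K by rewrite /K; lia.
  have hrho : c * (k - 1) + 1 < K by rewrite /K; nia.
  have hb : all (mem [:: rn; rm; rN; rk; rrounds]) (bound_regs linkage) by [].
  move=> h /(allP hb); rewrite /= !inE => /or4P[/eqP->|/eqP->|/eqP->|/orP[]/eqP->] /=.
  + by rewrite (st_n hst).
  + by rewrite (st_m hst).
  + by rewrite (st_N hst).
  + by rewrite (st_k hst).
  + by rewrite (st_rho hst).
set st3 := run linkage st2 in e3.
exists (t1 + (t2 + (t3 + 2))), (set_reg st3 rn (reg st3 rres)); split.
- apply: exec_seq e1 _; apply: exec_seq e2 _; apply: exec_seq e3 _.
  exact: (exec_set_reg st3 rn (Reg rres)).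
- apply: leq_trans (time_arith _ _ _ k0 n0 c0); rewrite -/D -/K.
  apply: leq_add => //; apply: leq_add.
    by move: h2; rewrite expn0 mul1n expn1.
  by rewrite leq_add2r.
- exact: (linkage_correct k0 c2 Bb Bc s_inj t_inj gm hst rf H0 M0).
Qed.
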